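(* Let $p\in\mathbb{C}[z,w]$ be a polynomial of degree $(n,m)$ that defines a distinguished variety, and let $V=\{(z,w)\in\mathbb{C}^2:p(z,w)=0\}$, assumed non-empty. Let $a,b\ge 0$ be real numbers, not both zero. Then there exist a $\mathbb{C}^n$-valued polynomial $\vec{P}(z,w)$ of degree at most $(n-1,m)$ and a $\mathbb{C}^m$-valued polynomial $\vec{Q}(z,w)$ of degree at most $(n,m-1)$ such that for all $(z,w)\in\mathbb{C}^2$ \[ (bm-an)|p(z,w)|^2+2\,\mathrm{Re}\big[(azp_z(z,w)-bwp_w(z,w))\overline{p(z,w)}\big]+(1-|z|^2)|\vec{P}(z,w)|^2=(1-|w|^2)|\vec{Q}(z,w)|^2 . \] If $p$ is a product of distinct irreducible factors, then none of the entries of $\vec{P}$ or $\vec{Q}$ can vanish identically on $V$. Moreover, for all $(z,w),(Z,W)\in V$, \[ (1-z\bar Z)\langle\vec{P}(z,w),\vec{P}(Z,W)\rangle=(1-w\bar W)\langle\vec{Q}(z,w),\vec{Q}(Z,W)\rangle . \]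
   Context: $\mathbb{D}$ is the open unit disk in $\mathbb{C}$, $\mathbb{T}$ the unit circle, $\mathbb{E}=\mathbb{C}\setminus\overline{\mathbb{D}}$. A polynomial $p\in\mathbb{C}[z,w]$ defines a distinguished variety if $\{(z,w)\in\mathbb{C}^2:p(z,w)=0\}\subset\mathbb{D}^2\cup\mathbb{T}^2\cup\mathbb{E}^2$; the distinguished variety is identified with this zero set in $\mathbb{C}^2$ and is by definition non-empty. A polynomial has degree $(n,m)$ if it has degree $n$ in $z$ and $m$ in $w$; degree at most $(n,m)$ means degree at most $n$ in $z$ and at most $m$ in $w$. A vector-valued polynomial has degree at most $(j,k)$ if each component does. $p_z,p_w$ are partial derivatives. For vectors, $\langle\cdot,\cdot\rangle$ is the standard inner product $\langle u,v\rangle=\sum_j u_j\overline{v_j}$ and $|\cdot|$ is the Euclidean length. *)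

(* Defs.v *)
(* C[z, w] is {poly {poly C}} with z the outer and w the inner variable, as in
   polyXY: p.[z, w] := p.[z%:P].[w], size p = 1 + deg_z p and
   sizeY p = 1 + deg_w p (both 0 when p = 0). *)
From HB Require Import structures.
From mathcomp Require Import all_boot all_order all_algebra.
From mathcomp Require Import spectral polyXY.
From mathcomp Require Import complex.
From mathcomp Require Import classical_sets reals.

Set Implicit Arguments.
Unset Strict Implicit.
Unset Printing Implicit Defensive.

Import Order.TTheory GRing.Theory Num.Theory.
Local Open Scope classical_set_scope.
Local Open Scope ring_scope.

Section BivariatePolynomials.
Variable C : numClosedFieldType.
Implicit Types p q r : {poly {poly C}}.

(* The zero polynomial has no bidegree. *)
Definition has_bidegree p (n m : nat) : Prop :=
  size p = n.+1 /\ sizeY p = m.+1.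

(* Strict bounds: "degree less than j in z and less than k in w", so that
   "degree at most (n - 1, m)" reads [bidegree_lt q n m.+1] without truncated
   subtraction. *)
Definition bidegree_lt q (j k : nat) : Prop :=
  (size q <= j)%N /\ (sizeY q <= k)%N.

Definition dz p : {poly {poly C}} := p^`().
Definition dw p : {poly {poly C}} := map_poly (@deriv C) p.

Definition evalv (d : nat) (P : 'rV[{poly {poly C}}]_d) (z w : C) : 'rV[C]_d :=
  \row_j (P 0 j).[z, w].

(* Irreducibility in the ring C[z, w]; [irreducible_poly] at this type would be
   irreducibility over the fraction field of C[w]. *)
Definition irreducible2 q : Prop :=
  [/\ q != 0, q \isn't a GRing.unit &
      forall r s : {poly {poly C}}, q = r * s ->
        r \is a GRing.unit \/ s \is a GRing.unit].

Definition associated2 q r : Prop :=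
  exists2 u : {poly {poly C}}, u \is a GRing.unit & q = u * r.

(* Factors are distinct up to units, since otherwise z * (2 z) would qualify. *)
Definition product_of_distinct_irreducibles p : Prop :=
  exists (k : nat) (q : 'I_k -> {poly {poly C}}),
    [/\ forall i, irreducible2 (q i),
        forall i j, i != j -> ~ associated2 (q i) (q j) &
        p = \prod_(i < k) q i].

Definition zero_set p : set (C * C) := [set x | p.[x.1, x.2] = 0].

Definition unit_disk : set C := [set z | `|z| < 1].
Definition unit_circle : set C := [set z | `|z| = 1].
Definition disk_exterior : set C := [set z | 1 < `|z|].

Definition defines_distinguished_variety p : Prop :=
  zero_set p `<=` (unit_disk `*` unit_disk) `|` (unit_circle `*` unit_circle)
                  `|` (disk_exterior `*` disk_exterior).

(* [dotmx u v] is \sum_j u_j * (v_j)^*. *)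
Definition eucl_norm (d : nat) (u : 'rV[C]_d) : C := sqrtC (dotmx u u).

End BivariatePolynomials.

(* Main.v *)
(* Put q(z, w) = w^m p(z, 1/w).  As p defines a distinguished variety, q has no
   zeros in the closed bidisc off the torus and is, up to a unimodular constant,
   equal to its reflection q~(z, w) = z^n w^m conj (q (1 / conj z, 1 / conj w)).
   The dilates q_t(z, w) = q((1 - a t) z, (1 - b t) w) have no zeros in the closed
   bidisc at all, so they satisfy
     |q_t|^2 - |q_t~|^2 = (1 - |z|^2) |P_t|^2 + (1 - |w|^2) |Q_t|^2
   with n + m squares.  Dividing by 2 t and letting t tend to 0 along an
   ultrafilter turns the left-hand side into the logarithmic derivative expression
   of the theorem; then w is replaced by 1/w.

   The identity for stable q is obtained as follows.  For |w| = 1 the Bezoutian of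
   q(., w) is positive definite (Schur-Cohn), so by the matrix Fejer-Riesz theorem
   it equals A(w)^* A(w) with A outer.  The terms with A account for P, and what
   is left is (1 - |w|^2) times a positive kernel Q^* Q.  A lurking isometry
   argument compares determinants and shows that Q needs at most m rows.

   If P or Q vanished on V, then so would a z p_z - b w p_w off the torus, which is
   impossible for square-free p.  Hence P and Q are nonzero at some points of V,
   and constant unitary changes of coordinates make all entries nonzero there. *)
Require Import Defs.
From HB Require Import structures.
From mathcomp Require Import all_boot all_order all_algebra.
From mathcomp Require Import spectral polyXY.
From mathcomp Require Import complex.
From mathcomp Require Import classical_sets reals.
From mathcomp Require Import boolp filter cyclic separable cyclotomic.
From mathcomp Require Import ring lra zify.

Set Implicit Arguments.
Unset Strict Implicit.
Unset Printing Implicit Defensive.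

Import Order.TTheory GRing.Theory Num.Theory.
Local Open Scope classical_set_scope.
Local Open Scope ring_scope.
Local Open Scope sesquilinear_scope.

(** * Limits along an ultrafilter *)

(** For q itself |q|^2 - |q~|^2 vanishes identically, so the stable case is empty at t = 0 and all
    information sits in the first-order term in t. With x = 1 - a t and y = 1 - b t, the coefficient
    of conj z^j conj w^k z^j' w^k' in |q_t|^2 - |q_t~|^2 is conj q_jk q_j'k' times x^(j+j') y^(k+k')
    - x^(2n-j-j') y^(2m-k-k'). The derivative of the last factor at t = 0 is 2 (a (n - j - j') + b
    (m - k - k')), which is why one divides by 2 t. The numbers of squares have to be n and m
    already before the limit, because the limit is taken square by square. This is why the bound on
    the rows of Q needs a proof of its own. The identities are kept as identities between
    coefficients of sesquilinear kernels. The replacement of w by 1/w is then a reversal of indices,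
    the bounds needed for compactness are telescoping sums, and the identity for pairs of points of
    V is obtained together with the one on the diagonal. *)

Lemma free_ultrafilter_ex : exists U : set_system nat,
  UltraFilter U /\ forall N, U [set k | (N <= k)%N].
Proof.
have [U [Uu UF]] := @ultraFilterLemma nat (\oo) _.
by exists U; split=> // N; apply: UF; exists N.
Qed.

(** One ultrafilter is fixed once and for all, so that all coefficients converge along the same
    filter and no subsequences have to be extracted. *)
Definition ufilter : set_system nat := projT1 (cid free_ultrafilter_ex).

Lemma ufilter_ultra : UltraFilter ufilter.
Proof. exact: (projT2 (cid free_ultrafilter_ex)).1. Qed.
#[local] Existing Instance ufilter_ultra.

Lemma ufilter_ge N : ufilter [set k | (N <= k)%N].
Proof. exact: (projT2 (cid free_ultrafilter_ex)).2. Qed.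

Lemma ufilter_not (A : set nat) : ~ ufilter A -> ufilter (~` A).
Proof. by have [|//] := in_ultra_setVsetC A ufilter_ultra. Qed.

Section Ulim.
Variable R : realType.
Local Notation C := R[i].
Implicit Types (u v : nat -> C) (l : C).

Definition ulim u l := forall e : C, 0 < e -> ufilter [set k | `|u k - l| < e].

Definition cbounded u := exists M : C, forall k, `|u k| <= M.

(** The limit is the supremum of the x that lie below [v k] for almost all k. Nothing above it has
    this property, and in an ultrafilter the failure of a condition means that its negation holds
    almost everywhere. *)
Lemma ulim_real (v : nat -> R) (M : R) : (forall k, `|v k| <= M) ->
  exists l : R, forall e, 0 < e -> ufilter [set k | `|v k - l| < e].
Proof.
move=> vM; pose S := [set x | ufilter [set k | x <= v k]].
have SM : ubound S M.
  move=> x Sx; rewrite leNgt; apply/negP => Mx.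
  have [k /= xk] := @filter_ex _ _ _ _ Sx.
  by have := vM k; rewrite ler_norml => /andP[_]; lra.
have S0 : has_sup S.
  split; last by exists M.
  exists (- M); rewrite /S /=.
  apply: (@filterS _ _ _ setT) => [k _ /=|]; last exact: filterT.
  by have := vM k; rewrite ler_norml => /andP[].
exists (sup S) => e e0.
have [x Sx xl] := sup_adherent e0 S0.
have nS : ~ S (sup S + e).
  by move=> h; have := sup_upper_bound S0 h; lra.
apply: (filterS _ (filterI Sx (ufilter_not nS))) => k /= [xv /negP]; rewrite -ltNge => vl.
by rewrite ltr_norml; apply/andP; split; lra.
Qed.

Lemma ler_norm_ReIm (z : C) :
  `|z| <= (`|complex.Re z| + `|complex.Im z|)%:C%C.
Proof.
case: z => x y /=.
rewrite normc_def /= lecR -[leRHS]ger0_norm ?addr_ge0 //.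
rewrite -sqrtr_sqr ler_wsqrtr // sqrrD !real_normK ?num_real //.
have : 0 <= `|x| * `|y| by rewrite mulr_ge0.
by lra.
Qed.

Lemma ler_Re_norm (z : C) : (`|complex.Re z|)%:C%C <= `|z|.
Proof.
case: z => x y /=; rewrite normc_def /= lecR -sqrtr_sqr ler_wsqrtr //.
by rewrite lerDl sqr_ge0.
Qed.

Lemma ler_Im_norm (z : C) : (`|complex.Im z|)%:C%C <= `|z|.
Proof.
case: z => x y /=; rewrite normc_def /= lecR -sqrtr_sqr ler_wsqrtr //.
by rewrite lerDr sqr_ge0.
Qed.

Lemma posC_real (e : C) : 0 < e -> exists2 r : R, 0 < r & e = (r%:C)%C.
Proof.
by case: e => a b; rewrite ltcE /= => /andP[/eqP -> a0]; exists a.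
Qed.

Lemma ulim_ex u : cbounded u -> exists l, ulim u l.
Proof.
move=> [M uM].
have M0 : 0 <= M by apply: le_trans (uM 0%N).
have [r Mr] : exists r : R, M = (r%:C)%C.
  by case: M M0 {uM} => a b; rewrite lecE /= => /andP[/eqP -> _]; exists a.
have [|x Hx] := @ulim_real (fun k => complex.Re (u k)) r.
  by move=> k; rewrite -lecR -Mr; apply: le_trans (ler_Re_norm _) (uM k).
have [|y Hy] := @ulim_real (fun k => complex.Im (u k)) r.
  by move=> k; rewrite -lecR -Mr; apply: le_trans (ler_Im_norm _) (uM k).
exists (x +i* y)%C => e /posC_real[d d0 ->].
have d20 : 0 < d / 2 by lra.
apply: (filterS _ (filterI (Hx _ d20) (Hy _ d20))) => k /= [h1 h2].
apply: le_lt_trans (ler_norm_ReIm _) _; rewrite ltcR.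
by case: (u k) h1 h2 => a b /=; lra.
Qed.

Lemma ulim_uniq u l l' : ulim u l -> ulim u l' -> l = l'.
Proof.
move=> ul ul'; apply/eqP; rewrite -subr_eq0 -normr_le0.
rewrite real_leNgt ?ger0_real //; apply/negP => d0.
have d20 : 0 < `|l - l'| / 2 by rewrite divr_gt0.
have [k /= [h1 h2]] := @filter_ex _ _ _ _ (filterI (ul _ d20) (ul' _ d20)).
have : `|l - l'| < `|l - l'|.
  have E : l - l' = (u k - l') - (u k - l) by ring.
  rewrite [ltRHS]splitr {1}E.
  by apply: le_lt_trans (ler_normB _ _) _; rewrite ltrD.
by rewrite ltxx.
Qed.

Lemma ulimC l : ulim (fun=> l) l.
Proof.
by move=> e e0; apply: (filterS _ filterT) => k _ /=; rewrite subrr normr0.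
Qed.

Lemma ulim_near u v l N : (forall k, (N <= k)%N -> u k = v k) ->
  ulim u l -> ulim v l.
Proof.
move=> uv ul e e0; apply: (filterS _ (filterI (ul e e0) (ufilter_ge N))) => k /= [].
by move=> + /uv <-.
Qed.

Lemma ulimD u v l l' : ulim u l -> ulim v l' -> ulim (fun k => u k + v k) (l + l').
Proof.
move=> ul vl e e0; have e20 : 0 < e / 2 by rewrite divr_gt0.
apply: (filterS _ (filterI (ul _ e20) (vl _ e20))) => k /= [h1 h2].
rewrite [ltRHS]splitr opprD addrACA.
by apply: le_lt_trans (ler_normD _ _) _; rewrite ltrD.
Qed.

Lemma ulimN u l : ulim u l -> ulim (fun k => - u k) (- l).
Proof.
by move=> ul e e0; apply: (filterS _ (ul e e0)) => k /=; rewrite -opprD normrN.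
Qed.

Lemma ulimB u v l l' : ulim u l -> ulim v l' -> ulim (fun k => u k - v k) (l - l').
Proof. by move=> ul vl; apply: ulimD ul (ulimN vl). Qed.

Lemma ulim_conj u l : ulim u l -> ulim (fun k => (u k)^*) l^*.
Proof.
by move=> ul e e0; apply: (filterS _ (ul e e0)) => k /=; rewrite -rmorphB norm_conjC.
Qed.

Lemma ulimM u v l l' : ulim u l -> ulim v l' -> ulim (fun k => u k * v k) (l * l').
Proof.
move=> ul vl e e0; set K := 1 + `|l| + `|l'|.
have K1 : 1 <= K by rewrite /K -addrA lerDl addr_ge0.
have K0 : 0 < K by exact: lt_le_trans K1.
have d0 : 0 < e / (K * 2) by rewrite divr_gt0 ?mulr_gt0.
apply: (filterS _ (filterI (filterI (ul _ d0) (vl _ d0)) (vl _ ltr01))) => k /= [[h1 h2] h3].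
have vK : `|v k| < K.
  rewrite (_ : v k = (v k - l') + l'); last by ring.
  apply: le_lt_trans (ler_normD _ _) _.
  by rewrite /K ltrD2r (lt_le_trans h3) // lerDl.
have -> : u k * v k - l * l' = (u k - l) * v k + l * (v k - l') by ring.
have -> : e = e / (K * 2) * K + K * (e / (K * 2)).
  by field; rewrite gt_eqF.
apply: le_lt_trans (ler_normD _ _) _; rewrite !normrM.
apply: ltr_leD; first by apply: ltr_pM.
apply: ler_pM => //; last exact: ltW.
by rewrite /K addrAC lerDr addr_ge0.
Qed.

Lemma ulimX u l i : ulim u l -> ulim (fun k => u k ^+ i) (l ^+ i).
Proof.
move=> ul; elim: i => [|i IH]; first exact: ulimC.
rewrite exprS; apply: (@ulim_near (fun k => u k * u k ^+ i) _ _ 0) => [k _|].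
  by rewrite exprS.
exact: ulimM.
Qed.

Lemma ulim_sum (I : Type) (r : seq I) (P : pred I) (F : I -> nat -> C) (L : I -> C) :
  (forall i, P i -> ulim (F i) (L i)) ->
  ulim (fun k => \sum_(i <- r | P i) F i k) (\sum_(i <- r | P i) L i).
Proof.
move=> H; elim: r => [|i r IH].
  by rewrite big_nil; apply: (ulim_near (N := 0)) (ulimC 0) => k _; rewrite big_nil.
rewrite big_cons; case: ifP => Pi; last first.
  by apply: (ulim_near (N := 0)) IH => k _; rewrite big_cons Pi.
apply: (ulim_near (N := 0)) (ulimD (H i Pi) IH) => k _.
by rewrite big_cons Pi.
Qed.

Lemma ulim_horner (p : {poly C}) u l :
  ulim u l -> ulim (fun k => p.[u k]) p.[l].
Proof.
move=> ul; rewrite horner_coef.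
apply: (@ulim_near (fun k => \sum_(i < size p) p`_i * u k ^+ i) _ _ 0) => [k _|].
  by rewrite horner_coef.
by apply: ulim_sum => i _; apply: ulimM (ulimC _) (ulimX _ ul).
Qed.

Lemma ulim_ge0 u l N : (forall k, (N <= k)%N -> 0 <= u k) -> ulim u l -> 0 <= l.
Proof.
move=> u0 ul.
have lr : l \is Num.real.
  rewrite CrealE; apply/eqP; apply: ulim_uniq (ulim_conj ul) _.
  by apply: (ulim_near (N := N)) ul => k /u0 /ger0_real /CrealP.
rewrite real_leNgt ?real0 //; apply/negP => l0.
have l0' : 0 < - l by rewrite oppr_gt0.
have [k /= [h1 /u0 h2]] := @filter_ex _ _ _ _ (filterI (ul _ l0') (ufilter_ge N)).
have : `|u k - l| = u k - l by rewrite ger0_norm // addr_ge0 // ltW.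
by move=> h; move: h1; rewrite h ltrBlDr addNr => /lt_le_trans/(_ h2); rewrite ltxx.
Qed.

Lemma ulim_le u v l l' N : (forall k, (N <= k)%N -> u k <= v k) ->
  ulim u l -> ulim v l' -> l <= l'.
Proof.
move=> uv ul vl; rewrite -subr_ge0; apply: (@ulim_ge0 _ _ N) (ulimB vl ul) => k Nk.
by rewrite subr_ge0 uv.
Qed.

Definition einv (k : nat) : C := k.+1%:R^-1.

Lemma ulim_einv : ulim einv 0.
Proof.
move=> e /posC_real[r r0 ->].
apply: (filterS _ (ufilter_ge (Num.trunc r^-1).+1)) => k /= Nk.
rewrite subr0 /einv ger0_norm ?invr_ge0 ?ler0n //.
rewrite (_ : k.+1%:R^-1 = ((k.+1%:R^-1 : R)%:C)%C); last first.
  by rewrite fmorphV rmorph_nat.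
rewrite ltcR invf_plt ?posrE ?ltr0n //.
apply: lt_le_trans (_ : (Num.trunc r^-1).+1%:R <= _).
  by rewrite truncnS_gt.
by rewrite ler_nat ltnW.
Qed.

End Ulim.

(** * Energy of matrix polynomials on the circle *)

Section Parseval.
Variable C : numClosedFieldType.
Implicit Types (f g : {poly C}).

Lemma prim_root_ex N : (0 < N)%N -> exists z : C, N.-primitive_root z.
Proof.
move=> n_gt0; pose p : {poly C} := 'X^N - 1; have [r Dp] := closed_field_poly_normal p.
rewrite (monicP _) ?monicXnsubC // scale1r in Dp.
have rn1 : all N.-unity_root r by apply/allP=> z; rewrite -root_prod_XsubC -Dp.
have sz_r : (N < (size r).+1)%N.
  by rewrite -(size_prod_XsubC r id) -Dp size_XnsubC.
have [|z] := hasP (has_prim_root n_gt0 rn1 _ sz_r); last by exists z.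
by rewrite -separable_prod_XsubC -Dp separable_Xn_sub_1 // pnatr_eq0 -lt0n.
Qed.

Lemma norm_prim_root N (z : C) : N.-primitive_root z -> `|z| = 1.
Proof.
move=> Hz; have := prim_expr_order Hz => /(congr1 (fun x => `|x|)).
rewrite normrX normr1 => /eqP.
by rewrite pexpr_eq1 ?(prim_order_gt0 Hz) // => /eqP.
Qed.

Lemma conj_unit (w : C) : `|w| = 1 -> w^* = w^-1.
Proof. by move=> w1; rewrite invC_norm w1 expr1n invr1 mul1r. Qed.

Lemma norm1_neq0 (w : C) : `|w| = 1 -> w != 0.
Proof. by move=> w1; rewrite -normr_eq0 w1 oner_eq0. Qed.

Lemma sum_prim_root N (z : C) (a b : nat) : N.-primitive_root z ->
  \sum_(s < N) (z ^+ s) ^- a * (z ^+ s) ^+ b = (if a == b %[mod N] then N%:R else 0).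
Proof.
move=> Hz; have z0 : z != 0 by apply: norm1_neq0 (norm_prim_root Hz).
set x := z ^- a * z ^+ b.
have -> : \sum_(s < N) (z ^+ s) ^- a * (z ^+ s) ^+ b = \sum_(s < N) x ^+ s.
  by apply: eq_bigr => s _; rewrite /x exprMn exprVn !(exprAC _ s).
have x1 : (x == 1) = (a == b %[mod N]).
  rewrite /x mulrC -subr_eq0 -[X in _ - X](divff (expf_neq0 a z0)) -mulrBl mulf_eq0.
  by rewrite invr_eq0 expf_eq0 (negbTE z0) andbF orbF subr_eq0 (eq_prim_root_expr Hz) eq_sym.
case: ifPn; rewrite -x1.
  move/eqP => ->; rewrite (eq_bigr (fun=> 1)) => [|i _]; last by rewrite expr1n.
  by rewrite sumr_const card_ord.
(* Here x is an N-th root of unity other than 1, so its geometric sum vanishes. *)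
move=> xn1; apply: (mulfI (_ : x - 1 != 0)); first by rewrite subr_eq0.
rewrite mulr0 -subrX1 /x exprMn exprVn -!exprM mulnC [(b * N)%N]mulnC !exprM.
by rewrite (prim_expr_order Hz) !expr1n invr1 mulr1 subrr.
Qed.

(** Averaging over the N-th roots of unity replaces integration over the circle; the bound N on the
    sizes keeps distinct exponents distinct modulo N. *)
Lemma parseval_prim N (z : C) f g : N.-primitive_root z ->
  (size f <= N)%N -> (size g <= N)%N ->
  \sum_(s < N) (f.[z ^+ s])^* * g.[z ^+ s] = N%:R * \sum_(k < N) (f`_k)^* * g`_k.
Proof.
move=> Hz sf sg.
transitivity (\sum_(s < N) \sum_(a < N) \sum_(b < N)
   (f`_a)^* * g`_b * ((z ^+ s) ^- a * (z ^+ s) ^+ b)).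
  apply: eq_bigr => s _.
  rewrite (horner_coef_wide _ sf) (horner_coef_wide _ sg) rmorph_sum mulr_suml.
  apply: eq_bigr => a _; rewrite mulr_sumr; apply: eq_bigr => b _.
  rewrite rmorphM rmorphXn /= (@conj_unit (z ^+ s)); last first.
    by rewrite normrX (norm_prim_root Hz) expr1n.
  by rewrite exprVn mulrACA.
rewrite exchange_big mulr_sumr; apply: eq_bigr => a _.
rewrite exchange_big (bigD1 a) //= -mulr_sumr (sum_prim_root _ _ Hz) eqxx big1 ?addr0.
  by rewrite mulrC.
move=> b ba; rewrite -mulr_sumr (sum_prim_root _ _ Hz) !modn_small //.
by case: eqP => [/val_inj E|]; rewrite ?mulr0 //; rewrite E eqxx in ba.
Qed.

Lemma parseval (I J : finType) (f g : I -> {poly C}) (f' g' : J -> {poly C}) N :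
  (forall i, size (f i) <= N)%N -> (forall i, size (g i) <= N)%N ->
  (forall i, size (f' i) <= N)%N -> (forall i, size (g' i) <= N)%N ->
  (forall w, `|w| = 1 -> \sum_i (f i).[w]^* * (g i).[w] = \sum_j (f' j).[w]^* * (g' j).[w]) ->
  \sum_i \sum_(k < N) ((f i)`_k)^* * (g i)`_k = \sum_j \sum_(k < N) ((f' j)`_k)^* * (g' j)`_k.
Proof.
move=> sf sg sf' sg' H.
case: N => [|N] in sf sg sf' sg' *.
  by rewrite !big1 // => i _; rewrite big_ord0.
have [z Hz] := prim_root_ex (ltn0Sn N).
have N0 : N.+1%:R != 0 :> C by rewrite pnatr_eq0.
apply: (mulfI N0); rewrite !mulr_sumr.
under eq_bigr => i _ do rewrite -(parseval_prim Hz) //.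
under [RHS]eq_bigr => i _ do rewrite -(parseval_prim Hz) //.
rewrite exchange_big [RHS]exchange_big; apply: eq_bigr => s _; apply: H.
by rewrite normrX (norm_prim_root Hz) expr1n.
Qed.

Lemma poly_eq_circle f g : (forall w, `|w| = 1 -> f.[w] = g.[w]) -> f = g.
Proof.
move=> H; apply/eqP; rewrite -subr_eq0; apply/negPn/negP => fg0.
set N := size (f - g).
have N0 : (0 < N)%N by rewrite size_poly_gt0.
have [z Hz] := prim_root_ex N0.
pose rs := [seq z ^+ s | s <- iota 0 N].
have rR : all (root (f - g)) rs.
  apply/allP => x /mapP[s _ ->]; rewrite rootE !hornerE H ?subrr //.
  by rewrite normrX (norm_prim_root Hz) expr1n.
have rU : uniq rs.
  rewrite map_inj_in_uniq ?iota_uniq // => a b; rewrite !mem_iota /= !add0n => aN bN.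
  by move/eqP; rewrite (eq_prim_root_expr Hz) !modn_small // => /eqP.
by have := max_poly_roots fg0 rR rU; rewrite size_map size_iota ltnn.
Qed.

End Parseval.

Section MatrixPoly.
Variable C : numClosedFieldType.

Definition mev (w : C) r s (F : 'M[{poly C}]_(r, s)) : 'M[C]_(r, s) :=
  map_mx (horner_eval w) F.
Definition mc (k : nat) r s (F : 'M[{poly C}]_(r, s)) : 'M[C]_(r, s) :=
  map_mx (fun p : {poly C} => p`_k) F.
Definition msize r s (F : 'M[{poly C}]_(r, s)) (N : nat) : Prop :=
  forall i j, (size (F i j) <= N)%N.
(** The squared Frobenius norm. *)
Definition fsq r s (A : 'M[C]_(r, s)) : C := \sum_i \sum_j `|A i j| ^+ 2.

Lemma mevM w r s t (F : 'M_(r, s)) (G : 'M_(s, t)) :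
  mev w (F *m G) = mev w F *m mev w G.
Proof. exact: map_mxM. Qed.

Lemma fsq_ge0 r s (A : 'M_(r, s)) : 0 <= fsq A.
Proof. by apply: sumr_ge0 => i _; apply: sumr_ge0 => j _; rewrite exprn_ge0. Qed.

Lemma fsq_tr r s (A : 'M_(r, s)) : fsq A = \tr (A ^t* *m A).
Proof.
rewrite /fsq exchange_big; apply: eq_bigr => j _; rewrite mxE.
by apply: eq_bigr => i _; rewrite !mxE normCKC.
Qed.

Lemma fsq_eq0 r s (A : 'M_(r, s)) : fsq A = 0 -> A = 0.
Proof.
move=> /eqP; rewrite psumr_eq0; last first.
  by move=> i _; apply: sumr_ge0 => j _; rewrite exprn_ge0.
move=> /allP H; apply/matrixP => i j; rewrite mxE; apply/eqP.
have := H i (mem_index_enum _); rewrite /= psumr_eq0 => [/allP/(_ j (mem_index_enum _))|].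
  by rewrite /= expf_eq0 normr_eq0.
by move=> k _; rewrite exprn_ge0.
Qed.

Lemma fsqZ r s (A : 'M_(r, s)) c : fsq (c *: A) = `|c| ^+ 2 * fsq A.
Proof.
rewrite mulr_sumr; apply: eq_bigr => i _; rewrite mulr_sumr.
by apply: eq_bigr => j _; rewrite mxE normrM exprMn.
Qed.

Lemma ctM r s t (A : 'M[C]_(r, s)) (B : 'M[C]_(s, t)) :
  (A *m B) ^t* = B ^t* *m A ^t*.
Proof. by rewrite trmx_mul map_mxM. Qed.

Lemma fsq_gram r r' s t (A : 'M_(r, s)) (B : 'M_(r', s)) (x : 'M_(s, t)) :
  A ^t* *m A = B ^t* *m B -> fsq (A *m x) = fsq (B *m x).
Proof. by move=> E; rewrite !fsq_tr !ctM -!mulmxA !(mulmxA (_ ^t*) _ x) E. Qed.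

Lemma msize_ge r s (F : 'M_(r, s)) N N' : (N <= N')%N -> msize F N -> msize F N'.
Proof. by move=> NN H i j; apply: leq_trans NN. Qed.

Lemma msize_ex r s (F : 'M_(r, s)) : exists N, msize F N.
Proof.
exists (\max_i \max_j size (F i j))%N => i j.
exact: leq_trans (leq_bigmax j) (leq_bigmax i).
Qed.

Lemma energy_avg N (z : C) r s (F : 'M_(r, s)) : N.-primitive_root z -> msize F N ->
  N%:R * \sum_(k < N) fsq (mc k F) = \sum_(k < N) fsq (mev (z ^+ k) F).
Proof.
move=> Hz sF; rewrite exchange_big [RHS]exchange_big mulr_sumr; apply: eq_bigr => i _.
rewrite exchange_big [RHS]exchange_big mulr_sumr; apply: eq_bigr => j _.
transitivity (\sum_(s < N) (F i j).[z ^+ s]^* * (F i j).[z ^+ s]).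
  rewrite (parseval_prim Hz) //; congr (_ * _); apply: eq_bigr => k _.
  by rewrite mxE normCKC.
by apply: eq_bigr => k _; rewrite mxE normCKC.
Qed.

Lemma energy_le r s r' s' (F : 'M_(r, s)) (G : 'M_(r', s')) N :
  msize F N -> msize G N ->
  (forall w, `|w| = 1 -> fsq (mev w F) <= fsq (mev w G)) ->
  \sum_(k < N) fsq (mc k F) <= \sum_(k < N) fsq (mc k G).
Proof.
case: N => [|N] sF sG H; first by rewrite !big_ord0.
have [z Hz] := prim_root_ex C (ltn0Sn N).
have N0 : 0 < N.+1%:R :> C by rewrite ltr0n.
rewrite -(ler_pM2l N0) !(energy_avg Hz) //; apply: ler_sum => k _; apply: H.
by rewrite normrX (norm_prim_root Hz) expr1n.
Qed.

Lemma energy_trunc r s (F : 'M_(r, s)) m N : (m <= N)%N ->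
  \sum_(k < m) fsq (mc k F) <= \sum_(k < N) fsq (mc k F).
Proof.
move=> mN; rewrite -(subnKC mN) big_split_ord /= lerDl.
by apply: sumr_ge0 => i _; apply: fsq_ge0.
Qed.

End MatrixPoly.

(** * Energy concentration for matrix polynomials invertible on the closed disc *)

Section Energy.
Variable R : realType.
Local Notation C := R[i].

Lemma geometric_small (x d : R) : 1 < x -> 0 < d ->
  exists T0, forall T, (T0 <= T)%N -> x ^- T <= d.
Proof.
move=> x1 d0; exists (Num.trunc (d * (x - 1))^-1).+1 => T hT.
have x0 : 0 < x by lra.
have y0 : 0 < x - 1 by lra.
rewrite invf_ple ?posrE ?exprn_gt0 //.
(* Bernoulli's inequality. *)
have B : forall k, 1 + k%:R * (x - 1) <= x ^+ k.
  elim=> [|k IH]; first by rewrite expr0 mul0r addr0.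
  rewrite exprS; apply: le_trans (_ : x * (1 + k%:R * (x - 1)) <= _); last first.
    by rewrite ler_pM2l.
  have : 0 <= k%:R * (x - 1) * (x - 1) by rewrite !mulr_ge0 // ltW.
  by rewrite -natr1; lra.
apply: le_trans (B T); have h : (d * (x - 1))^-1 < T%:R.
  by apply: lt_le_trans (truncnS_gt _) _; rewrite ler_nat.
have -> : d^-1 = (d * (x - 1))^-1 * (x - 1) by field; rewrite !gt_eqF.
by have : (d * (x - 1))^-1 * (x - 1) < T%:R * (x - 1); [rewrite ltr_pM2r | lra].
Qed.

(* [s] is to be thought of as a truncation of the power series of [1 / d]. *)
Definition circle_invertible (d : {poly C}) := forall e : C, 0 < e ->
  exists T0, forall T, (T0 <= T)%N -> exists s r : {poly C},
    d * s = 1 + 'X^T * r /\ forall w, `|w| = 1 -> `|r.[w]| <= e.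

Lemma circle_invertibleM c d :
  circle_invertible c -> circle_invertible d -> circle_invertible (c * d).
Proof.
move=> Hc Hd e /posC_real[x x0 ->].
(* The product of the two remainders is controlled by y + y + y y, which is at most 3 y <= x because
   y <= 1. *)
pose y := Num.min (x / 3) 1.
have y0 : 0 < (y%:C)%C by rewrite ltcR lt_min; lra.
have [T1 H1] := Hc _ y0; have [T2 H2] := Hd _ y0.
exists (maxn T1 T2) => T; rewrite geq_max => /andP[/H1[s1 [r1 [E1 b1]]] /H2[s2 [r2 [E2 b2]]]].
exists (s1 * s2), (r1 + r2 + 'X^T * r1 * r2); split.
  by rewrite mulrACA E1 E2; ring.
move=> w w1; rewrite !hornerE.
apply: le_trans (_ : (y%:C)%C + (y%:C)%C + (y%:C)%C * (y%:C)%C <= _).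
  apply: le_trans (ler_normD _ _) _; apply: lerD.
    by apply: le_trans (ler_normD _ _) _; rewrite lerD ?b1 ?b2.
  by rewrite !normrM normrX w1 expr1n mul1r ler_pM ?b1 ?b2.
rewrite -rmorphM -!rmorphD lecR.
have h1 : y <= x / 3 by rewrite /y ge_min lexx.
have h2 : y <= 1 by rewrite /y ge_min lexx orbT.
have h3 : 0 < y by rewrite -ltcR.
have : y * y <= y by rewrite ger_pMr.
by lra.
Qed.

Lemma circle_invertibleC (c : C) : c != 0 -> circle_invertible c%:P.
Proof.
move=> c0 e e0; exists 0%N => T _; exists (c^-1)%:P, 0; split.
  by rewrite mulr0 addr0 -polyCM divff.
by move=> w _; rewrite horner0 normr0 ltW.
Qed.

(** Dividing X^T - a^T by X - a yields the truncated geometric series, with the constant remainder -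
    a^-T, which is small since |a| > 1. *)
Lemma circle_invertible_XsubC (a : C) : 1 < `|a| -> circle_invertible ('X - a%:P).
Proof.
move=> a1 e /posC_real[d d0 ->].
have [x xa] : exists x : R, `|a| = (x%:C)%C by rewrite normc_def; eexists.
have x1 : 1 < x by rewrite -ltcR -xa.
have a0 : a != 0 by rewrite -normr_gt0 (lt_trans _ a1) ?ltr01.
have [T0 HT] := geometric_small x1 d0; exists T0 => T /HT hT.
exists (- a ^- T *: \sum_(i < T) 'X^(T.-1 - i) * a%:P ^+ i), (- (a ^- T)%:P); split.
  have h : (a ^- T)%:P * a%:P ^+ T = 1 :> {poly C}.
    by rewrite -rmorphXn -rmorphM /= mulVf ?expf_neq0 // polyC1.
  rewrite -scalerAr -subrXX -mul_polyC polyCN mulrBr !mulNr h opprK mulrN.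
  by rewrite addrC mulrC.
move=> w _; rewrite hornerN hornerC normrN normfV normrX xa -rmorphXn /=.
by rewrite -fmorphV lecR.
Qed.

Lemma circle_invertibleP (d : {poly C}) :
  (forall w, `|w| <= 1 -> d.[w] != 0) -> circle_invertible d.
Proof.
have [r ->] := closed_field_poly_normal d; rewrite -mul_polyC => H.
have := H 0; rewrite normr0 => /(_ ler01); rewrite hornerM hornerC mulf_eq0 => /norP[l0 _].
apply: circle_invertibleM; first exact: circle_invertibleC.
have {}H : forall a, a \in r -> 1 < `|a|.
  move=> a ar; rewrite real_ltNge ?normr_real //; apply/negP => /H.
  rewrite hornerM mulf_eq0 -!rootE root_prod_XsubC ar orbT //.
elim: r H => [|a r IH] H; first by rewrite big_nil; apply: (@circle_invertibleC 1); rewrite oner_eq0.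
rewrite big_cons; apply: circle_invertibleM.
  by apply: circle_invertible_XsubC; apply: H; rewrite mem_head.
by apply: IH => b br; apply: H; rewrite inE br orbT.
Qed.

Lemma fsqZ_poly w r s (F : 'M[{poly C}]_(r, s)) (p : {poly C}) :
  fsq (mev w (p *: F)) = `|p.[w]| ^+ 2 * fsq (mev w F).
Proof.
rewrite -fsqZ; congr fsq; apply/matrixP => i j.
by rewrite !mxE /horner_eval hornerM.
Qed.

(* If [u'] is the power series with [M1 u'] equal to the first [m] terms of
   [M1 u], then [u'] agrees with [u] up to order [m], and all the energy of
   [M2 u'] is that of the truncation of [M1 u].  The polynomial [s] below
   truncates [1 / det M1], so that [v] approximates [u']. *)
Lemma energy_concentration s t (M1 : 'M[{poly C}]_s) (M2 : 'M[{poly C}]_(t, s)) :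
  (forall w, `|w| = 1 ->
     (mev w M1)^t* *m mev w M1 = (mev w M2)^t* *m mev w M2) ->
  (forall w, `|w| <= 1 -> \det (mev w M1) != 0) ->
  forall (u : 'cV[{poly C}]_s) m,
  \sum_(k < m) fsq (mc k (M2 *m u)) <= \sum_(k < m) fsq (mc k (M1 *m u)).
Proof.
move=> HE Hd u m.
have Hinv : circle_invertible (\det M1).
  by apply: circle_invertibleP => w /Hd; rewrite /mev det_map_mx.
set A := \sum_(k < m) _; set B := \sum_(k < m) _.
suff H e : 0 < e -> A <= (1 + e) ^+ 2 * B.
  have : ulim (fun k => (1 + einv R k) ^+ 2 * B) ((1 + 0) ^+ 2 * B).
    exact: ulimM (ulimX _ (ulimD (ulimC _) (@ulim_einv R))) (ulimC _).
  rewrite addr0 expr1n mul1r; apply: (ulim_le (N := 0)) (ulimC A) => k _.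
  by apply: H; rewrite invr_gt0 ltr0n.
move=> e0; have [T0 /(_ (maxn T0 m) (leq_maxl _ _))[q [r [Eq br]]]] := Hinv e e0.
set T := maxn T0 m in Eq.
pose g := map_mx (take_poly m) (M1 *m u).
pose v := q *: (\adj M1 *m g).
have M1v : M1 *m v = (1 + 'X^T * r) *: g.
  by rewrite -scalemxAr mulmxA mul_mx_adj mul_scalar_mx scalerA mulrC Eq.
have XT : 'X^T = 'X^m * 'X^(T - m) :> {poly C} by rewrite -exprD subnKC // leq_maxr.
have gE : M1 *m u = g + 'X^m *: map_mx (drop_poly m) (M1 *m u).
  apply/matrixP => i j; rewrite !mxE mulrC.
  by rewrite addrC -[LHS](poly_take_drop m) addrC.
(* [M1 *m (v - u)] is divisible by X^m. Multiplication by [q *: \adj M1] turns [M1] into the scalar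
   1 + X^T r, which is 1 modulo X^m, so v - u is divisible by X^m as well. *)
have [H vE] : exists H, v = u + 'X^m *: H.
  pose K := 'X^(T - m) * r *: g - map_mx (drop_poly m) (M1 *m u).
  exists (q *: (\adj M1 *m K) - ('X^(T - m) * r) *: (v - u)).
  have E1 : M1 *m (v - u) = 'X^m *: K.
    rewrite mulmxBr M1v gE scalerDl scale1r XT /K scalerBr scalerA mulrA.
    by rewrite opprD addrACA subrr add0r.
  have E2 : (1 + 'X^T * r) *: (v - u) = 'X^m *: (q *: (\adj M1 *m K)).
    rewrite -Eq mulrC -scalerA -[\det M1 *: _]mul_scalar_mx -mul_adj_mx -mulmxA E1 -scalemxAr.
    by rewrite !scalerA mulrC.
  rewrite scalerBr -E2 scalerA mulrA -XT -scalerBl addrK scale1r addrC subrK //.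
have mcE k : (k < m)%N -> mc k (M2 *m u) = mc k (M2 *m v).
  move=> km; rewrite vE mulmxDr -scalemxAr; apply/matrixP => i j.
  by rewrite !mxE coefD coefXnM km addr0.
have [N1 sN1] := msize_ex (M2 *m v); have [N2 sN2] := msize_ex (M1 *m v).
have sg : msize g m by move=> i j; rewrite mxE size_take_poly.
pose N := maxn m (maxn N1 N2).
have le1 : (N1 <= N)%N by rewrite !leq_max leqnn !orbT.
have le2 : (N2 <= N)%N by rewrite !leq_max leqnn !orbT.
have le3 : (m <= N)%N by rewrite !leq_max leqnn.
rewrite /A (eq_bigr (fun k : 'I_m => fsq (mc k (M2 *m v)))) => [|k _]; last by rewrite mcE.
apply: le_trans (energy_trunc _ le3) _.
have BE : B = \sum_(k < N) fsq (mc k g).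
  rewrite -(subnKC le3) big_split_ord /= [X in _ + X]big1 ?addr0 => [|k _].
    apply: eq_bigr => k _; congr fsq; apply/matrixP => i j.
    by rewrite !mxE coef_take_poly ltn_ord.
  apply: big1 => i _; apply: big1 => j _.
  by rewrite !mxE coef_take_poly ltnNge leq_addr normr0 expr0n.
pose h : 'cV[{poly C}]_s := (1 + e)%:P *: g.
have -> : (1 + e) ^+ 2 * B = \sum_(k < N) fsq (mc k h).
  rewrite BE mulr_sumr; apply: eq_bigr => k _.
  have -> : mc k h = (1 + e) *: mc k g by apply/matrixP => i j; rewrite !mxE coefCM.
  by rewrite fsqZ ger0_norm // addr_ge0 // ltW.
apply: energy_le; first exact: msize_ge sN1.
  move=> i j; apply: leq_trans (_ : size (g i j) <= N)%N; last exact: leq_trans (sg i j) _.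
  by rewrite mxE mul_polyC size_scale_leq.
(* On the circle |M2 v| = |M1 v| = |1 + w^T r| |g| <= (1 + e) |g|. *)
move=> w w1; rewrite mevM (fsq_gram _ (esym (HE w w1))) -mevM M1v !fsqZ_poly hornerC.
apply: ler_wpM2r; first exact: fsq_ge0.
have e1 : 0 <= 1 + e by rewrite addr_ge0 // ltW.
rewrite ler_pXn2r ?nnegrE // [leRHS]ger0_norm //.
rewrite !hornerE; apply: le_trans (ler_normD _ _) _; rewrite normr1 lerD2l.
by rewrite normrM normrX w1 expr1n mul1r br.
Qed.
End Energy.

(** * Bezoutians and the Schur-Cohn criterion *)

Section Bezoutian.
Variable C : numClosedFieldType.

Lemma sum_ord_widen (V : nmodType) (F : nat -> V) a b : (a <= b)%N ->
  (forall k, (a <= k)%N -> F k = 0) -> \sum_(k < a) F k = \sum_(k < b) F k.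
Proof.
move=> ab F0; rewrite -(subnKC ab) big_split_ord /= [X in _ + X]big1 ?addr0 //.
by move=> i _; rewrite F0 // leq_addr.
Qed.

(* The coefficient of [x^i y^j] in [(1 - x y)^-1 M^#(x) M(y)], where [M^#(x)]
   has coefficients [(mc k M)^t* ]. *)
Definition bez r s (M : 'M[{poly C}]_(r, s)) (i j : nat) : 'M[C]_s :=
  \sum_(l < (minn i j).+1) (mc (i - l) M)^t* *m mc (j - l) M.

Lemma ctK r s (A : 'M[C]_(r, s)) : A ^t* ^t* = A.
Proof. exact: trmxCK. Qed.

Lemma ctD r s (A B : 'M[C]_(r, s)) : (A + B)^t* = A^t* + B^t*.
Proof. by rewrite !raddfD. Qed.

Lemma ctZ r s (A : 'M[C]_(r, s)) c : (c *: A)^t* = c^* *: A^t*.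
Proof. by apply/matrixP => i j; rewrite !mxE rmorphM. Qed.

Lemma ct_sum (I : Type) (e : seq I) (P : pred I) r s (F : I -> 'M[C]_(r, s)) :
  (\sum_(i <- e | P i) F i)^t* = \sum_(i <- e | P i) (F i)^t*.
Proof. by rewrite !raddf_sum. Qed.

Lemma bezJ r s (M : 'M[{poly C}]_(r, s)) i j : (bez M i j)^t* = bez M j i.
Proof.
rewrite /bez ct_sum minnC; apply: eq_bigr => l _.
by rewrite ctM ctK.
Qed.

Lemma bezS r s (M : 'M[{poly C}]_(r, s)) i j :
  bez M i.+1 j.+1 = (mc i.+1 M)^t* *m mc j.+1 M + bez M i j.
Proof. by rewrite /bez minnSS big_ord_recl !subn0. Qed.

Lemma bez0l r s (M : 'M[{poly C}]_(r, s)) j : bez M 0 j = (mc 0 M)^t* *m mc j M.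
Proof. by rewrite /bez min0n big_ord1 !subn0. Qed.

Lemma bez0r r s (M : 'M[{poly C}]_(r, s)) i : bez M i 0 = (mc i M)^t* *m mc 0 M.
Proof. by rewrite /bez minn0 big_ord1 !subn0. Qed.

Lemma mc_eq0 r s (M : 'M[{poly C}]_(r, s)) N k : msize M N -> (N <= k)%N -> mc k M = 0.
Proof.
move=> sM Nk; apply/matrixP => i j; rewrite !mxE nth_default //.
exact: leq_trans Nk.
Qed.

Lemma size_XnM_le (p : {poly C}) d N : (size p <= N)%N -> (size ('X^d * p)%R <= d + N)%N.
Proof.
by move=> sp; apply: leq_trans (size_polyMleq _ _) _; rewrite size_polyXn /= leq_add2l.
Qed.

(** Each sum is the Fourier coefficient of index d of M^* M on the circle, hence depends only on the
    values there; the factor X^d performs the shift. *)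
Lemma corr_eq r r' s (M1 : 'M[{poly C}]_(r, s)) (M2 : 'M[{poly C}]_(r', s)) N d :
  msize M1 N -> msize M2 N ->
  (forall w, `|w| = 1 ->
     (mev w M1)^t* *m mev w M1 = (mev w M2)^t* *m mev w M2) ->
  \sum_(k < N) (mc k M1)^t* *m mc (k + d) M1 =
  \sum_(k < N) (mc k M2)^t* *m mc (k + d) M2.
Proof.
move=> s1 s2 H; apply/matrixP => a b; rewrite !summxE.
have E r0 (M : 'M[{poly C}]_(r0, s)) : msize M N ->
    \sum_(k < N) ((mc k M)^t* *m mc (k + d) M) a b =
    \sum_i \sum_(k < d + N) (('X^d * M i a)`_k)^* * (M i b)`_k.
  move=> sM; rewrite exchange_big big_split_ord /= [X in _ = X + _]big1 ?add0r => [|k _].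
    apply: eq_bigr => k _; rewrite mxE; apply: eq_bigr => i _; rewrite !mxE.
    by rewrite coefXnM ltnNge leq_addr addKn addnC.
  by apply: big1 => i _; rewrite coefXnM ltn_ord conjC0 mul0r.
rewrite !E //; apply: parseval => [i|i|i|i|w w1].
- exact: size_XnM_le.
- by apply: leq_trans (s1 _ _) (leq_addl _ _).
- exact: size_XnM_le.
- by apply: leq_trans (s2 _ _) (leq_addl _ _).
have := congr1 (fun A : 'M_s => A a b) (H w w1); rewrite !mxE => Hab.
transitivity ((w ^+ d)^* * \sum_i ((mev w M1)^t*) a i * mev w M1 i b).
  rewrite mulr_sumr; apply: eq_bigr => i _.
  by rewrite !mxE /horner_eval hornerM hornerXn rmorphM /= mulrA.
rewrite Hab mulr_sumr; apply: eq_bigr => i _.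
by rewrite !mxE /horner_eval hornerM hornerXn rmorphM /= mulrA.
Qed.

(** Once one index reaches the degree m, the terms cut off at [minn i j] would be zero anyway. The
    entry is then a full autocorrelation, to which [corr_eq] applies. *)
Lemma bez_eq r r' s (M1 : 'M[{poly C}]_(r, s)) (M2 : 'M[{poly C}]_(r', s)) m i j :
  msize M1 m.+1 -> msize M2 m.+1 ->
  (forall w, `|w| = 1 ->
     (mev w M1)^t* *m mev w M1 = (mev w M2)^t* *m mev w M2) ->
  (m <= i)%N || (m <= j)%N -> bez M1 i j = bez M2 i j.
Proof.
move=> s1 s2 H.
wlog ij : i j / (i <= j)%N.
  move=> W; case: (leqP i j) => [|/ltnW] ij mij; first exact: W.
  by rewrite -bezJ -[RHS]bezJ; congr (_ ^t*); apply: W; rewrite // orbC.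
move=> mij; have {mij} mj : (m <= j)%N by case/orP: mij => // /leq_trans; apply.
have E r0 (M : 'M[{poly C}]_(r0, s)) : msize M m.+1 ->
    bez M i j = \sum_(k < m.+1) (mc k M)^t* *m mc (k + (j - i)) M.
  move=> sM; rewrite /bez (minn_idPl ij) (reindex_inj rev_ord_inj) /=.
  transitivity (\sum_(k < i.+1) (mc k M)^t* *m mc (k + (j - i)) M).
    apply: eq_bigr => k _; rewrite subSS subKn ?leq_ord //.
    by congr (_ *m mc _ M); have := ltn_ord k; lia.
  pose F k := (mc k M)^t* *m mc (k + (j - i)) M.
  have F1 k : (i < k)%N -> F k = 0.
    by move=> ik; rewrite /F (mc_eq0 (k := k + (j - i)) sM) ?mulmx0 //; lia.
  have F2 k : (m < k)%N -> F k = 0.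
    by move=> mk; rewrite /F (mc_eq0 (k := k) sM) ?trmx0 ?map_mx0 ?mul0mx.
  by rewrite (sum_ord_widen (leq_maxl i.+1 m.+1) F1) (sum_ord_widen (leq_maxr i.+1 m.+1) F2).
by rewrite !E //; apply: corr_eq.
Qed.

Lemma fsq_col r (y : 'cV[C]_r) : fsq y = (y ^t* *m y) 0 0.
Proof. by rewrite fsq_tr /mxtrace big_ord1. Qed.

(** The leading m by m block of the Bezoutian is T^* T with T triangular block Toeplitz. Such a T is
    multiplication by [M] modulo X^m, once the order of the vectors [c i] is reversed. *)
Lemma bez_energy r s (M : 'M[{poly C}]_(r, s)) m (c : nat -> 'cV[C]_s) :
  \sum_(i < m) \sum_(j < m) ((c i)^t* *m bez M i j *m c j) 0 0 =
  \sum_(k < m) fsq (mc k (M *m \col_a \poly_(k < m) (c (m.-1 - k)%N a 0))).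
Proof.
set u := \col_a _.
pose y (l : nat) := \sum_(i < m | (l <= i)%N) mc (i - l) M *m c i.
have mcu (l : 'I_m) : mc (m - l.+1) (M *m u) = y l.
  apply/matrixP => a b; rewrite !mxE ord1 summxE coef_sum.
  under eq_bigr => k _ do rewrite coefM.
  rewrite exchange_big /= (reindex_inj rev_ord_inj) /=.
  have ml : (m - l.+1).+1 = (m - l)%N by have := ltn_ord l; lia.
  rewrite ml.
  have -> : \sum_(i < m | (l <= i)%N) (mc (i - l) M *m c i) a 0 =
            \sum_(k < m - l) (mc k M *m c (l + k)%N) a 0.
    rewrite -(big_mkord (fun i => (l <= i)%N) (fun i => (mc (i - l) M *m c i) a 0)).
    rewrite (@big_cat_nat _ _ _ l 0 m) //=; last exact: ltnW.
    rewrite big_nat_cond big1 ?add0r => [|i]; last by case/andP; lia.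
    rewrite -{1}[l : nat]add0n big_addn big_mkord; apply: eq_big => i; first by rewrite leq_addl.
    by rewrite addnK addnC.
  rewrite (reindex_inj rev_ord_inj) /=; apply: eq_bigr => k _.
  rewrite mxE; apply: eq_bigr => b' _; rewrite !mxE coef_poly.
  have := ltn_ord k; have := ltn_ord l => hl hk.
  by rewrite ifT; [congr (_`__ * c _ _ _) | ]; lia.
rewrite [RHS](reindex_inj rev_ord_inj) /=.
under [RHS]eq_bigr => l _ do rewrite mcu fsq_col.
transitivity (\sum_(i < m) \sum_(j < m) \sum_(l < m | (l <= i)%N && (l <= j)%N)
   ((mc (i - l) M *m c i)^t* *m (mc (j - l) M *m c j)) 0 0).
  apply: eq_bigr => i _; apply: eq_bigr => j _.
  rewrite /bez mulmx_sumr mulmx_suml summxE.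
  rewrite (big_ord_widen_cond m (fun=> true) (fun l => ((c i)^t* *m ((mc (i - l) M)^t* *m mc (j - l) M) *m c j) 0 0)).
    by apply: eq_big => l; [rewrite ltnS leq_min | rewrite ctM !mulmxA].
  by rewrite ltnNge leq_min negb_and -!ltnNge ltn_ord.
under [RHS]eq_bigr => l _.
  rewrite /y ct_sum mulmx_suml summxE.
  under eq_bigr => i _ do rewrite mulmx_sumr summxE.
  over.
rewrite [RHS](exchange_big_dep xpredT) //=; apply: eq_bigr => i _.
by rewrite [RHS](exchange_big_dep xpredT).
Qed.

End Bezoutian.

(** * The Schur-Cohn criterion for polynomials without zeros in the closed disc *)

Section SchurCohn.
Variable R : realType.
Local Notation C := R[i].

Definition recip n (f : {poly C}) : {poly C} := \poly_(k < n.+1) (f`_(n - k))^*.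

Lemma horner_recip n (f : {poly C}) (w : C) : (size f <= n.+1)%N -> w != 0 ->
  (recip n f).[w] = w ^+ n * (f.[(w^-1)^*])^*.
Proof.
move=> sf w0; rewrite horner_poly (horner_coef_wide _ sf) rmorph_sum mulr_sumr.
rewrite (reindex_inj rev_ord_inj) /=; apply: eq_bigr => k _.
have kn : (k <= n)%N by rewrite -ltnS.
rewrite subSS subKn // rmorphM rmorphXn /= conjCK mulrCA; congr (_ * _).
by rewrite exprVn expfB_cond ?(negbTE w0).
Qed.

Lemma norm_horner_recip n (f : {poly C}) (w : C) : (size f <= n.+1)%N -> `|w| = 1 ->
  `|(recip n f).[w]| = `|f.[w]|.
Proof.
move=> sf w1; rewrite horner_recip ?norm1_neq0 //.
by rewrite normrM normrX w1 expr1n mul1r norm_conjC -conj_unit // conjCK.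
Qed.

(** Scalars are treated as 1 by 1 matrices, so that the results on [bez] apply to them. *)
Definition bz (f : {poly C}) i j : C := bez (const_mx f : 'M_1) i j 0 0.

Lemma bzE f i j :
  bz f i j = \sum_(l < (minn i j).+1) (f`_(i - l))^* * f`_(j - l).
Proof.
rewrite /bz /bez summxE; apply: eq_bigr => l _.
by rewrite mxE big_ord1 !mxE.
Qed.

Lemma bzS f i j : bz f i.+1 j.+1 = (f`_i.+1)^* * f`_j.+1 + bz f i j.
Proof. by rewrite /bz bezS mxE mxE big_ord1 !mxE. Qed.

Lemma bz0l f j : bz f 0 j = (f`_0)^* * f`_j.
Proof. by rewrite /bz bez0l mxE big_ord1 !mxE. Qed.

Lemma bz0r f i : bz f i 0 = (f`_i)^* * f`_0.
Proof. by rewrite /bz bez0r mxE big_ord1 !mxE. Qed.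

Lemma bzJ f i j : (bz f i j)^* = bz f j i.
Proof. by rewrite /bz -(bezJ _ i j) !mxE. Qed.

Section Fixed.
Variables (n : nat) (f : {poly C}).
Hypothesis sf : (size f <= n.+1)%N.
Let g := recip n f.

Lemma mev_recip w : `|w| = 1 ->
  (mev w (const_mx f : 'M_1))^t* *m mev w (const_mx f : 'M_1) =
  (mev w (const_mx g : 'M_1))^t* *m mev w (const_mx g : 'M_1).
Proof.
move=> w1; apply/matrixP => a b; rewrite !mxE !big_ord1 !mxE /horner_eval.
by rewrite -!normCKC norm_horner_recip.
Qed.

Lemma bz_recip_ge i j : (n <= i)%N || (n <= j)%N -> bz f i j = bz g i j.
Proof.
move=> nij; rewrite /bz; congr ((_ : matrix _ _ _) 0 0); apply: (bez_eq _ _ mev_recip nij).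
  by move=> a b; rewrite mxE.
by move=> a b; rewrite mxE size_poly.
Qed.

Hypothesis f0 : forall z, `|z| <= 1 -> f.[z] != 0.

(** On the circle f and its reflection have the same modulus, so [energy_concentration] for 1 by 1
    matrices compares the two quadratic forms. *)
Lemma schur_cohn_ge0 (c : nat -> C) :
  0 <= \sum_(i < n) \sum_(j < n) (c i)^* * (bz f i j - bz g i j) * c j.
Proof.
pose u : 'cV[{poly C}]_1 := \col_a \poly_(k < n) ((c (n.-1 - k)%N)%:M : 'cV_1) a 0.
have H (h : {poly C}) : \sum_(i < n) \sum_(j < n) (c i)^* * bz h i j * c j =
    \sum_(k < n) fsq (mc k ((const_mx h : 'M_1) *m u)).
  rewrite -(bez_energy _ n (fun i => ((c i)%:M : 'cV_1))).
  apply: eq_bigr => i _; apply: eq_bigr => j _.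
  by rewrite !(mxE, big_ord1) !eqxx !mulr1n.
have -> : \sum_(i < n) \sum_(j < n) (c i)^* * (bz f i j - bz g i j) * c j =
    \sum_(i < n) \sum_(j < n) (c i)^* * bz f i j * c j -
    \sum_(i < n) \sum_(j < n) (c i)^* * bz g i j * c j.
  rewrite -sumrB; apply: eq_bigr => i _; rewrite -sumrB; apply: eq_bigr => j _.
  by rewrite mulrBr mulrBl.
have eq_le_ge (x y x' y' : C) : x = x' -> y = y' -> y' <= x' -> 0 <= x - y.
  by move=> -> ->; rewrite subr_ge0.
apply: (eq_le_ge _ _ _ _ (H f) (H g)).
apply: energy_concentration; first exact: mev_recip.
by move=> w /f0; rewrite det_mx11 !mxE.
Qed.

Lemma root_recip z : root g z -> `|z| < 1.
Proof.
rewrite rootE; have [->|z0] := eqVneq z 0; first by rewrite normr0 ltr01.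
rewrite horner_recip // mulf_eq0 expf_eq0 (negbTE z0) andbF /= conjC_eq0.
rewrite -[_ < 1]negbK -real_leNgt ?normr_real ?real1 // => gz; apply/negP => z1.
move: gz; apply/negP/f0; rewrite norm_conjC normfV invf_le1 //.
by rewrite normr_gt0.
Qed.

Lemma coprime_recip : coprimep f g.
Proof.
apply/Pdiv.ClosedField.coprimepP => z fz; apply/negP => /root_recip/ltW/f0.
by rewrite -rootE fz.
Qed.

Lemma size_recip : size g = n.+1.
Proof.
rewrite size_poly_eq // subnn conjC_eq0 -horner_coef0; apply: f0.
by rewrite normr0 ler01.
Qed.

(** A kernel vector yields f X_f = g X_g with X_f of degree less than n. As f and g are coprime and
    g has degree n, X_f must vanish, and its coefficients determine the vector because f(0) is not
    0. *)
Lemma schur_cohn_nondeg (c : nat -> C) :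
  (forall i, (i < n)%N -> \sum_(j < n) (bz f i j - bz g i j) * c j = 0) ->
  forall i, (i < n)%N -> c i = 0.
Proof.
move=> H.
pose X (h : {poly C}) := \poly_(l < n) (\sum_(i < n | (l <= i)%N) (h`_(i - l))^* * (c i)^*).
have EX (h : {poly C}) j : (h * X h)`_j = \sum_(i < n) (c i)^* * bz h i j.
  rewrite coefMr.
  transitivity (\sum_(l < j.+1) \sum_(i < n | (l <= i)%N) (c i)^* * ((h`_(i - l))^* * h`_(j - l))).
    apply: eq_bigr => l _; rewrite coef_poly; case: ltnP => ln.
      by rewrite mulr_sumr; apply: eq_bigr => i _; ring.
    rewrite mulr0 big1 // => i li; have := ltn_ord i; lia.
  rewrite (exchange_big_dep xpredT) //=; apply: eq_bigr => i _.
  rewrite bzE mulr_sumr.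
  rewrite (big_ord_widen_cond j.+1 (fun=> true)
     (fun l => (c i)^* * ((h`_(i - l))^* * h`_(j - l)))).
    apply: eq_bigl => l; rewrite ltnS leq_min; have := ltn_ord l; lia.
  by rewrite ltnS geq_minr.
have E : f * X f = g * X g.
  apply/polyP => j; rewrite !EX; apply/eqP; rewrite -subr_eq0 -sumrB; apply/eqP.
  case: (ltnP j n) => jn; last first.
    by apply: big1 => i _; rewrite bz_recip_ge ?jn ?orbT // subrr.
  have := congr1 Num.conj (H j jn); rewrite rmorph_sum conjC0; apply: etrans.
  apply: eq_bigr => i _; rewrite rmorphM rmorphB /= !bzJ -mulrBr mulrC //.
have X0 : X f = 0.
  apply/eqP; apply/negPn/negP => Xn0.
  have : g %| X f by rewrite -(Gauss_dvdpr _ (_ : coprimep g f)) ?E ?dvdp_mulr // coprimep_sym coprime_recip.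
  move/(dvdp_leq Xn0); rewrite size_recip => /leq_trans/(_ (size_poly _ _)).
  by rewrite ltnn.
have fn0 : f`_0 != 0 by rewrite -horner_coef0; apply: f0; rewrite normr0 ler01.
(* Descending induction: coefficient i of [X f] is conj (f(0) c_i) plus terms in the c_j with j >
   i. *)
suff S k i : (n - k <= i < n)%N -> c i = 0 by move=> i ni; apply: (S n); rewrite subnn.
elim: k i => [|k IH] i; first by lia.
move=> hi; have [|ik] := leqP (n - k) i; first by move=> ?; apply: IH; lia.
have lti : (i < n)%N by lia.
have := congr1 (fun p : {poly C} => p`_i) X0; rewrite coef_poly coef0 lti.
rewrite (bigD1 (Ordinal lti)) //= subnn big1 ?addr0.
  move/eqP; rewrite mulf_eq0 !conjC_eq0 (negbTE fn0) /= => /eqP //.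
move=> j /andP[ij jn]; rewrite (IH j) ?conjC0 ?mulr0 //.
have := ltn_ord j; have : j != i :> nat by []. lia.
Qed.

End Fixed.
End SchurCohn.

(** * Gram matrices and unitary matrices *)

Section LinearAlgebra.
Variable C : numClosedFieldType.

Definition psd k (H : 'M[C]_k) : Prop :=
  H^t* = H /\ forall x : 'cV[C]_k, 0 <= (x^t* *m H *m x) 0 0.

Lemma psd_gram r k (A : 'M[C]_(r, k)) : psd (A^t* *m A).
Proof.
split=> [|x]; first by rewrite ctM ctK.
by rewrite mulmxA -ctM -mulmxA -fsq_col fsq_ge0.
Qed.

Lemma psd_sqrt k (H : 'M[C]_k) : psd H -> exists T : 'M[C]_k, T^t* *m T = H.
Proof.
move=> [Hh Hp].
have HN : H \is normalmx by apply/normalmxP; rewrite Hh.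
set P := spectralmx H; set d := spectral_diag H.
have Pu : P \is unitarymx by apply: spectral_unitarymx.
have HE : H = P^t* *m diag_mx d *m P.
  by rewrite {1}(orthomx_spectralP HN) invmx_unitary.
have PP : P *m P^t* = 1%:M by apply/unitarymxP.
have PHP : P *m H *m P^t* = diag_mx d.
  by rewrite HE !mulmxA PP mul1mx -mulmxA PP mulmx1.
have d0 i : 0 <= d 0 i.
  pose e : 'cV[C]_k := delta_mx i 0.
  have := Hp (P^t* *m e).
  have -> : (P^t* *m e)^t* *m H *m (P^t* *m e) = e^t* *m (P *m H *m P^t*) *m e.
    by rewrite ctM ctK !mulmxA.
  rewrite PHP /e trmx_delta map_delta_mx -rowE -colE !mxE eqxx mulr1n //.
exists (diag_mx (map_mx sqrtC d) *m P); rewrite ctM HE -!mulmxA; congr (_ *m _).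
rewrite !mulmxA; congr (_ *m _).
rewrite tr_diag_mx map_diag_mx mulmx_diag; congr diag_mx; apply/rowP => i.
have s0 : 0 <= sqrtC (d 0 i) by rewrite sqrtC_ge0.
by rewrite !mxE /= geC0_conj // -expr2 sqrtCK.
Qed.

Lemma ct_inj r s : injective (fun A : 'M[C]_(r, s) => A^t*).
Proof. by move=> A B /(congr1 (fun A => A^t*)); rewrite !ctK. Qed.

Lemma unit_of_inj k (S : 'M[C]_k) : (forall x : 'cV[C]_k, S *m x = 0 -> x = 0) ->
  S \in unitmx.
Proof.
move=> H; rewrite -unitmx_tr unitmxE unitfE; apply/negP => /det0P[v v0 vS].
case/negP: v0; rewrite -[v]trmxK (H v^T) ?trmx0 //.
by rewrite -[S]trmxK -trmx_mul vS trmx0.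
Qed.

(** In the rank factorization of a square root T the left factor is injective, so it can be
    exchanged for the square root of its own Gram matrix, which is square and invertible. *)
Lemma gram_factor k (H : 'M[C]_k) : psd H ->
  exists N (Q : 'M[C]_(N, k)), row_free Q /\ Q^t* *m Q = H.
Proof.
move=> /psd_sqrt[T TH]; set N := \rank T.
have [S SE] := psd_sqrt (psd_gram (col_base T)).
exists N, (S *m row_base T); split; last first.
  rewrite ctM -mulmxA (mulmxA _ S) SE -TH.
  have := congr1 (fun A => A^t* *m A) (mulmx_base T).
  by rewrite /= ctM !mulmxA.
have Su : S \in unitmx.
  apply: unit_of_inj => x Sx0.
  have : fsq (col_base T *m x) = 0.
    by rewrite -(fsq_gram _ SE) Sx0 /fsq big1 // => i _; rewrite big1 // => j _; rewrite mxE normr0 expr0n.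
  move/fsq_eq0 => Tx0; have /row_fullP[D DT] := col_base_full T.
  by rewrite -[x]mul1mx -DT -mulmxA Tx0 mulmx0.
by rewrite /row_free mxrankMfree ?row_base_free // -/(row_free S) row_free_unit.
Qed.

(** Equal Gram matrices have equal kernels, which gives Y = V X; a right inverse of X then isolates
    V^* V. *)
Lemma isometry_of_gram k l (X Y : 'M[C]_(k, l)) : row_free X ->
  X^t* *m X = Y^t* *m Y -> exists V : 'M[C]_k, V *m X = Y /\ V^t* *m V = 1%:M.
Proof.
move=> Xf E.
have /submxP[V VX] : (Y <= X)%MS.
  rewrite submxE; apply/eqP/fsq_eq0.
  rewrite -(fsq_gram _ E) mulmx_coker /fsq.
  by rewrite big1 // => i _; rewrite big1 // => j _; rewrite mxE normr0 expr0n.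
exists V; split=> //; have /row_freeP[D XD] := Xf.
have E1 : X^t* *m (V^t* *m V) *m X = X^t* *m X by rewrite E VX ctM !mulmxA.
have := congr1 (fun Z => D^t* *m Z *m D) E1.
by rewrite !mulmxA -ctM XD !(=^~ mulmxA, XD) trmx1 map_mx1 !(mulmx1, mul1mx).
Qed.

Lemma scalar_mx11 (A : 'M[C]_1) : A = (A 0 0)%:M.
Proof. by apply/matrixP => i j; rewrite !ord1 !mxE eqxx mulr1n. Qed.

(* A Householder reflection takes [v] to a multiple of [(1, ..., 1)]. *)
Lemma unitary_no_zero_entry k (v : 'rV[C]_k) : v != 0 ->
  exists U : 'M[C]_k, U *m U^t* = 1%:M /\ forall j, (v *m U) 0 j != 0.
Proof.
case: k v => [|k] v v0; first by case/eqP: v0; apply/rowP => -[].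
pose dot (x y : 'rV[C]_k.+1) : C := (x *m y^t*) 0 0.
have dotE x y : dot x y = \sum_j x 0 j * (y 0 j)^*.
  by rewrite /dot mxE; apply: eq_bigr => j _; rewrite !mxE.
have dotJ x y : (dot x y)^* = dot y x.
  by rewrite !dotE rmorph_sum; apply: eq_bigr => j _; rewrite rmorphM /= conjCK mulrC.
have vv0 : 0 < dot v v.
  rewrite lt_neqAle; apply/andP; split; last first.
    by rewrite dotE sumr_ge0 // => j _; rewrite -normCK exprn_ge0.
  apply: contra v0; rewrite eq_sym dotE psumr_eq0 => [/allP H|j _]; last first.
    by rewrite -normCK exprn_ge0.
  apply/eqP/rowP => j; rewrite mxE; apply/eqP.
  by have := H j (mem_index_enum _); rewrite /= -normCK expf_eq0 normr_eq0.
(* The phase makes the inner product of v with the target vector y real; a reflection can exchange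
   the two only then. *)
pose s := \sum_j v 0 j; pose ph := if s == 0 then 1 else s / `|s|.
have ph1 : ph * ph^* = 1.
  rewrite -normCK /ph; case: ifPn => s0; first by rewrite normr1 expr1n.
  by rewrite normrM normfV normr_id divff ?expr1n // normr_eq0.
have sph : s * ph^* \is Num.real.
  rewrite /ph; case: ifPn => [/eqP ->|s0]; first by rewrite mul0r real0.
  rewrite rmorphM fmorphV /= (conj_Creal (normr_real _)) mulrA -normCK.
  by rewrite rpredM ?rpredX ?rpredV ?normr_real.
(* The scale for which y has the same length as v. *)
pose t := sqrtC (dot v v / k.+1%:R).
have t0 : 0 < t by rewrite sqrtC_gt0 divr_gt0 // ltr0n.
have tr : t^* = t by rewrite geC0_conj // ltW.
pose y : 'rV[C]_k.+1 := const_mx (t * ph).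
have yy : dot y y = dot v v.
  rewrite dotE (eq_bigr (fun=> dot v v / k.+1%:R)) => [|j _].
    by rewrite sumr_const card_ord -[LHS]mulr_natr divfK // pnatr_eq0.
  by rewrite !mxE rmorphM /= tr mulrACA ph1 mulr1 -expr2 sqrtCK.
have vy : dot v y = t * (s * ph^*).
  rewrite dotE mulrCA /s mulr_suml; apply: eq_bigr => j _.
  by rewrite !mxE rmorphM /= tr; ring.
have yv : dot y v = dot v y.
  by rewrite -dotJ vy conj_Creal // rpredM // ger0_real // ltW.
have yj U : v *m U = y -> forall j, (v *m U) 0 j != 0.
  move=> -> j; rewrite mxE; apply: mulf_neq0; first by rewrite gt_eqF.
  by apply/negP => /eqP ph0; move: ph1; rewrite ph0 mul0r => /esym/eqP; rewrite oner_eq0.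
have [vyE|xn0] := eqVneq (v - y) 0.
  exists 1%:M; split; first by rewrite trmx1 map_mx1 mulmx1.
  by apply: yj; rewrite mulmx1; apply/eqP; rewrite -subr_eq0 vyE.
pose x := v - y; pose b := dot v x.
have dotB u u' u'' : dot u (u' - u'') = dot u u' - dot u u''.
  by rewrite !dotE -sumrB; apply: eq_bigr => j _; rewrite !mxE rmorphB mulrBr.
have dotBl u u' u'' : dot (u' - u'') u = dot u' u - dot u'' u.
  by rewrite !dotE -sumrB; apply: eq_bigr => j _; rewrite !mxE mulrBl.
have xx : dot x x = 2 * b by rewrite /b /x !dotB !dotBl yy yv; ring.
have b0 : b != 0.
  apply: contra xn0 => /eqP b0; move: xx; rewrite b0 mulr0 dotE => /eqP.
  rewrite psumr_eq0 => [/allP H|j _]; last by rewrite -normCK exprn_ge0.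
  apply/eqP/rowP => j; rewrite [RHS]mxE; apply/eqP.
  by have := H j (mem_index_enum _); rewrite /= -normCK expf_eq0 normr_eq0.
have br : b^* = b.
  have : (dot x x)^* = dot x x by rewrite dotJ.
  by rewrite xx rmorphM /= conjC_nat => /mulfI; apply; rewrite pnatr_eq0.
(* Since |x|^2 = 2 b, this is the reflection 1 - 2 x^* x / |x|^2; it sends v to v - x = y because v
   x^* = b. *)
pose U : 'M[C]_k.+1 := 1%:M - b^-1 *: (x^t* *m x).
have UH : U^t* = U.
  rewrite /U raddfB /= map_mxB trmx1 map_mx1 linearZ /= map_mxZ ctM ctK.
  by rewrite fmorphV /= br.
exists U; split; last first.
  apply: yj; rewrite /U mulmxBr mulmx1 -scalemxAr mulmxA.
  rewrite (scalar_mx11 (v *m x^t*)) mul_scalar_mx scalerA mulVf // scale1r.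
  by rewrite /x opprB addrC subrK.
rewrite UH /U mulmxBr mulmx1 mulmxBl mul1mx.
rewrite -scalemxAl -scalemxAr -mulmxA (mulmxA x) (scalar_mx11 (x *m x^t*)).
rewrite mul_scalar_mx -/(dot x x) xx -scalemxAr !scalerA.
rewrite (_ : b^-1 * (b^-1 * (2 * b)) = b^-1 + b^-1); last by field.
by rewrite scalerDl opprB addrK subrK.
Qed.

End LinearAlgebra.

(** * The matrix Fejer-Riesz theorem *)

Lemma le_of_sq (F : numDomainType) (x M : F) : 0 <= x -> x ^+ 2 <= M -> x <= 1 + M.
Proof.
move=> x0 xM; have M0 : 0 <= M by apply: le_trans xM; rewrite exprn_ge0.
case: (real_leP (ger0_real x0) (@real1 F)) => x1; first by rewrite (le_trans x1) // lerDl.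
apply: le_trans (_ : x ^+ 2 <= _); last by rewrite (le_trans xM) // lerDr.
by rewrite expr2 ler_peMl // ltW.
Qed.

Section FejerRiesz.
Variable R : realType.
Local Notation C := R[i].

Definition factors r n (A : 'M[{poly C}]_(r, n)) (B : C -> 'M[C]_n) : Prop :=
  forall w, `|w| = 1 -> (mev w A)^t* *m mev w A = B w.

Lemma fsq_entry r s (A : 'M[C]_(r, s)) i j : `|A i j| ^+ 2 <= fsq A.
Proof.
rewrite /fsq (bigD1 i) //= (bigD1 j) //= -addrA lerDl addr_ge0 //.
  by apply: sumr_ge0 => k _; rewrite exprn_ge0.
by apply: sumr_ge0 => k _; apply: sumr_ge0 => l _; rewrite exprn_ge0.
Qed.

Lemma fsq0 r s : fsq (0 : 'M[C]_(r, s)) = 0.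
Proof. by apply: big1 => i _; apply: big1 => j _; rewrite mxE normr0 expr0n. Qed.

Lemma ulim_mxpoly r s N (A : nat -> 'M[{poly C}]_(r, s)) (M : C) :
  (forall k, msize (A k) N) ->
  (forall k t, (t < N)%N -> fsq (mc t (A k)) <= M) ->
  exists A' : 'M[{poly C}]_(r, s),
  [/\ msize A' N,
      forall i j t, ulim (fun k => (A k i j)`_t) (A' i j)`_t &
      forall i j w, ulim (fun k => (A k i j).[w]) (A' i j).[w]].
Proof.
move=> sA bA.
have Hb i j t : exists l, ulim (fun k => (A k i j)`_t) l.
  apply: ulim_ex; case: (ltnP t N) => tN; last first.
    by exists 0 => k; rewrite nth_default ?normr0 // (leq_trans (sA k i j)).
  exists (1 + M) => k; have := le_trans (fsq_entry (mc t (A k)) i j) (bA k t tN).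
  by rewrite mxE; apply: le_of_sq.
have /choice[L HL] : forall p : 'I_r * 'I_s * nat, exists l, ulim (fun k => (A k p.1.1 p.1.2)`_(p.2)) l.
  by move=> [[i j] t]; apply: Hb.
pose A' : 'M[{poly C}]_(r, s) := \matrix_(i, j) \poly_(t < N) L (i, j, t).
have cA' i j t : ulim (fun k => (A k i j)`_t) (A' i j)`_t.
  rewrite mxE coef_poly; case: ltnP => tN; first exact: (HL (i, j, t)).
  apply: (ulim_near (N := 0)) (ulimC 0) => k _.
  by rewrite nth_default // (leq_trans (sA k i j)).
have sA' : msize A' N by move=> i j; rewrite mxE size_poly.
exists A'; split=> // i j w.
rewrite (horner_coef_wide _ (sA' i j)).
apply: (@ulim_near _ (fun k => \sum_(t < N) (A k i j)`_t * w ^+ t) _ _ 0) => [k _|].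
  by rewrite (horner_coef_wide _ (sA k i j)).
by apply: ulim_sum => t _; apply: ulimM (cA' i j t) (ulimC _).
Qed.

Lemma energy_factors r r' n (A : 'M[{poly C}]_(r, n)) (A' : 'M[{poly C}]_(r', n)) B N :
  factors A B -> factors A' B -> msize A N -> msize A' N ->
  \sum_(k < N) fsq (mc k A) = \sum_(k < N) fsq (mc k A').
Proof.
move=> fA fA' sA sA'; apply/eqP; rewrite eq_le.
by apply/andP; split; apply: energy_le => // w w1; rewrite !fsq_tr fA ?fA'.
Qed.

Lemma mev_entry w r s (A : 'M[{poly C}]_(r, s)) i j : mev w A i j = (A i j).[w].
Proof. by rewrite mxE. Qed.

Lemma gram_entry w r s (A : 'M[{poly C}]_(r, s)) a b :
  ((mev w A)^t* *m mev w A) a b = \sum_i ((A i a).[w])^* * (A i b).[w].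
Proof. by rewrite mxE; apply: eq_bigr => i _; rewrite !mxE. Qed.

(* The outer factor maximizes [fsq (mc 0 A)] among all factors. *)
Lemma max_factor r n (A0 : 'M[{poly C}]_(r, n)) B N :
  factors A0 B -> msize A0 N.+1 ->
  exists A : 'M[{poly C}]_(r, n), [/\ factors A B, msize A N.+1 &
    forall A' : 'M[{poly C}]_(r, n), factors A' B -> msize A' N.+1 ->
      fsq (mc 0 A') <= fsq (mc 0 A)].
Proof.
move=> f0 s0; pose E := \sum_(k < N.+1) fsq (mc k A0).
have HE (A : 'M[{poly C}]_(r, n)) t : factors A B -> msize A N.+1 -> (t < N.+1)%N ->
    fsq (mc t A) <= E.
  move=> fA sA tN; rewrite /E (energy_factors f0 fA s0 sA) (bigD1 (Ordinal tN)) //=.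
  by rewrite lerDl sumr_ge0 // => i _; apply: fsq_ge0.
have fr (A : 'M[{poly C}]_(r, n)) : (complex.Re (fsq (mc 0 A)))%:C%C = fsq (mc 0 A).
  have := fsq_ge0 (mc 0 A); case: (fsq _) => a b.
  by rewrite lecE /= => /andP[/eqP -> _].
pose S := [set x : R | exists A : 'M[{poly C}]_(r, n),
  [/\ factors A B, msize A N.+1 & complex.Re (fsq (mc 0 A)) = x]].
have S0 : has_sup S.
  split; first by exists (complex.Re (fsq (mc 0 A0))), A0.
  exists (complex.Re E) => _ [A [fA sA <-]].
  by have := HE A 0%N fA sA isT; rewrite lecE => /andP[].
have /choice[A HA] : forall k, exists A : 'M[{poly C}]_(r, n),
    [/\ factors A B, msize A N.+1 & ((sup S)%:C)%C - einv R k <= fsq (mc 0 A)].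
  move=> k; have k0 : 0 < k.+1%:R^-1 :> R by rewrite invr_gt0 ltr0n.
  have [_ [A [fA sA <-]] lx] := sup_adherent k0 S0; exists A; split=> //.
  rewrite -fr (_ : einv R k = ((k.+1%:R^-1)%:C)%C); last first.
    by rewrite /einv fmorphV rmorph_nat.
  by rewrite -rmorphB lecR ltW.
have [A' [sA' cA' eA']] := @ulim_mxpoly r n N.+1 A E (fun k => let: And3 _ s _ := HA k in s)
   (fun k t tN => let: And3 f s _ := HA k in HE _ _ f s tN).
exists A'; split; [|exact: sA'|].
  move=> w w1; apply/matrixP => a b; rewrite gram_entry.
  apply: (@ulim_uniq R (fun k => \sum_i ((A k i a).[w])^* * (A k i b).[w])).
    by apply: ulim_sum => i _; apply: ulimM (ulim_conj (eA' _ _ _)) (eA' _ _ _).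
  apply: (ulim_near (N := 0)) (ulimC _) => k _.
  by have [fA _ _] := HA k; rewrite -gram_entry fA.
move=> A1 f1 s1; apply: le_trans (_ : ((sup S)%:C)%C <= _).
  by rewrite -fr lecR; apply: sup_upper_bound => //; exists A1.
apply: (@ulim_le R (fun k => (sup S)%:C%C - einv R k) (fun k => fsq (mc 0 (A k))) _ _ 0).
- by move=> k _; have [] := HA k.
- have := ulimB (ulimC ((sup S)%:C)%C) (@ulim_einv R); by rewrite subr0.
apply: ulim_sum => i _; apply: ulim_sum => j _.
apply: (@ulim_near _ (fun k => (A k i j)`_0 * ((A k i j)`_0)^*) _ _ 0) => [k _|].
  by rewrite mxE normCK.
by rewrite mxE normCK; apply: ulimM (cA' _ _ _) (ulim_conj (cA' _ _ _)).
Qed.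

(** The new matrix has y as its component along the unit row u, in place of u M, and the same
    components orthogonal to u. *)
Lemma row_update r n (M : 'M[C]_(r, n)) (u : 'rV[C]_r) (y : 'rV[C]_n) :
  u *m u^t* = 1%:M ->
  let M' := M + u^t* *m (y - u *m M) in
  M'^t* *m M' = M^t* *m M + y^t* *m y - (u *m M)^t* *m (u *m M).
Proof.
move=> uu /=; have Ex : u *m M = u *m M by []; move: {2}(u *m M) Ex => x Ex; rewrite Ex.
have yE : y = (y - x) + x by rewrite subrK.
move: (y - x) yE => d ->.
have E1 : (u^t* *m d)^t* *m (u^t* *m d) = d^t* *m d.
  by rewrite ctM ctK -mulmxA (mulmxA u) uu mul1mx.
have E2 : M^t* *m (u^t* *m d) = x^t* *m d by rewrite mulmxA -ctM Ex.
have E3 : (u^t* *m d)^t* *m M = d^t* *m x by rewrite ctM ctK -mulmxA Ex.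
rewrite ctD mulmxDl !mulmxDr E1 E2 E3.
rewrite ctD !mulmxDl -!addrA; congr (_ + _).
by rewrite subrr addr0 [RHS]addrC !addrA.
Qed.

Definition cmx r s (M : 'M[C]_(r, s)) : 'M[{poly C}]_(r, s) := map_mx polyC M.

Lemma mev_cmx w r s (M : 'M[C]_(r, s)) : mev w (cmx M) = M.
Proof. by apply/matrixP => i j; rewrite !mxE /horner_eval hornerC. Qed.

Lemma mevD w r s (A B : 'M[{poly C}]_(r, s)) : mev w (A + B) = mev w A + mev w B.
Proof. exact: map_mxD. Qed.

Lemma mevB w r s (A B : 'M[{poly C}]_(r, s)) : mev w (A - B) = mev w A - mev w B.
Proof. exact: map_mxB. Qed.

Lemma mcD k r s (A B : 'M[{poly C}]_(r, s)) : mc k (A + B) = mc k A + mc k B.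
Proof. by apply/matrixP => i j; rewrite !mxE coefD. Qed.

Lemma mcB k r s (A B : 'M[{poly C}]_(r, s)) : mc k (A - B) = mc k A - mc k B.
Proof. by apply/matrixP => i j; rewrite !mxE coefB. Qed.

Lemma mc_cmxM k r s t (M : 'M[C]_(r, s)) (A : 'M[{poly C}]_(s, t)) :
  mc k (cmx M *m A) = M *m mc k A.
Proof.
apply/matrixP => i j; rewrite !mxE coef_sum; apply: eq_bigr => l _.
by rewrite !mxE coefCM.
Qed.

Lemma msize_cmxM r s t (M : 'M[C]_(r, s)) (A : 'M[{poly C}]_(s, t)) N :
  msize A N -> msize (cmx M *m A) N.
Proof.
move=> sA i j; apply/leq_sizeP => k Nk.
have -> : (cmx M *m A) i j = \sum_l (M i l)%:P * A l j.
  by rewrite mxE; apply: eq_bigr => l _; rewrite mxE.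
rewrite coef_sum big1 // => l _; rewrite coefCM nth_default ?mulr0 //.
exact: leq_trans (sA l j) Nk.
Qed.

Lemma mev_sum_mc w r s (A : 'M[{poly C}]_(r, s)) N : msize A N ->
  mev w A = \sum_(k < N) w ^+ k *: mc k A.
Proof.
move=> sA; apply/matrixP => i j; rewrite summxE mxE /horner_eval.
rewrite (horner_coef_wide _ (sA i j)); apply: eq_bigr => k _.
by rewrite !mxE mulrC.
Qed.

Section Outer.
Variables (r n N m : nat) (B : C -> 'M[C]_n) (Bp : 'M[{poly C}]_n).
Hypothesis HB : forall w, `|w| = 1 -> mev w Bp = w ^+ m *: B w.
Variable A : 'M[{poly C}]_(r, n).
Hypotheses (fA : factors A B) (sA : msize A N.+1).
Hypothesis Amax : forall A' : 'M[{poly C}]_(r, n), factors A' B -> msize A' N.+1 ->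
  fsq (mc 0 A') <= fsq (mc 0 A).

(** Exchanging the component u A for y produces another factor of B, which competes with A in
    [Amax]. *)
Lemma outer_row (u : 'rV[C]_r) (y : 'rV[{poly C}]_n) : u *m u^t* = 1%:M ->
  msize y N.+1 ->
  (forall w, `|w| = 1 ->
     (mev w y)^t* *m mev w y = (u *m mev w A)^t* *m (u *m mev w A)) ->
  fsq (mc 0 y) <= fsq (u *m mc 0 A).
Proof.
move=> uu sy Hy.
pose A' := A + cmx (u^t* ) *m (y - cmx u *m A).
have fA' : factors A' B.
  move=> w w1; rewrite /A' mevD mevM mevB mevM !mev_cmx.
  by rewrite row_update // Hy // addrK fA.
have sA' : msize A' N.+1.
  move=> i j; rewrite mxE; apply: leq_trans (size_polyD _ _) _.
  rewrite geq_max sA /=; apply: msize_cmxM => a b.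
  rewrite !mxE; apply: leq_trans (size_polyD _ _) _.
  rewrite size_polyN geq_max sy /=.
  by have := msize_cmxM u sA a b; rewrite mxE.
have := Amax fA' sA'; rewrite /A' mcD mc_cmxM mcB mc_cmxM.
have /(congr1 mxtrace) := row_update (mc 0 A) (mc 0 y) uu.
rewrite mxtraceD mxtraceD raddfN /= -!fsq_tr => ->.
by rewrite -addrA gerDl subr_le0.
Qed.

(** If u A vanishes at 0 to order e, then X^-e u A has the same Gram matrix on the circle, so by
    [outer_row] its value at 0 is bounded by that of u A, which is 0. Hence the order of vanishing
    can always be increased. *)
Lemma outer_unit_row0 (u : 'rV[C]_r) : u *m u^t* = 1%:M ->
  u *m mc 0 A = 0 -> forall k, u *m mc k A = 0.
Proof.
move=> uu u0; pose a := cmx u *m A.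
have sa : msize a N.+1 := msize_cmxM u sA.
suff H e k : (k < e)%N -> mc k a = 0.
  by move=> k; rewrite -mc_cmxM; apply: (H k.+1).
elim: e k => [//|e IH] k; rewrite ltnS leq_eqVlt => /orP[/eqP ->|/IH //].
pose y := map_mx (drop_poly e) a.
have aE : a = 'X^e *: y.
  apply/matrixP => i j; rewrite [RHS]mxE [y i j]mxE -[LHS](poly_take_drop e) mulrC.
  suff -> : take_poly e (a i j) = 0 by rewrite add0r.
  apply/polyP => l; rewrite coef_take_poly coef0; case: ltnP => // le.
  by have /matrixP/(_ i j) := IH l le; rewrite [LHS]mxE [RHS]mxE.
have mcy : mc 0 y = mc e a by apply/matrixP => i j; rewrite !mxE coef_drop_poly add0n.
rewrite -mcy; apply: fsq_eq0; apply/eqP; rewrite eq_le fsq_ge0 andbT.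
apply: le_trans (_ : fsq (u *m mc 0 A) <= _); last by rewrite u0 fsq0.
apply: outer_row => // [i j|w w1].
  by rewrite mxE size_drop_poly (leq_trans (leq_subr _ _)) ?sa.
rewrite -{1 2}(mev_cmx w u) -mevM -/a aE.
have -> : mev w ('X^e *: y) = w ^+ e *: mev w y.
  by apply/matrixP => i j; rewrite !mxE /horner_eval hornerM hornerXn.
rewrite ctZ -scalemxAl -scalemxAr scalerA /= -normCKC normrX w1.
by rewrite !expr1n scale1r.
Qed.

(** Removing the Blaschke factor of w0 from u A keeps the Gram matrix on the circle but divides the
    length at 0 by |w0| < 1. Maximality leaves only the possibility that u A vanishes at 0. *)
Lemma outer_unit_row (u : 'rV[C]_r) w0 : `|w0| < 1 -> u *m u^t* = 1%:M ->
  u *m mev w0 A = 0 -> forall k, u *m mc k A = 0.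
Proof.
move=> w01 uu u0; apply: outer_unit_row0 => //; pose a := cmx u *m A.
have sa : msize a N.+1 := msize_cmxM u sA.
pose q : {poly C} := 'X - w0%:P.
pose c := map_mx (fun p : {poly C} => p %/ q) a.
have aE : a = q *: c.
  apply/matrixP => i j; rewrite [RHS]mxE [c i j]mxE mulrC divpK //.
  by rewrite dvdp_XsubCl rootE -mev_entry mevM mev_cmx u0 mxE.
pose y := (1 - w0^* *: 'X) *: c.
have mcy : mc 0 y = mc 0 c.
  by apply/matrixP => i j; rewrite !mxE -!horner_coef0 !hornerE subr0 mul1r.
have mca : u *m mc 0 A = - w0 *: mc 0 c.
  rewrite -mc_cmxM -/a aE; apply/matrixP => i j.
  by rewrite !mxE -!horner_coef0 !hornerE.
suff : fsq (mc 0 c) <= `|w0| ^+ 2 * fsq (mc 0 c).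
  have w2 : `|w0| ^+ 2 < 1 by rewrite expr_lt1.
  rewrite -subr_ge0 -[X in _ - X]mul1r -mulrBl => h.
  have w3 : `|w0| ^+ 2 - 1 < 0 by rewrite subr_lt0.
  have h2 : fsq (mc 0 c) <= 0 by rewrite -(nmulr_rge0 _ w3).
  rewrite mca (_ : mc 0 c = 0) ?scaler0 //.
  by apply: fsq_eq0; apply/eqP; rewrite eq_le h2 fsq_ge0.
rewrite -[`|w0|]normrN -fsqZ -mca -mcy; apply: outer_row => // [i j|w w1].
  rewrite mxE; apply: leq_trans (size_polyMleq _ _) _.
  have s1 : (size (1 - w0^* *: 'X : {poly C})%R <= 2)%N.
    apply: leq_trans (size_polyD _ _) _; rewrite size_polyN geq_max size_poly1 /=.
    by apply: leq_trans (size_scale_leq _ _) _; rewrite size_polyX.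
  rewrite mxE size_divp ?polyXsubC_eq0 // size_XsubC.
  rewrite -subn1 leq_subLR add1n; apply: leq_trans (leq_add s1 (leq_sub2r 1 (sa i j))) _.
  by rewrite subn1.
rewrite -{1 2}(mev_cmx w u) -mevM -/a aE.
have E (p : {poly C}) : mev w (p *: c) = p.[w] *: mev w c.
  by apply/matrixP => i j; rewrite !mxE /horner_eval hornerM.
rewrite !E ctZ -scalemxAl -scalemxAr scalerA /= -normCKC.
rewrite ctZ -scalemxAl -scalemxAr scalerA /= -normCKC.
congr (_ ^+ 2 *: _); rewrite !hornerE.
have -> : 1 - w0^* * w = w * (w - w0)^*.
  by rewrite rmorphB mulrBr -normCK w1 expr1n mulrC.
by rewrite normrM w1 mul1r norm_conjC.
Qed.

Lemma outer_rows q (W : 'M[C]_(q, r)) w0 : `|w0| < 1 ->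
  W *m mev w0 A = 0 -> forall k, W *m mc k A = 0.
Proof.
move=> w01 WA k; apply/row_matrixP => i; rewrite row_mul row0.
have {WA} : row i W *m mev w0 A = 0 by rewrite -row_mul WA row0.
move: (row i W) => u uA; have [->|un0] := eqVneq u 0; first by rewrite mul0mx.
pose c := sqrtC (fsq u).
have c0 : 0 < c.
  rewrite sqrtC_gt0 lt_neqAle fsq_ge0 andbT eq_sym.
  by apply: contra un0 => /eqP/fsq_eq0 ->.
have cr : c^* = c by rewrite geC0_conj // ltW.
have uu : (c^-1 *: u) *m (c^-1 *: u)^t* = 1%:M.
  rewrite ctZ fmorphV /= cr -scalemxAl -scalemxAr scalerA (scalar_mx11 (u *m u^t* )).
  have -> : (u *m u^t* ) 0 0 = c ^+ 2.
    by rewrite sqrtCK /fsq big_ord1 mxE; apply: eq_bigr => j _; rewrite !mxE normCK.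
  rewrite scale_scalar_mx; congr (_ %:M); field.
  by rewrite gt_eqF.
have cu : (c^-1 *: u) *m mev w0 A = 0 by rewrite -scalemxAl uA scaler0.
have := outer_unit_row w01 uu cu k; rewrite -scalemxAl => /eqP.
by rewrite scaler_eq0 invr_eq0 gt_eqF //= => /eqP.
Qed.

(** Let A_K be the top coefficient, with K > m. Then A_K^* A_0 is a Fourier coefficient of B of
    index -K, hence zero. By [outer_rows] the rows of A_K^* annihilate every coefficient of A, in
    particular A_K itself. *)
Lemma outer_degree k : (m < k)%N -> mc k A = 0.
Proof.
suff H d K : (N - d < K)%N -> (m < K)%N -> mc K A = 0.
  by move=> mk; apply: (H N) => //; rewrite subnn (leq_ltn_trans _ mk).
elim: d K => [|d IH] K NK mK; first by apply: mc_eq0 sA _; rewrite subn0 in NK.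
have Htop j : (K < j)%N -> mc j A = 0.
  by move=> Kj; apply: IH; last exact: ltn_trans Kj; lia.
have E : (mc K A)^t* *m mc 0 A = 0.
  apply/matrixP => a b; rewrite mxE [RHS]mxE.
  have sb : (size (Bp a b) <= (size (Bp a b)))%N by [].
  pose L := (K + N.+1 + (K - m + size (Bp a b)))%N.
  have := @parseval C 'I_r 'I_1 (fun i => A i a) (fun i => 'X^K * A i b)
    (fun=> 1) (fun=> 'X^(K - m) * Bp a b) L.
  rewrite big_ord1 => P.
  have -> : \sum_j ((mc K A)^t* ) a j * mc 0 A j b =
      \sum_i \sum_(k < L) ((A i a)`_k)^* * ('X^K * A i b)`_k.
    apply: eq_bigr => i _.
    have KL : (K < L)%N by rewrite /L; lia.
    rewrite (bigD1 (Ordinal KL)) //= coefXnM ltnn subnn big1 ?addr0 ?mxE //.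
    move=> l /negP lK; rewrite coefXnM; case: ltnP => [_|Kl]; first by rewrite mulr0.
    have /Htop/matrixP/(_ i a) : (K < l)%N.
      by rewrite ltn_neqAle Kl andbT; apply/negP => /eqP lE; apply: lK; apply/eqP/val_inj.
    by rewrite !mxE => ->; rewrite conjC0 mul0r.
  rewrite P.
  - apply: big1 => l _; rewrite coef1 coefXnM; case: eqP => [->|_].
      by rewrite subn_gt0 mK mulr0.
    by rewrite conjC0 mul0r.
  - by move=> i; apply: leq_trans (sA _ _) _; rewrite /L; lia.
  - by move=> i; apply: leq_trans (size_XnM_le K (sA _ _)) _; rewrite /L; lia.
  - by move=> i; rewrite size_poly1 /L; lia.
  - by move=> i; apply: leq_trans (size_XnM_le _ sb) _; rewrite /L; lia.
  move=> w w1; rewrite big_ord1 hornerC conjC1 mul1r hornerM hornerXn.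
  rewrite -mev_entry HB // mxE mulrA -exprD subnK; last exact: ltnW.
  rewrite -fA // gram_entry mulr_sumr; apply: eq_bigr => i _.
  by rewrite hornerM hornerXn mulrCA.
apply: fsq_eq0; rewrite fsq_tr.
by rewrite (@outer_rows _ _ 0) ?mxtrace0 ?normr0 ?ltr01 // (mev_sum_mc _ sA)
  big_ord_recl expr0 scale1r big1 ?addr0 // => i _; rewrite expr0n scale0r.
Qed.

End Outer.

(** By [outer_rows] the columns of every A(w) lie in the column space of A(0), so A = A(0) Pi A with
    a generalized inverse Pi. Replacing the left factor A(0) by the n by n square root T of its Gram
    matrix makes the factor square. *)
Lemma outer_factor_size r n (A0 : 'M[{poly C}]_(r, n)) B m (Bp : 'M[{poly C}]_n) :
  factors A0 B -> (forall w, `|w| = 1 -> mev w Bp = w ^+ m *: B w) ->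
  exists A : 'M[{poly C}]_n, [/\ factors A B, msize A m.+1 &
    (forall w (x : 'cV[C]_n), `|w| = 1 -> B w *m x = 0 -> x = 0) ->
    forall w, `|w| <= 1 -> \det (mev w A) != 0].
Proof.
move=> f0 HB; have [N sN] := msize_ex A0.
have [A [fA sA Amax]] := max_factor f0 (msize_ge (leqnSn N) sN).
have rows := outer_rows fA sA Amax.
have sAm : msize A m.+1.
  move=> i j; apply/leq_sizeP => k mk.
  by have /matrixP/(_ i j) := outer_degree HB fA sA Amax mk; rewrite !mxE.
have [T TE] := psd_sqrt (psd_gram (mc 0 A)).
pose Pi := (pinvmx (mc 0 A)^T)^T.
have A0E : mev 0 A = mc 0 A.
  by apply/matrixP => i j; rewrite !mxE /horner_eval horner_coef0.
have PiE k : mc 0 A *m (Pi *m mc k A) = mc k A.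
  apply: trmx_inj; rewrite !trmx_mul /Pi trmxK; apply: mulmxKpV.
  rewrite submxE; apply/eqP; apply: trmx_inj; rewrite trmx_mul trmxK trmx0.
  apply: (rows _ _ 0); first by rewrite normr0 ltr01.
  by rewrite A0E; apply: trmx_inj; rewrite trmx_mul trmxK mulmx_coker trmx0.
have PiEw w : mc 0 A *m (Pi *m mev w A) = mev w A.
  rewrite (mev_sum_mc w sA) !mulmx_sumr; apply: eq_bigr => k _.
  by rewrite -!scalemxAr PiE.
pose A' := cmx (T *m Pi) *m A.
have gA w : (mev w A')^t* *m mev w A' = (mev w A)^t* *m mev w A.
  rewrite -[in RHS](PiEw w) /A' mevM mev_cmx -mulmxA; move: (Pi *m _) => Y.
  by rewrite !ctM -!mulmxA (mulmxA (T^t* )) TE !mulmxA.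
exists A'; split=> [w w1||].
- by rewrite gA fA.
- exact: msize_cmxM.
move=> Binj w w1; rewrite -unitfE -unitmxE; apply: unit_of_inj => x A'x.
have Ax : mev w A *m x = 0.
  by apply: fsq_eq0; rewrite -(fsq_gram _ (gA w)) A'x fsq0.
have inj1 v : `|v| = 1 -> mev v A *m x = 0 -> x = 0.
  by move=> v1 vx; apply: (Binj v) => //; rewrite -fA // -mulmxA vx mulmx0.
case: (real_leP (normr_real w) (@real1 C)) => w1'; last by rewrite (le_gtF w1) in w1'.
have [|wn1] := eqVneq `|w| 1; first by move=> /inj1; apply.
have {w1' wn1} w1' : `|w| < 1 by rewrite lt_neqAle wn1.
have W0 := rows _ (kermx (mev w A)) w w1' (mulmx_ker _).
(* Inside the disc the left kernel of A(w) annihilates all coefficients of A, hence A(1) too, so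
   A(w) has at least the rank n of A(1). *)
have sub : (kermx (mev w A) <= kermx (mev 1 A))%MS.
  apply/sub_kermxP; rewrite (mev_sum_mc 1 sA) mulmx_sumr big1 // => k _.
  by rewrite -scalemxAr W0 scaler0.
have r1 : \rank (mev 1 A) = n.
  apply/eqP; rewrite -[_ == _]/(row_full (mev 1 A)) -cokermx_eq0.
  apply/eqP/matrixP => i j; rewrite [RHS]mxE.
  have : mev 1 A *m col j (cokermx (mev 1 A)) = 0.
    by rewrite colE mulmxA mulmx_coker mul0mx.
  move=> h; have : col j (cokermx (mev 1 A)) = 0.
    by apply: (Binj 1); rewrite ?normr1 // -fA ?normr1 // -mulmxA h mulmx0.
  by move/matrixP/(_ i 0); rewrite !mxE.
have := mxrankS sub; rewrite !mxrank_ker r1 => h.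
have rw : row_full (mev w A).
  rewrite /row_full eqn_leq rank_leq_col /=.
  by have := rank_leq_row (mev 1 A); have := rank_leq_row (mev w A); rewrite r1; lia.
have /row_fullP[D DA] := rw.
by rewrite -[x]mul1mx -DA -mulmxA Ax mulmx0.
Qed.

End FejerRiesz.

(** * Existence of Fejer-Riesz factors by means of Fejer means *)

Section FejerRieszExistence.
Variable R : realType.
Local Notation C := R[i].

(* The Fejer weight [N - |t - m|]. *)
Definition ndiff (m t N : nat) : nat :=
  \sum_(i < N) \sum_(j < N) (t + i == m + j)%N.

Lemma sum_ord_lt N K : (K <= N)%N -> (\sum_(i < N) (i < K) = K)%N.
Proof.
move=> KN; rewrite -big_mkcond /= -(big_ord_widen _ (fun=> 1%N) KN).
by rewrite sum1_card card_ord.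
Qed.

Lemma ndiffE m t N : ndiff m t N = (N - maxn (t - m) (m - t))%N.
Proof.
have inner (i : 'I_N) : (\sum_(j < N) (t + i == m + j) = ((m <= t + i) && (t + i < m + N)))%N.
  case: (leqP m (t + i)) => mi /=; last first.
    by rewrite big1 // => j _; case: eqP => // h; lia.
  case: (ltnP (t + i) (m + N)) => iN /=; last first.
    by rewrite big1 // => j _; case: eqP => // h; have := ltn_ord j; lia.
  have lt : (t + i - m < N)%N by lia.
  rewrite (bigD1 (Ordinal lt)) //= subnKC // eqxx big1 // => j jn.
  case: eqP => // h; case/eqP: jn; apply: val_inj => /=; lia.
rewrite /ndiff; under eq_bigr => i _ do rewrite inner.
case: (leqP m t) => mt.
  rewrite (_ : maxn _ _ = t - m)%N; last lia.
  rewrite -[RHS](sum_ord_lt (leq_subr (t - m) N)); apply: eq_bigr => i _.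
  by congr nat_of_bool; have := ltn_ord i; lia.
rewrite (_ : maxn _ _ = m - t)%N; last lia.
rewrite -[RHS](sum_ord_lt (leq_subr (m - t) N)) [LHS](reindex_inj rev_ord_inj) /=.
apply: eq_bigr => i _; congr nat_of_bool; have := ltn_ord i; lia.
Qed.

Lemma ulim_ndiff m t : ulim (fun k => (ndiff m t k.+1)%:R / k.+1%:R : C) 1.
Proof.
pose d := maxn (t - m) (m - t).
have := ulimB (ulimC (1 : C)) (ulimM (ulimC (d%:R : C)) (@ulim_einv R)).
rewrite mulr0 subr0; apply: (ulim_near (N := d)) => k dk.
by rewrite ndiffE natrB 1?leqW // mulrBl divff ?pnatr_eq0.
Qed.

Variables (n m : nat) (B : C -> 'M[C]_n) (Bp : 'M[{poly C}]_n).
Hypothesis HB : forall w, `|w| = 1 -> mev w Bp = w ^+ m *: B w.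
Hypothesis sB : msize Bp (m + m).+1.
Hypothesis Bpsd : forall w, `|w| = 1 -> psd (B w).

(* The [N]-th Fejer mean of [B], multiplied by [w ^+ m]. *)
Definition fejer N : 'M[{poly C}]_n :=
  \matrix_(a, b) \poly_(t < (m + m).+1) ((ndiff m t N)%:R / N%:R * (Bp a b)`_t).

(* The Fejer mean is an average of translates of [B] with nonnegative weights;
   sampling at roots of unity makes this average a finite sum. *)
Lemma fejer_sos N : exists r (A : 'M[{poly C}]_(r, n)),
  factors A (fun w => w ^- m *: mev w (fejer N.+1)).
Proof.
(* More sample points than any exponent t + i or m + j that occurs below, so that the sums over s
   detect equality of exponents. *)
pose M := (m + m + N.+1).+1; have [z Hz] := prim_root_ex C (ltn0Sn (m + m + N.+1)).
have z1 (s : nat) : `|z ^+ s| = 1 by rewrite normrX (norm_prim_root Hz) expr1n.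
have /choice[T HT] : forall s : nat, exists T : 'M[C]_n, T^t* *m T = B (z ^+ s).
  by move=> s; apply: psd_sqrt; apply: Bpsd.
pose c : C := sqrtC (M%:R * N.+1%:R)^-1.
(* On the circle |phi_s|^2 is N + 1 times the Fejer kernel translated by z^s. *)
pose phi (s : nat) : {poly C} := \sum_(i < N.+1) (z ^+ s) ^- i *: 'X^i.
pose ev (p : 'I_#|{: 'I_M * 'I_n}|) : 'I_M * 'I_n := enum_val p.
pose A : 'M[{poly C}]_(#|{: 'I_M * 'I_n}|, n) :=
  \matrix_(p, j) ((c * T (ev p).1 (ev p).2 j) *: phi (ev p).1).
exists _, A => w w1; apply/matrixP => a b; rewrite gram_entry !mxE /horner_eval.
have w0 : w != 0 := norm1_neq0 w1.
transitivity (\sum_(p : 'I_M * 'I_n)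
   ((c * T p.1 p.2 a) * (phi p.1).[w])^* * ((c * T p.1 p.2 b) * (phi p.1).[w])).
  rewrite [RHS](reindex _ (onW_bij _ (@enum_val_bij {: 'I_M * 'I_n}))) /=.
  by apply: eq_bigr => p _; rewrite !mxE !hornerZ.
rewrite -(pair_bigA _ (fun (s : 'I_M) (i : 'I_n) =>
  ((c * T s i a) * (phi s).[w])^* * ((c * T s i b) * (phi s).[w]))) /=.
have c2 : c^* * c = (M%:R * N.+1%:R)^-1.
  rewrite geC0_conj -?expr2 ?sqrtCK // sqrtC_ge0 invr_ge0 mulr_ge0 ?ler0n //.
have phiE (s : nat) : (phi s).[w]^* * (phi s).[w] =
    \sum_(i < N.+1) \sum_(j < N.+1) (z ^+ s) ^+ i * (z ^+ s) ^- j * (w ^- i * w ^+ j).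
  rewrite /phi horner_sum rmorph_sum mulr_suml; apply: eq_bigr => i _.
  rewrite mulr_sumr; apply: eq_bigr => j _.
  rewrite !hornerZ !hornerXn rmorphM rmorphXn fmorphV rmorphXn /=.
  rewrite (conj_unit w1) (conj_unit (z1 s)) !exprVn invrK; ring.
have BE (s : nat) : B (z ^+ s) a b = \sum_(t < (m + m).+1) (Bp a b)`_t * ((z ^+ s) ^- m * (z ^+ s) ^+ t).
  have := congr1 (fun A : 'M_n => A a b) (HB (z1 s)); rewrite !mxE /horner_eval.
  rewrite (horner_coef_wide _ (sB a b)) => /(congr1 (fun x => (z ^+ s) ^- m * x)).
  rewrite mulrA mulVf ?mul1r => [<-|]; last by rewrite expf_neq0 ?norm1_neq0.
  by rewrite mulr_sumr; apply: eq_bigr => t _; rewrite mulrCA.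
transitivity ((M%:R * N.+1%:R)^-1 * \sum_(s < M) B (z ^+ s) a b * ((phi s).[w]^* * (phi s).[w])).
  rewrite mulr_sumr; apply: eq_bigr => s _.
  rewrite -c2 -HT mxE mulr_suml mulr_sumr; apply: eq_bigr => i _.
  by rewrite !mxE !rmorphM /=; ring.
have -> : \sum_(s < M) B (z ^+ s) a b * ((phi s).[w]^* * (phi s).[w]) =
    \sum_(t < (m + m).+1) \sum_(i < N.+1) \sum_(j < N.+1)
      (Bp a b)`_t * (w ^- i * w ^+ j) * 
      \sum_(s < M) ((z ^+ s) ^- (m + j) * (z ^+ s) ^+ (t + i)).
  under eq_bigr => s _.
    rewrite BE phiE mulr_suml.
    under eq_bigr => t _.
      rewrite mulr_sumr.
      under eq_bigr => i _ do rewrite mulr_sumr.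
      over.
    over.
  rewrite exchange_big; apply: eq_bigr => t _; rewrite exchange_big; apply: eq_bigr => i _.
  rewrite exchange_big; apply: eq_bigr => j _; rewrite mulr_sumr; apply: eq_bigr => s _.
  rewrite !exprD invfM; ring.
rewrite horner_poly !mulr_sumr; apply: eq_bigr => t _.
under eq_bigr => i _.
  under eq_bigr => j _.
    rewrite (sum_prim_root _ _ Hz) !modn_small; last 2 first.
    - by have := ltn_ord i; have := ltn_ord t; rewrite /M; lia.
    - by have := ltn_ord j; rewrite /M; lia.
    over.
  over.
have E (i j : 'I_N.+1) : (Bp a b)`_t * (w ^- i * w ^+ j) * (if (m + j == t + i)%N then M%:R else 0)
    = ((t + i == m + j)%N)%:R * ((Bp a b)`_t * (w ^- m * w ^+ t) * M%:R).
  rewrite eq_sym; case: eqP => [h|_]; last by rewrite mulr0 mul0r.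
  have -> : w ^- i * w ^+ j = w ^- m * w ^+ t.
    apply/eqP; rewrite ![_^-1 * _]mulrC eqr_div ?expf_neq0 // -!exprD eq_sym.
    by rewrite h addnC.
  by rewrite mul1r.
under eq_bigr => i _ do under eq_bigr => j _ do rewrite E.
set K := _ * _ * M%:R.
have -> : \sum_(i < N.+1) \sum_(j < N.+1) (t + i == m + j)%N%:R * K = (ndiff m t N.+1)%:R * K.
  rewrite /ndiff natr_sum mulr_suml; apply: eq_bigr => i _.
  by rewrite natr_sum mulr_suml.
rewrite /K; field.
by rewrite expf_neq0 // addrC natr1 !pnatr_eq0.
Qed.

Lemma fejer_lim w a b : ulim (fun k => (fejer k.+1 a b).[w]) (Bp a b).[w].
Proof.
rewrite (horner_coef_wide _ (sB a b)).
apply: (@ulim_near _ (fun k => \sum_(t < (m + m).+1)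
  ((ndiff m t k.+1)%:R / k.+1%:R * (Bp a b)`_t) * w ^+ t) _ _ 0) => [k _|].
  by rewrite mxE horner_poly.
apply: ulim_sum => t _; apply: ulimM (ulimC _).
by rewrite -[X in ulim _ X]mul1r; apply: ulimM (ulim_ndiff _ _) (ulimC _).
Qed.

(** The energy is the trace of the mean value of B, to which the Fejer weights assign the factor 1.
    Being independent of N, it bounds the factors uniformly. *)
Lemma fejer_energy r N (A : 'M[{poly C}]_(r, n)) K : msize A K ->
  factors A (fun w => w ^- m *: mev w (fejer N.+1)) ->
  \sum_(k < K) fsq (mc k A) = \sum_a (Bp a a)`_m.
Proof.
move=> sA fA.
pose L := (K + (m + m).+1)%N.
have mL : (m < L)%N by rewrite /L; lia.
transitivity (\sum_(k < L) fsq (mc k A)).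
  apply: (@sum_ord_widen _ (fun k => fsq (mc k A))) => [|k Kk]; first exact: leq_addr.
  by rewrite (mc_eq0 sA Kk) fsq0.
have := @parseval C ('I_r * 'I_n)%type 'I_n (fun p => A p.1 p.2) (fun p => A p.1 p.2)
  (fun=> 'X^m) (fun a => fejer N.+1 a a) L.
have -> : \sum_(k < L) fsq (mc k A) =
    \sum_(p : 'I_r * 'I_n) \sum_(k < L) ((A p.1 p.2)`_k)^* * (A p.1 p.2)`_k.
  rewrite -(pair_bigA _ (fun i j => \sum_(k < L) ((A i j)`_k)^* * (A i j)`_k)) /=.
  rewrite exchange_big; apply: eq_bigr => i _; rewrite exchange_big; apply: eq_bigr => j _.
  by apply: eq_bigr => k _; rewrite mxE normCKC.
move=> ->.
- apply: eq_bigr => a _; rewrite (bigD1 (Ordinal mL)) //= coefXn eqxx conjC1 mul1r.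
  rewrite big1 ?addr0 => [|k km]; last first.
    rewrite coefXn (_ : (k == m :> nat) = false) ?conjC0 ?mul0r //.
    by apply/negbTE; apply: contra km => /eqP km; apply/eqP/val_inj.
  rewrite mxE coef_poly ifT; last by lia.
  by rewrite ndiffE subnn maxnn subn0 divff ?mul1r // pnatr_eq0.
- by move=> p; apply: leq_trans (sA _ _) (leq_addr _ _).
- by move=> p; apply: leq_trans (sA _ _) (leq_addr _ _).
- by move=> a; rewrite size_polyXn; lia.
- by move=> a; rewrite mxE; apply: leq_trans (size_poly _ _) _; rewrite /L; lia.
move=> w w1.
transitivity (\tr ((mev w A)^t* *m mev w A)).
  rewrite /mxtrace; under [RHS]eq_bigr => a _ do rewrite gram_entry.
  by rewrite exchange_big pair_big.
rewrite fA // /mxtrace; apply: eq_bigr => a _.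
by rewrite mxE mev_entry hornerXn rmorphXn /= (conj_unit w1) exprVn.
Qed.

Theorem fejer_riesz :
  exists A : 'M[{poly C}]_n, [/\ factors A B, msize A m.+1 &
    (forall w (x : 'cV[C]_n), `|w| = 1 -> B w *m x = 0 -> x = 0) ->
    forall w, `|w| <= 1 -> \det (mev w A) != 0].
Proof.
have /choice[A HA] : forall k, exists A : 'M[{poly C}]_n,
    factors A (fun w => w ^- m *: mev w (fejer k.+1)) /\ msize A m.+1.
  move=> k; have [r [A0 fA0]] := fejer_sos k.
  have [|A [fA sA _]] := @outer_factor_size R r n A0 _ m (fejer k.+1) fA0; last by exists A.
  by move=> w w1; rewrite scalerA mulfV ?scale1r // expf_neq0 // norm1_neq0.
have [|k t tm|A' [sA' _ eA']] := @ulim_mxpoly R n n m.+1 A (\sum_a (Bp a a)`_m).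
- by move=> k; have [] := HA k.
- have [fA sA] := HA k; rewrite -(fejer_energy sA fA) (bigD1 (Ordinal tm)) //= lerDl.
  by apply: sumr_ge0 => i _; apply: fsq_ge0.
(* The limit A' is a factor of B but is not known to be outer, so an outer one is chosen anew. *)
apply: (outer_factor_size (A0 := A') _ HB) => w w1; apply/matrixP => a b.
rewrite gram_entry; apply: (@ulim_uniq R (fun k => \sum_i ((A k i a).[w])^* * (A k i b).[w])).
  by apply: ulim_sum => i _; apply: ulimM (ulim_conj (eA' _ _ _)) (eA' _ _ _).
have w0 : w ^+ m != 0 by rewrite expf_neq0 ?norm1_neq0.
have -> : B w a b = w ^- m * (Bp a b).[w].
  by rewrite -mev_entry HB // mxE mulrA mulVf ?mul1r.
apply: (ulim_near (N := 0)) (ulimM (ulimC (w ^- m)) (fejer_lim w a b)) => k _.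
have [fA _] := HA k; have /matrixP/(_ a b) := fA w w1.
by rewrite gram_entry => ->; rewrite [RHS]mxE mev_entry.
Qed.

End FejerRieszExistence.

(** * Sums of squares for stable polynomials *)

Lemma ct_entry (C : numClosedFieldType) r s (A : 'M[C]_(r, s)) i j :
  (A^t* ) i j = (A j i)^*.
Proof. by rewrite !mxE. Qed.

Lemma ctB (C : numClosedFieldType) r s (A B : 'M[C]_(r, s)) : (A - B)^t* = A^t* - B^t*.
Proof. by rewrite !raddfB. Qed.

Lemma block_gram (C : numClosedFieldType) m s (L : nat -> nat -> 'M[C]_s) :
  (forall i j, (L i j)^t* = L j i) ->
  (forall c : nat -> 'cV[C]_s,
     0 <= \sum_(i < m) \sum_(j < m) ((c i)^t* *m L i j *m c j) 0 0) ->
  exists N (Q : 'M[{poly C}]_(N, s)),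
  [/\ msize Q m,
      forall i j, (i < m)%N -> (j < m)%N -> (mc i Q)^t* *m mc j Q = L i j &
      forall v : 'rV[C]_N, (forall k, v *m mc k Q = 0) -> v = 0].
Proof.
move=> LJ L_ge0.
pose T := ('I_m * 'I_s)%type.
pose ev (p : 'I_#|{: T}|) : T := enum_val p.
pose H : 'M[C]_#|{: T}| := \matrix_(p, p') L (ev p).1 (ev p').1 (ev p).2 (ev p').2.
have Hpsd : psd H.
  split.
    by apply/matrixP => p p'; rewrite !mxE -[in RHS]LJ !mxE.
  move=> x; pose c k : 'cV_s :=
    \col_a (if insub k is Some k' then x (enum_rank ((k', a) : T)) 0 else 0).
  have := L_ge0 c; congr (0 <= _).
  rewrite mxE (reindex _ (onW_bij _ (@enum_rank_bij T))) /=.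
  pose F (t t' : T) := (x (enum_rank t) 0)^* * L t.1 t'.1 t.2 t'.2 * x (enum_rank t') 0.
  transitivity (\sum_(t' : T) \sum_(t : T) F t t'); last first.
    apply: eq_bigr => t' _; rewrite mxE mulr_suml (reindex _ (onW_bij _ (@enum_rank_bij T))) /=.
    by apply: eq_bigr => t _; rewrite !mxE /ev !enum_rankK.
  transitivity (\sum_(j < m) \sum_b \sum_(t : T) F t (j, b)); last first.
    by rewrite pair_bigA; apply: eq_bigr => -[j b].
  rewrite exchange_big; apply: eq_bigr => j _.
  transitivity (\sum_(i < m) \sum_b \sum_a F (i, a) (j, b)); last first.
    rewrite exchange_big; apply: eq_bigr => b _; rewrite pair_bigA.
    by apply: eq_bigr => -[].
  apply: eq_bigr => i _; rewrite mxE; apply: eq_bigr => b _.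
  rewrite mxE mulr_suml; apply: eq_bigr => a _.
  by rewrite !mxE !valK.
have [N [Q0 [Q0f Q0E]]] := gram_factor Hpsd.
pose Q : 'M[{poly C}]_(N, s) := \matrix_(r, a) \poly_(k < m)
  (if insub k is Some k' then Q0 r (enum_rank ((k', a) : T)) else 0).
have QE (k : 'I_m) r a : mc k Q r a = Q0 r (enum_rank ((k, a) : T)).
  by rewrite !mxE coef_poly ltn_ord valK.
have sQ : msize Q m by move=> r a; rewrite mxE size_poly.
exists N, Q; split=> // [i j im jm|v vQ].
  apply/matrixP => a b.
  have := congr1 (fun M : 'M_#|{: T}| => M (enum_rank ((Ordinal im, a) : T)) (enum_rank ((Ordinal jm, b) : T))) Q0E.
  rewrite [RHS]mxE /ev !enum_rankK /= => <-; rewrite [LHS]mxE [RHS]mxE; apply: eq_bigr => r _.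
  by rewrite !ct_entry -(QE (Ordinal im)) -(QE (Ordinal jm)).
have : v *m Q0 = 0.
  apply/matrixP => i p; rewrite [RHS]mxE.
  rewrite -(enum_valK p); case: (enum_val p) => k a.
  have /matrixP/(_ i a) := vQ k; rewrite [LHS]mxE [RHS]mxE => E; rewrite mxE -[RHS]E.
  by apply: eq_bigr => r _; rewrite QE.
by move=> vQ0; apply: (row_free_inj Q0f); rewrite /= vQ0 mul0mx.
Qed.

Lemma bez_sub_ge0 (R : realType) s t m (M1 : 'M[{poly R[i]}]_s) (M2 : 'M[{poly R[i]}]_(t, s)) :
  (forall w, `|w| = 1 -> (mev w M1)^t* *m mev w M1 = (mev w M2)^t* *m mev w M2) ->
  (forall w, `|w| <= 1 -> \det (mev w M1) != 0) ->
  forall c : nat -> 'cV[R[i]]_s,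
  0 <= \sum_(i < m) \sum_(j < m) ((c i)^t* *m (bez M1 i j - bez M2 i j) *m c j) 0 0.
Proof.
move=> E D c.
have -> : \sum_(i < m) \sum_(j < m) ((c i)^t* *m (bez M1 i j - bez M2 i j) *m c j) 0 0 =
    \sum_(i < m) \sum_(j < m) ((c i)^t* *m bez M1 i j *m c j) 0 0 -
    \sum_(i < m) \sum_(j < m) ((c i)^t* *m bez M2 i j *m c j) 0 0.
  rewrite -sumrB; apply: eq_bigr => i _; rewrite -sumrB; apply: eq_bigr => j _.
  by rewrite mulmxBr mulmxBl mxE [X in _ + X]mxE.
rewrite subr_ge0 !bez_energy; exact: energy_concentration.
Qed.

Section HermitianForms.
Variable C : numClosedFieldType.

(* Kernels in [conj z^j w^k] and [z^j' w^k'], stored as coefficients [S j k j' k'];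
   [diffz S] and [diffw S] are [(1 - conj z Z) S] and [(1 - conj w W) S]. *)
Definition gramf d (F : 'I_d -> nat -> nat -> C) j k j' k' : C :=
  \sum_i (F i j k)^* * F i j' k'.

Definition diffz (S : nat -> nat -> nat -> nat -> C) j k j' k' : C :=
  S j k j' k' - (if (j, j') is (j1.+1, j1'.+1) then S j1 k j1' k' else 0).

Definition diffw (S : nat -> nat -> nat -> nat -> C) j k j' k' : C :=
  S j k j' k' - (if (k, k') is (k1.+1, k1'.+1) then S j k1 j' k1' else 0).

End HermitianForms.

(** * The lurking isometry for polynomials without zeros in the closed bidisc *)

Section Stable.
Variable R : realType.
Local Notation C := R[i].
Variables (n m : nat) (q : nat -> nat -> C).
Hypothesis q_stable : forall z w, `|z| <= 1 -> `|w| <= 1 ->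
  \sum_(j < n.+1) \sum_(k < m.+1) q j k * z ^+ j * w ^+ k != 0.

(** [qp j] and [qt j] are the coefficients of z^j in q and in its reflection q~. *)
Let qp j : {poly C} := \poly_(k < m.+1) q j k.
Let qt j : {poly C} := \poly_(k < m.+1) (q (n - j) (m - k))^*.
Let f w : {poly C} := \poly_(j < n.+1) (qp j).[w].

Lemma norm1_le1 (w : C) : `|w| = 1 -> `|w| <= 1.
Proof. by move=> ->. Qed.

Lemma horner_reverse (c : nat -> C) w : `|w| = 1 ->
  w ^+ m * ((\poly_(k < m.+1) c k).[w])^* = (\poly_(k < m.+1) (c (m - k)%N)^*).[w].
Proof.
move=> w1; rewrite !horner_poly rmorph_sum mulr_sumr (reindex_inj rev_ord_inj) /=.
apply: eq_bigr => k _; have km : (k <= m)%N by rewrite -ltnS.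
rewrite subSS rmorphM rmorphXn /= (conj_unit w1) mulrCA; congr (_ * _).
by rewrite exprVn -expfB_cond ?(negbTE (norm1_neq0 w1)) ?leq_subr // subKn.
Qed.

Lemma qp_reverse w j : (j <= n)%N -> `|w| = 1 -> w ^+ m * ((qp j).[w])^* = (qt (n - j)).[w].
Proof. by move=> jn w1; rewrite horner_reverse // /qt subKn. Qed.

Lemma qt_reverse w j : (j <= n)%N -> `|w| = 1 -> w ^+ m * ((qt j).[w])^* = (qp (n - j)).[w].
Proof.
move=> jn w1; rewrite (horner_reverse (fun k => (q (n - j) (m - k))^*)) //.
congr (_.[w]); apply/polyP => k; rewrite !coef_poly; case: ltnP => // km.
by rewrite /= conjCK subKn.
Qed.

Lemma coef_f w j : (j <= n)%N -> (f w)`_j = (qp j).[w].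
Proof. by move=> jn; rewrite coef_poly ltnS jn. Qed.

Lemma size_f w : (size (f w) <= n.+1)%N.
Proof. exact: size_poly. Qed.

Lemma coef_recip_f w j : (j <= n)%N -> `|w| = 1 ->
  (recip n (f w))`_j = w ^- m * (qt j).[w].
Proof.
move=> jn w1; rewrite coef_poly ltnS jn coef_f ?leq_subr //.
have w0 : w ^+ m != 0 by rewrite expf_neq0 ?norm1_neq0.
by apply: (mulfI w0); rewrite qp_reverse ?leq_subr // subKn // mulrA mulfV // mul1r.
Qed.

Lemma f_stable w z : `|w| <= 1 -> `|z| <= 1 -> (f w).[z] != 0.
Proof.
move=> w1 z1; have := q_stable z1 w1; congr (_ != 0).
rewrite horner_poly; apply: eq_bigr => j _.
rewrite horner_poly mulr_suml; apply: eq_bigr => k _; ring.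
Qed.

Let K w i j : C := bz (f w) i j - bz (recip n (f w)) i j.
Let B w : 'M[C]_n := \matrix_(i, j) K w i j.
(** On the circle the conjugate of a coefficient is w^-m times a reversed coefficient, which makes
    w^m B(w) a polynomial in w. *)
Let Bp : 'M[{poly C}]_n := \matrix_(i, j) \sum_(l < (minn i j).+1)
  (qt (n - (i - l)) * qp (j - l) - qp (n - (i - l)) * qt (j - l)).

Lemma B_poly w : `|w| = 1 -> mev w Bp = w ^+ m *: B w.
Proof.
move=> w1; apply/matrixP => i j; rewrite mev_entry !mxE /K !bzE -sumrB horner_sum mulr_sumr.
have w0 : w ^+ m != 0 by rewrite expf_neq0 ?norm1_neq0.
apply: eq_bigr => l _; have ni := ltn_ord i; have nj := ltn_ord j.
rewrite !coef_f ?coef_recip_f //; try lia.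
rewrite hornerD hornerN !hornerM -qp_reverse // -?qt_reverse //; try lia.
rewrite rmorphM /= fmorphV rmorphXn /= (conj_unit w1) exprVn invrK.
by field.
Qed.

Lemma size_Bp : msize Bp (m + m).+1.
Proof.
move=> i j; rewrite mxE; apply: leq_trans (size_sum _ _ _) _.
apply/bigmax_leqP => l _; apply: leq_trans (size_polyD _ _) _.
have H (c d : nat -> C) : (size ((\poly_(k < m.+1) c k) * (\poly_(k < m.+1) d k))%R <= (m + m).+1)%N.
  apply: leq_trans (size_polyMleq _ _) _.
  have h1 := size_poly m.+1 c; have h2 := size_poly m.+1 d.
  by rewrite -subn1 leq_subLR; apply: leq_trans (leq_add h1 h2) _; rewrite addSn addnS.
by rewrite size_polyN geq_max !H.
Qed.

Lemma B_psd w : `|w| = 1 -> psd (B w).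
Proof.
move=> w1; split.
  by apply/matrixP => i j; rewrite !mxE /K rmorphB /= !bzJ.
move=> x; pose c k := if insub k is Some k' then x k' 0 else 0.
have cE (i : 'I_n) : c i = x i 0 by rewrite /c valK.
have := schur_cohn_ge0 (size_f w) (fun z => f_stable (norm1_le1 w1)) c.
congr (0 <= _); rewrite mxE exchange_big /=; apply: eq_bigr => j _.
rewrite mxE mulr_suml; apply: eq_bigr => i _.
by rewrite !mxE !cE.
Qed.
Lemma B_nondeg w (x : 'cV[C]_n) : `|w| = 1 -> B w *m x = 0 -> x = 0.
Proof.
move=> w1 Bx; pose c k := if insub k is Some k' then x k' 0 else 0.
have cE (i : 'I_n) : c i = x i 0 by rewrite /c valK.
have H := schur_cohn_nondeg (size_f w) (fun z => f_stable (norm1_le1 w1)) (c := c).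
apply/matrixP => i a; rewrite ord1 mxE -cE; apply: H => // l ln.
have /matrixP/(_ (Ordinal ln) 0) := Bx; rewrite !mxE => {2}<-.
by apply: eq_bigr => j _; rewrite mxE cE.
Qed.

Section Decompose.
Variable A : 'M[{poly C}]_n.
Hypotheses (fA : factors A B) (sA : msize A m.+1).
Hypothesis dA : forall w, `|w| <= 1 -> \det (mev w A) != 0.

(* The lurking isometry: [M1] and [M2] are the columns [(q, z P)] and [(q~, P)]. *)
Let M1 : 'M[{poly C}]_n.+1 := \matrix_(i, j)
  if unlift ord0 i is Some i' then
    if unlift ord0 j is Some j' then A i' j' else 0
  else qp j.
Let M2 : 'M[{poly C}]_n.+1 := \matrix_(i, j)
  if unlift ord0 i is Some i' then
    if unlift ord_max j is Some j' then A i' j' else 0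
  else qt j.

Lemma size_M1 : msize M1 m.+1.
Proof.
move=> i j; rewrite mxE; case: unliftP => [i' _|_]; last exact: size_poly.
by case: unliftP => [j' _|_]; rewrite ?size_poly0.
Qed.

Lemma size_M2 : msize M2 m.+1.
Proof.
move=> i j; rewrite mxE; case: unliftP => [i' _|_]; last exact: size_poly.
by case: unliftP => [j' _|_]; rewrite ?size_poly0.
Qed.

Lemma K_gram w (i j : 'I_n) : `|w| = 1 ->
  \sum_l ((A l i).[w])^* * (A l j).[w] = K w i j.
Proof. by move=> w1; rewrite -gram_entry fA // mxE. Qed.

(** By [bzS] the passage from K(i, j) to K(i+1, j+1) adds the products of coefficients of q and
    subtracts those of q~. Embedding A behind column 0 in [M1] and before the last column in [M2]
    produces exactly this shift; K vanishes when an index is n. *)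
Lemma M1_M2 w : `|w| = 1 -> (mev w M1)^t* *m mev w M1 = (mev w M2)^t* *m mev w M2.
Proof.
move=> w1; apply/matrixP => i j; rewrite !gram_entry !big_ord_recl.
have E1 (l : 'I_n) (b : 'I_n.+1) : M1 (lift ord0 l) b =
    if unlift ord0 b is Some j' then A l j' else 0 by rewrite mxE liftK.
have E2 (l : 'I_n) (b : 'I_n.+1) : M2 (lift ord0 l) b =
    if unlift ord_max b is Some j' then A l j' else 0 by rewrite mxE liftK.
have E3 (b : 'I_n.+1) : M1 ord0 b = qp b by rewrite mxE unlift_none.
have E4 (b : 'I_n.+1) : M2 ord0 b = qt b by rewrite mxE unlift_none.
under eq_bigr => l _ do rewrite !E1.
under [in RHS]eq_bigr => l _ do rewrite !E2.
rewrite !E3 !E4.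
have ni := leq_ord i; have nj := leq_ord j.
have rE a b : (a <= n)%N -> (b <= n)%N ->
    ((recip n (f w))`_a)^* * (recip n (f w))`_b = ((qt a).[w])^* * (qt b).[w].
  move=> an bn; rewrite !coef_recip_f // rmorphM fmorphV rmorphXn /=.
  rewrite (conj_unit w1) exprVn invrK; have w0 := norm1_neq0 w1.
  by field; rewrite expf_neq0.
have -> : \sum_l (if unlift ord_max i is Some i' then A l i' else 0).[w]^* *
    (if unlift ord_max j is Some j' then A l j' else 0).[w] = K w i j.
  case: unliftP => [i'|] iE; last first.
    rewrite big1 => [|l _]; last by rewrite horner0 conjC0 mul0r.
    by rewrite /K (bz_recip_ge (size_f w)) ?subrr // iE leqnn.
  case: unliftP => [j'|] jE; last first.
    rewrite big1 => [|l _]; last by rewrite horner0 mulr0.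
    by rewrite /K (bz_recip_ge (size_f w)) ?subrr // jE leqnn orbT.
  by rewrite K_gram // iE jE !lift_max.
case: unliftP => [i'|] iE; last first.
  rewrite big1 => [|l _]; last by rewrite horner0 conjC0 mul0r.
  by rewrite addr0 iE /K !bz0l !coef_f // rE // addrC subrK.
case: unliftP => [j'|] jE; last first.
  rewrite big1 => [|l _]; last by rewrite horner0 mulr0.
  by rewrite addr0 jE /K !bz0r !coef_f // rE // addrC subrK.
rewrite K_gram // iE jE !lift0 /K !bzS !coef_f ?rE -?lift0 -?iE -?jE //.
by ring.
Qed.

Lemma det_M1 : \det M1 = qp 0 * \det A.
Proof.
rewrite (expand_det_col _ ord0) big_ord_recl big1 ?addr0 => [|l _]; last first.
  by rewrite !mxE liftK unlift_none mul0r.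
rewrite mxE unlift_none /cofactor expr0 mul1r; congr (_ * \det _).
by apply/matrixP => i j; rewrite !mxE !liftK.
Qed.

Lemma det_M2 : \det M2 = (-1) ^+ n * qt n * \det A.
Proof.
rewrite (expand_det_col _ ord_max) big_ord_recl big1 ?addr0 => [|l _]; last first.
  by rewrite !mxE liftK unlift_none mul0r.
rewrite mxE unlift_none /cofactor add0n mulrCA mulrA; congr (_ * \det _).
by apply/matrixP => i j; rewrite !mxE !liftK.
Qed.

Lemma qp0_stable w : `|w| <= 1 -> (qp 0).[w] != 0.
Proof.
move=> w1; have := @f_stable w 0 w1; rewrite normr0 => /(_ ler01).
by rewrite horner_coef0 coef_f.
Qed.

(** The coefficients of (M1^* M1 - M2^* M2) / (1 - conj w W), the kernel that is to become Q^* Q. *)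
Let L i j := bez M1 i j - bez M2 i j.

Lemma L_ge i j : (m <= i)%N || (m <= j)%N -> L i j = 0.
Proof.
move=> mij; apply/eqP; rewrite subr_eq0; apply/eqP.
exact: bez_eq size_M1 size_M2 M1_M2 mij.
Qed.

Lemma L_ge0 (c : nat -> 'cV[C]_n.+1) :
  0 <= \sum_(i < m) \sum_(j < m) ((c i)^t* *m L i j *m c j) 0 0.
Proof.
have det0 w : `|w| <= 1 -> \det (mev w M1) != 0.
  move=> w1; rewrite /mev det_map_mx det_M1 /= horner_evalE hornerM mulf_neq0 //.
    exact: qp0_stable.
  by have := dA w1; rewrite /mev det_map_mx.
exact: (bez_sub_ge0 m M1_M2 det0 c).
Qed.

Lemma L_factor : exists N (Q : 'M[{poly C}]_(N, n.+1)),
  [/\ msize Q m, forall i j, (mc i Q)^t* *m mc j Q = L i j &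
      forall v : 'rV[C]_N, (forall k, v *m mc k Q = 0) -> v = 0].
Proof.
have LJ i j : (L i j)^t* = L j i.
  by rewrite /L ctB (bezJ M1) (bezJ M2).
have [N [Q [sQ QE Q0]]] := block_gram LJ L_ge0.
exists N, Q; split=> // i j.
have [im|im] := ltnP i m; last first.
  by rewrite L_ge ?im // (mc_eq0 sQ im) trmx0 map_mx0 mul0mx.
have [jm|jm] := ltnP j m; last by rewrite L_ge ?jm ?orbT // (mc_eq0 sQ jm) mulmx0.
exact: QE.
Qed.

Section Rank.
Variables (N : nat) (Q : 'M[{poly C}]_(N, n.+1)).
Hypotheses (sQ : msize Q m) (QE : forall i j, (mc i Q)^t* *m mc j Q = L i j).
Hypothesis Q0 : forall v : 'rV[C]_N, (forall k, v *m mc k Q = 0) -> v = 0.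

Let XQ := 'X *: Q.

Lemma mc_XQ0 : mc 0 XQ = 0.
Proof. by apply/matrixP => i j; rewrite !mxE coefXM. Qed.

Lemma mc_XQS k : mc k.+1 XQ = mc k Q.
Proof. by apply/matrixP => i j; rewrite !mxE coefXM. Qed.

(** This is (1 - conj w W) Q^* Q = M1^* M1 - M2^* M2 with positive terms on both sides: the stacks
    of M1 over w Q and of M2 over Q have equal Gram kernels. *)
Lemma colligation_gram i j :
  (mc i M1)^t* *m mc j M1 + (mc i XQ)^t* *m mc j XQ =
  (mc i M2)^t* *m mc j M2 + (mc i Q)^t* *m mc j Q.
Proof.
rewrite QE /L; case: i j => [|i] [|j]; rewrite ?mc_XQ0 ?mulmx0 ?trmx0 ?map_mx0 ?mul0mx ?addr0.
- by rewrite !bez0l addrC subrK.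
- by rewrite !bez0l addrC subrK.
- by rewrite !bez0r addrC subrK.
rewrite !mc_XQS QE /L !bezS; set a := _ *m _; set b := _ *m _.
by rewrite [in RHS]opprD [in RHS]addrACA [RHS]addrA [b + _]addrC subrK.
Qed.

Let ev (p : 'I_#|{: 'I_m.+1 * 'I_n.+1}|) : 'I_m.+1 * 'I_n.+1 := enum_val p.
(** Listing the coefficients 0, ..., m side by side turns matrix polynomials into constant matrices,
    to which [isometry_of_gram] applies. *)
Let flat r (F : 'M[{poly C}]_(r, n.+1)) : 'M[C]_(r, #|{: 'I_m.+1 * 'I_n.+1}|) :=
  \matrix_(i, p) (F i (ev p).2)`_(ev p).1.

Lemma flat_entry r (F : 'M[{poly C}]_(r, n.+1)) i (k : 'I_m.+1) j :
  flat F i (enum_rank (k, j)) = mc k F i j.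
Proof. by rewrite [LHS]mxE /ev enum_rankK [RHS]mxE. Qed.

Lemma mul_flat r r' (v : 'M[C]_(r', r)) (F : 'M[{poly C}]_(r, n.+1)) i (k : 'I_m.+1) j :
  (v *m flat F) i (enum_rank (k, j)) = (v *m mc k F) i j.
Proof. by rewrite mxE [RHS]mxE; apply: eq_bigr => l _; rewrite flat_entry. Qed.

Lemma gram_flat r r' (F : 'M[{poly C}]_(r, n.+1)) (G : 'M[{poly C}]_(r', n.+1))
    (k k' : 'I_m.+1) j j' :
  ((flat F)^t* *m flat F + (flat G)^t* *m flat G) (enum_rank (k, j)) (enum_rank (k', j')) =
  ((mc k F)^t* *m mc k' F + (mc k G)^t* *m mc k' G) j j'.
Proof.
rewrite mxE [RHS]mxE; congr (_ + _); rewrite mxE [RHS]mxE;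
  by apply: eq_bigr => l _; rewrite !ct_entry !flat_entry.
Qed.

Lemma colligation_ex : exists V : 'M[C]_(n.+1 + N),
  [/\ V^t* *m V = 1%:M,
      M2 = cmx (ulsubmx V) *m M1 + cmx (ursubmx V) *m XQ &
      Q = cmx (dlsubmx V) *m M1 + cmx (drsubmx V) *m XQ].
Proof.
pose X := col_mx (flat M1) (flat XQ); pose Y := col_mx (flat M2) (flat Q).
have Xfree : row_free X.
  apply: inj_row_free => v; rewrite -[v]hsubmxK mul_row_col.
  move: (lsubmx v) (rsubmx v) => v1 v2 vX.
  have E k : (k <= m)%N -> v1 *m mc k M1 + v2 *m mc k XQ = 0.
    move=> km; apply/matrixP => i j; have kS : (k < m.+1)%N by [].
    have := congr1 (fun M : 'rV_#|{: 'I_m.+1 * 'I_n.+1}| => M i (enum_rank (Ordinal kS, j))) vX.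
    by rewrite mxE !mul_flat [RHS]mxE => h; rewrite mxE h mxE.
  have v10 : v1 = 0.
    have := E 0%N (leq0n m); rewrite mc_XQ0 mulmx0 addr0.
    have -> : mc 0 M1 = mev 0 M1.
      by apply/matrixP => i j; rewrite mev_entry horner_coef0 mxE.
    have u : mev 0 M1 \in unitmx.
      rewrite unitmxE unitfE /mev det_map_mx det_M1 /= horner_evalE hornerM mulf_neq0 //.
        by rewrite qp0_stable // normr0 ler01.
      by have := @dA 0; rewrite normr0 /mev det_map_mx => /(_ ler01).
    by move=> /(congr1 (fun M => M *m invmx (mev 0 M1))); rewrite mulmxK // mul0mx.
  have v20 : v2 = 0.
    apply: Q0 => k; have [km|mk] := ltnP k m; last by rewrite (mc_eq0 sQ mk) mulmx0.
    by have := E k.+1 km; rewrite v10 mul0mx add0r mc_XQS.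
  by rewrite v10 v20 row_mx0.
have XY : X^t* *m X = Y^t* *m Y.
  rewrite /X /Y !tr_col_mx !map_row_mx !mul_row_col.
  apply/matrixP => p p'; rewrite -(enum_valK p) -(enum_valK p').
  case: (enum_val p) (enum_val p') => k j [k' j'].
  by rewrite !gram_flat colligation_gram.
have [V [VX VV]] := isometry_of_gram Xfree XY.
have sXQ : msize XQ m.+1.
  move=> i j; rewrite mxE; apply: leq_trans (size_polyMleq _ _) _.
  by rewrite size_polyX /= addSn add0n ltnS.
have lift r (F : 'M[{poly C}]_(r, n.+1)) (U1 : 'M[C]_(r, n.+1)) (U2 : 'M[C]_(r, N)) :
    msize F m.+1 -> flat F = U1 *m flat M1 + U2 *m flat XQ ->
    F = cmx U1 *m M1 + cmx U2 *m XQ.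
  move=> sF E; apply/matrixP => i j; apply/polyP => k.
  have [km|mk] := ltnP k m.+1; last first.
    rewrite nth_default ?(leq_trans (sF i j)) // nth_default // (leq_trans _ mk) //.
    rewrite mxE; apply: leq_trans (size_polyD _ _) _.
    by rewrite geq_max !msize_cmxM //; exact: size_M1.
  have := congr1 (fun M : 'M_(r, #|{: 'I_m.+1 * 'I_n.+1}|) => M i (enum_rank (Ordinal km, j))) E.
  rewrite /= flat_entry [RHS]mxE !mul_flat /= -!mc_cmxM.
  by rewrite !mxE coefD => ->.
exists V; split=> //.
  apply: lift; first exact: size_M2.
  have := congr1 usubmx VX; rewrite -{1}[V]submxK /X /Y mul_block_col !col_mxKu //.
apply: lift; first exact: msize_ge sQ.
by have := congr1 dsubmx VX; rewrite -{1}[V]submxK /X /Y mul_block_col !col_mxKd.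
Qed.

(** Eliminating Q from the colligation shows that det M2 / det M1 is, up to a constant, det (w -
    VD^* ) / det (w VD - 1). The numerator has its zeros in the open disc, the denominator none
    there, so they are coprime. As det A cancels on the left, the numerator, of degree N, divides
    [qt n], of degree at most m. *)
Lemma rank_bound : (N <= m)%N.
Proof.
have [V [VV M2E QVE]] := colligation_ex.
set VA := ulsubmx V in M2E; set VB := ursubmx V in M2E.
set VC := dlsubmx V in QVE; set VD := drsubmx V in QVE.
have VE : V = block_mx VA VB VC VD by rewrite submxK.
have VVt : V *m V^t* = 1%:M by apply: mulmx1C.
have [EAC ECC] : VA *m VC^t* + VB *m VD^t* = 0 /\ VC *m VC^t* + VD *m VD^t* = 1%:M.
  move: VVt; rewrite {1 2}VE tr_block_mx map_block_mx mulmx_block scalar_mx_block.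
  by move/eq_block_mx => [].
pose D1 : 'M[{poly C}]_N := 'X *: cmx VD - 1%:M.
pose W := block_mx (cmx VA) ('X *: cmx VB) (cmx VC) D1.
have E1 : W *m block_mx M1 0 Q 1%:M = block_mx M2 ('X *: cmx VB) 0 D1.
  rewrite /W mulmx_block !mulmx0 !mulmx1 !add0r; congr block_mx.
    by rewrite M2E /XQ -scalemxAl -scalemxAr.
  rewrite /D1 mulmxBl mul1mx {2}QVE /XQ -scalemxAl -scalemxAr.
  by rewrite addrA subrr.
(* The unitarity relations [EAC] and [ECC] turn the right block column into w times the right half
   of V. *)
have E2 : W = cmx V *m block_mx 1%:M (- cmx (VC^t* )) 0 (char_poly_mx (VD^t* )).
  rewrite {1}VE /cmx map_block_mx mulmx_block !mulmx0 !mulmx1 !addr0 /W; congr block_mx.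
    rewrite /char_poly_mx mulmxBr mulmxN -!map_mxM mul_mx_scalar addrCA -opprD.
    by rewrite -map_mxD EAC map_mx0 subr0.
  rewrite /char_poly_mx mulmxBr mulmxN -!map_mxM mul_mx_scalar addrCA -opprD.
  by rewrite -map_mxD ECC map_mx1.
have detE : (\det V)%:P * char_poly (VD^t* ) * qp 0 = (-1) ^+ n * qt n * \det D1.
  have dA0 : \det A != 0.
    apply/negP => /eqP d0; have := @dA 0; rewrite normr0 /mev det_map_mx d0 => /(_ ler01).
    by rewrite /= horner_evalE horner0 eqxx.
  apply: (mulIf dA0); have := congr1 (fun M => \det M) E1.
  rewrite det_mulmx det_ublock det_lblock det1 mulr1 det_M2 det_M1 => E.
  have -> : (\det V)%:P * char_poly (VD^t* ) = \det W.
    by rewrite E2 det_mulmx det_ublock det1 mul1r /cmx det_map_mx.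
  rewrite -[LHS]mulrA E; ring.
have VDx (x : 'cV_N) : fsq (VB *m x) + fsq (VD *m x) = fsq x.
  have -> : fsq x = fsq (V *m col_mx 0 x).
    rewrite [RHS]fsq_tr ctM -mulmxA (mulmxA (V^t* )) VV mul1mx -fsq_tr.
    by rewrite /fsq big_split_ord /= [X in _ = X + _]big1 ?add0r => [|i _];
      [apply: eq_bigr => i _; apply: eq_bigr => j _; rewrite col_mxEd |
       apply: big1 => j _; rewrite col_mxEu mxE normr0 expr0n].
  rewrite VE mul_block_col !mulmx0 !add0r /fsq big_split_ord /=.
  by congr (_ + _); apply: eq_bigr => i _; apply: eq_bigr => j _;
    rewrite ?col_mxEu ?col_mxEd.
(* VD is a contraction. A unimodular eigenvalue u of VD^* would split off from V: its eigenvector v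
   satisfies v VC = 0 and v VD = conj u v, so (1 - conj u w) v Q = 0, contrary to [Q0]. *)
have chi_root u : root (char_poly (VD^t* )) u -> `|u| < 1.
  rewrite -eigenvalue_root_char => /eigenvalueP[v vD v0].
  pose x := v^t*.
  have xD : VD *m x = u^* *: x by rewrite /x -ctZ -vD ctM ctK.
  have x0 : 0 < fsq x.
    rewrite lt_neqAle fsq_ge0 andbT eq_sym; apply: contra v0 => /eqP/fsq_eq0 x0.
    by rewrite -[v]ctK -/x x0 trmx0 map_mx0.
  have := VDx x; rewrite xD fsqZ norm_conjC => Ex.
  have u1 : `|u| <= 1.
    rewrite -(@ler_pXn2r _ 2) ?nnegrE // expr1n -(ler_pM2r x0) mul1r -[leRHS]Ex.
    by rewrite lerDr fsq_ge0.
  rewrite lt_neqAle u1 andbT; apply/negP => /eqP u1'.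
  have Bx : VB *m x = 0.
    by apply: fsq_eq0; move: Ex; rewrite u1' expr1n mul1r => /(canRL (addrK _)); rewrite subrr.
  have uu : u * u^* = 1 by rewrite -normCK u1' expr1n.
  have Vx : V *m col_mx 0 x = u^* *: col_mx 0 x.
    by rewrite {1}VE mul_block_col !mulmx0 !add0r Bx xD scale_col_mx scaler0.
  have Vtx : V^t* *m col_mx 0 x = u *: col_mx 0 x.
    rewrite -[LHS]scale1r -uu -scalerA scalemxAr -Vx mulmxA VV mul1mx.
    by [].
  have [Cx Dx] : VC^t* *m x = 0 /\ VD^t* *m x = u *: x.
    move: Vtx; rewrite {1}VE tr_block_mx map_block_mx mul_block_col !mulmx0 !add0r.
    by rewrite scale_col_mx scaler0 => /eq_col_mx[].
  have vC : v *m VC = 0.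
    by apply: ct_inj; rewrite /= ctM -/x Cx trmx0 map_mx0.
  have vDu : v *m VD = u^* *: v.
    by apply: ct_inj; rewrite /= ctM -/x Dx ctZ conjCK.
  have vQ : (1 - u^* *: 'X) *: (cmx v *m Q) = 0.
    rewrite scalerBl scale1r {1}QVE mulmxDr !mulmxA -!map_mxM vC map_mx0 mul0mx add0r.
    rewrite vDu /XQ map_mxZ /= -!scalemxAr -scalemxAl scalerA -mul_polyC mulrC.
    by rewrite subrr.
  case/negP: v0; apply/eqP/Q0 => k; rewrite -mc_cmxM.
  apply/matrixP => i j; have /matrixP/(_ i j) := vQ.
  rewrite [LHS]mxE [RHS]mxE => /eqP; rewrite mulf_eq0 => /orP[/eqP h|/eqP h].
    have := congr1 (fun p : {poly C} => p.[0]) h; rewrite !hornerE subr0 => /eqP.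
    by rewrite oner_eq0.
  by rewrite [LHS]mxE h coef0 mxE.
have D1_root u : root (\det D1) u -> 1 <= `|u|.
  have -> : root (\det D1) u = (\det (u *: VD - 1%:M) == 0).
    rewrite rootE -horner_evalE -det_map_mx; congr (\det _ == 0).
    apply/matrixP => i j; rewrite !mxE /= horner_evalE !hornerE.
    by case: (i == j); rewrite ?hornerC ?horner0.
  rewrite -det_tr => /det0P[v v0 vD].
  pose x := v^T.
  have xD : u *: (VD *m x) = x.
    have := congr1 (fun M => M^T) vD; rewrite trmx_mul trmxK trmx0 mulmxBl mul1mx -/x.
    by rewrite -scalemxAl => /eqP; rewrite subr_eq0 => /eqP.
  have x0 : 0 < fsq x.
    rewrite lt_neqAle fsq_ge0 andbT eq_sym; apply: contra v0 => /eqP/fsq_eq0 x0.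
    by rewrite -[v]trmxK -/x x0 trmx0.
  have le : fsq (VD *m x) <= fsq x by rewrite -(VDx x) lerDr fsq_ge0.
  have u2 : 1 <= `|u| ^+ 2.
    rewrite -(ler_pM2r x0) mul1r -{1}xD fsqZ.
    by rewrite ler_wpM2l // exprn_ge0.
  by rewrite -(@ler_pXn2r _ 2) ?nnegrE // expr1n.
have cop : coprimep (char_poly (VD^t* )) (\det D1).
  apply/Pdiv.ClosedField.coprimepP => u /chi_root u1; apply/negP => /D1_root u2.
  by have := lt_le_trans u1 u2; rewrite ltxx.
have qt0 : qt n != 0.
  apply/negP => /eqP/(congr1 (fun p : {poly C} => p`_m)); rewrite coef0 coef_poly ltnSn !subnn.
  move/eqP; rewrite conjC_eq0; apply/negP.
  have := @qp0_stable 0; rewrite normr0 => /(_ ler01).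
  by rewrite horner_coef0 coef_poly.
have dv : char_poly (VD^t* ) %| (-1) ^+ n * qt n.
  by rewrite -(Gauss_dvdpl _ cop) -detE -mulrA mulrCA dvdp_mulr.
have := dvdp_leq (mulf_neq0 (negbT (signr_eq0 _ n)) qt0) dv.
rewrite size_char_poly -signr_odd mulr_sign.
have sq : (size (qt n) <= m.+1)%N by exact: size_poly.
by case: (odd n); rewrite ?size_polyN => /leq_trans/(_ sq).
Qed.

Lemma colligation_sos : exists (P : 'I_n -> nat -> nat -> C) (Q' : 'I_m -> nat -> nat -> C),
  [/\ forall i j k, (n <= j)%N || (m < k)%N -> P i j k = 0,
      forall i j k, (n < j)%N || (m <= k)%N -> Q' i j k = 0 &
      forall j j' k k', (j <= n)%N -> (j' <= n)%N -> (k <= m)%N -> (k' <= m)%N ->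
      (q j k)^* * q j' k' - q (n - j)%N (m - k)%N * (q (n - j')%N (m - k')%N)^* =
      diffz (gramf P) j k j' k' + diffw (gramf Q') j k j' k'].
Proof.
pose P (i : 'I_n) j k : C := if insub j is Some j' then (A i j')`_k else 0.
(* Q has N <= m rows; zero rows fill it up to m. *)
pose Qn (i : nat) j k : C := if insub i is Some r then
  (if insub j is Some a then (Q r a)`_k else 0) else 0.
pose Q' (i : 'I_m) := Qn i.
exists P, Q'; split.
- move=> i j k; rewrite /P; case: insubP => // j' _ <-; rewrite leqNgt ltn_ord /= => mk.
  by rewrite nth_default // (leq_trans (sA i j')).
- move=> i j k; rewrite /Q' /Qn; case: insubP => // r _ _; case: insubP => // a _ <-.
  rewrite ltnNge leq_ord /= => mk.
  by rewrite nth_default // (leq_trans (sQ r a)).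
move=> j0 j0' k k' jn jn' km km'.
have [j jE] : exists j : 'I_n.+1, j0 = j by exists (Ordinal (jn : (j0 < n.+1)%N)).
have [j' jE'] : exists j : 'I_n.+1, j0' = j by exists (Ordinal (jn' : (j0' < n.+1)%N)).
have ge r (F : 'M[{poly C}]_(r, n.+1)) l l' :
    ((mc l F)^t* *m mc l' F) j j' = \sum_i ((F i j)`_l)^* * (F i j')`_l'.
  by rewrite mxE; apply: eq_bigr => i _; rewrite !mxE.
have GQ l l' : gramf Q' j l j' l' = \sum_i ((Q i j)`_l)^* * (Q i j')`_l'.
  rewrite /gramf -(@sum_ord_widen _ (fun i => (Qn i j l)^* * Qn i j' l') _ _ rank_bound).
    by apply: eq_bigr => i _; rewrite /Qn !valK.
  by move=> i Ni; rewrite /Qn insubF ?conjC0 ?mul0r // ltnNge Ni.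
have E1 (l : 'I_n) (b : 'I_n.+1) : M1 (lift ord0 l) b =
    if unlift ord0 b is Some b' then A l b' else 0 by rewrite mxE liftK.
have E2 (l : 'I_n) (b : 'I_n.+1) : M2 (lift ord0 l) b =
    if unlift ord_max b is Some b' then A l b' else 0 by rewrite mxE liftK.
have E3 (b : 'I_n.+1) : M1 ord0 b = qp b by rewrite mxE unlift_none.
have E4 (b : 'I_n.+1) : M2 ord0 b = qt b by rewrite mxE unlift_none.
have := congr1 (fun M : 'M_n.+1 => M j j') (colligation_gram k k').
rewrite mxE [RHS]mxE !ge !big_ord_recl !E3 !E4 jE jE'.
rewrite !coef_poly !ltnS km km' conjCK.
have -> : \sum_(i < n) ((M1 (lift ord0 i) j)`_k)^* * (M1 (lift ord0 i) j')`_k' =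
    if (j : nat, j' : nat) is (j1.+1, j1'.+1) then gramf P j1 k j1' k' else 0.
  case: (unliftP ord0 j) => [j1|] ->; last first.
    by apply: big1 => l _; rewrite E1 unlift_none coef0 conjC0 mul0r.
  case: (unliftP ord0 j') => [j1'|] ->; last first.
    by apply: big1 => l _; rewrite (E1 _ ord0) unlift_none coef0 mulr0.
  by rewrite !lift0; apply: eq_bigr => l _; rewrite !E1 !liftK /P !valK.
have -> : \sum_(i < n) ((M2 (lift ord0 i) j)`_k)^* * (M2 (lift ord0 i) j')`_k' =
    gramf P j k j' k'.
  apply: eq_bigr => l _; rewrite !E2 /P; congr (_^* * _).
    case: (unliftP ord_max j) => [j1|] ->; first by rewrite lift_max valK.
    by rewrite insubF ?ltnn // coef0.
  case: (unliftP ord_max j') => [j1|] ->; first by rewrite lift_max valK.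
  by rewrite insubF ?ltnn // coef0.
have -> : \sum_i ((XQ i j)`_k)^* * (XQ i j')`_k' =
    if (k, k') is (k1.+1, k1'.+1) then gramf Q' j k1 j' k1' else 0.
  case: k km => [|k] km /=.
    by apply: big1 => i _; rewrite [XQ i j]mxE coefXM conjC0 mul0r.
  case: k' km' => [|k'] km' /=.
    by apply: big1 => i _; rewrite [XQ i j']mxE coefXM mulr0.
  by rewrite GQ; apply: eq_bigr => i _; rewrite [XQ i j]mxE [XQ i j']mxE !coefXM.
rewrite -GQ /diffz /diffw => E.
set z1 := (X in _ - X + _); set w1 := (X in _ + (_ - X)).
have {E} : (q j k)^* * q j' k' + z1 + w1 = (q (n - j) (m - k)) * (q (n - j') (m - k'))^* +
   gramf P j k j' k' + gramf Q' j k j' k' by [].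
move=> E; apply/eqP; rewrite -subr_eq0; apply/eqP.
by have := congr1 (fun x => x - (q (n - j) (m - k) * (q (n - j') (m - k'))^* + gramf P j k j' k' + gramf Q' j k j' k')) E; rewrite subrr => <-; ring.
Qed.

End Rank.
End Decompose.
Theorem stable_sos : exists (P : 'I_n -> nat -> nat -> C) (Q : 'I_m -> nat -> nat -> C),
  [/\ forall i j k, (n <= j)%N || (m < k)%N -> P i j k = 0,
      forall i j k, (n < j)%N || (m <= k)%N -> Q i j k = 0 &
      forall j j' k k', (j <= n)%N -> (j' <= n)%N -> (k <= m)%N -> (k' <= m)%N ->
      (q j k)^* * q j' k' - q (n - j)%N (m - k)%N * (q (n - j')%N (m - k')%N)^* =
      diffz (gramf P) j k j' k' + diffw (gramf Q) j k j' k'].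
Proof.
have [A [fA sA HA]] := fejer_riesz B_poly size_Bp B_psd.
have dA := HA (fun w x w1 => @B_nondeg w x w1).
have [N [Q [sQ QE Q0]]] := L_factor fA sA dA.
have H := colligation_sos sA dA sQ QE Q0; exact: H.
Qed.

End Stable.

(** * Passage to the limit of the dilates *)

Section Limit.
Variable R : realType.
Local Notation C := R[i].

Lemma ulim_einv_shift K : ulim (fun k => einv R (k + K)) 0.
Proof.
move=> e e0; apply: (filterS _ (@ulim_einv R e e0)) => k /=.
rewrite !subr0; apply: le_lt_trans.
rewrite /einv !ger0_norm ?invr_ge0 ?ler0n // lef_pV2 ?posrE ?ltr0n //.
by rewrite ler_nat ltnS leq_addr.
Qed.

Lemma cbounded_horner (p : {poly C}) (u : nat -> C) : (forall k, `|u k| <= 1) ->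
  cbounded (fun k => p.[u k]).
Proof.
move=> u1; exists (\sum_(i < size p) `|p`_i|) => k; rewrite horner_coef.
apply: le_trans (ler_norm_sum _ _ _) _; apply: ler_sum => i _.
by rewrite normrM normrX ler_piMr // exprn_ile1.
Qed.

Lemma cboundedZ (c : C) (u : nat -> C) : cbounded u -> cbounded (fun k => c * u k).
Proof. by move=> [M uM]; exists (`|c| * M) => k; rewrite normrM ler_wpM2l. Qed.

Lemma cbounded_sum (I : Type) (r : seq I) (u : I -> nat -> C) :
  (forall i, cbounded (u i)) -> cbounded (fun k => \sum_(i <- r) u i k).
Proof.
move=> H; elim: r => [|i r [M IH]]; first by exists 0 => k; rewrite big_nil normr0.
have [M' uM] := H i; exists (M' + M) => k; rewrite big_cons.
by apply: le_trans (ler_normD _ _) _; rewrite lerD.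
Qed.

Lemma gramf_ge0 d (F : 'I_d -> nat -> nat -> C) j k : 0 <= gramf F j k j k.
Proof. by apply: sumr_ge0 => i _; rewrite -normCKC exprn_ge0. Qed.

Lemma gramf_entry d (F : 'I_d -> nat -> nat -> C) i j k :
  `|F i j k| ^+ 2 <= gramf F j k j k.
Proof.
rewrite /gramf (bigD1 i) //= -normCKC lerDl.
by apply: sumr_ge0 => l _; rewrite -normCKC exprn_ge0.
Qed.

Lemma sum_diffz (S : nat -> nat -> nat -> nat -> C) j k :
  \sum_(l < j.+1) diffz S l k l k = S j k j k.
Proof.
elim: j => [|j IH]; first by rewrite big_ord1 /diffz subr0.
by rewrite big_ord_recr /= IH /diffz addrC subrK.
Qed.

Lemma sum_diffw (S : nat -> nat -> nat -> nat -> C) j k :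
  \sum_(l < k.+1) diffw S j l j l = S j k j k.
Proof.
elim: k => [|k IH]; first by rewrite big_ord1 /diffw subr0.
by rewrite big_ord_recr /= IH /diffw addrC subrK.
Qed.

Lemma sum_diff (S T : nat -> nat -> nat -> nat -> C) j k :
  \sum_(l < j.+1) \sum_(h < k.+1) (diffz S l h l h + diffw T l h l h) =
  \sum_(h < k.+1) S j h j h + \sum_(l < j.+1) T l k l k.
Proof.
under eq_bigr => l _ do rewrite big_split sum_diffw.
rewrite big_split exchange_big /=; congr (_ + _).
by apply: eq_bigr => h _; rewrite sum_diffz.
Qed.

(** The diagonal differences telescope to sums of squares that include |P_jk|^2 and |Q_jk|^2. This
    bounds the coefficients of P and Q by the left-hand side of the identity, as the limit
    requires. *)
Lemma sum_diff_bound d e (P : 'I_d -> nat -> nat -> C) (Q : 'I_e -> nat -> nat -> C) j k :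
  let s := \sum_(l < j.+1) \sum_(h < k.+1)
    (diffz (gramf P) l h l h + diffw (gramf Q) l h l h) in
  (forall i, `|P i j k| ^+ 2 <= s) /\ (forall i, `|Q i j k| ^+ 2 <= s).
Proof.
rewrite /= sum_diff; split=> i; apply: le_trans (gramf_entry _ _ _ _) _.
  rewrite big_ord_recr /= -addrA addrCA lerDl.
  by rewrite addr_ge0 ?sumr_ge0 // => h _; apply: gramf_ge0.
rewrite [X in _ + X]big_ord_recr /= addrA lerDr.
by rewrite addr_ge0 ?sumr_ge0 // => h _; apply: gramf_ge0.
Qed.

Lemma gramfZ d (F : 'I_d -> nat -> nat -> C) (c : C) j k j' k' :
  gramf (fun i j k => c * F i j k) j k j' k' = `|c| ^+ 2 * gramf F j k j' k'.
Proof.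
rewrite /gramf mulr_sumr; apply: eq_bigr => i _.
by rewrite rmorphM normCKC /= mulrACA.
Qed.

Lemma diffzZ d (F : 'I_d -> nat -> nat -> C) (c : C) j k j' k' :
  diffz (gramf (fun i j k => c * F i j k)) j k j' k' = `|c| ^+ 2 * diffz (gramf F) j k j' k'.
Proof.
rewrite /diffz mulrBr gramfZ; congr (_ - _).
by case: j j' => [|j] [|j']; rewrite ?mulr0 // gramfZ.
Qed.

Lemma diffwZ d (F : 'I_d -> nat -> nat -> C) (c : C) j k j' k' :
  diffw (gramf (fun i j k => c * F i j k)) j k j' k' = `|c| ^+ 2 * diffw (gramf F) j k j' k'.
Proof.
rewrite /diffw mulrBr gramfZ; congr (_ - _).
by case: k k' => [|k] [|k']; rewrite ?mulr0 // gramfZ.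
Qed.

Section UlimDiff.
Variables (d : nat) (P : nat -> 'I_d -> nat -> nat -> C) (P' : 'I_d -> nat -> nat -> C).
Hypothesis PP : forall i j k, ulim (fun t => P t i j k) (P' i j k).

Lemma ulim_gramf j k j' k' : ulim (fun t => gramf (P t) j k j' k') (gramf P' j k j' k').
Proof. by apply: ulim_sum => i _; apply: ulimM (ulim_conj (PP _ _ _)) (PP _ _ _). Qed.

Lemma ulim_diffz j k j' k' :
  ulim (fun t => diffz (gramf (P t)) j k j' k') (diffz (gramf P') j k j' k').
Proof.
apply: ulimB (ulim_gramf _ _ _ _) _.
by case: j j' => [|j] [|j']; [apply: ulimC|apply: ulimC|apply: ulimC|apply: ulim_gramf].
Qed.

Lemma ulim_diffw j k j' k' :
  ulim (fun t => diffw (gramf (P t)) j k j' k') (diffw (gramf P') j k j' k').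
Proof.
apply: ulimB (ulim_gramf _ _ _ _) _.
by case: k k' => [|k] [|k']; [apply: ulimC|apply: ulimC|apply: ulimC|apply: ulim_gramf].
Qed.
End UlimDiff.

Variables (n m : nat) (q : nat -> nat -> C) (a b : C).
Hypotheses (a_real : a \is Num.real) (b_real : b \is Num.real).

Definition scaled (e : C) j k : C := q j k * (1 - a * e) ^+ j * (1 - b * e) ^+ k.

Variable c : C.
Hypothesis c1 : `|c| = 1.
Hypothesis q_sym : forall j k, (j <= n)%N -> (k <= m)%N ->
  (q (n - j) (m - k))^* = c * q j k.

Variable K : nat.
Hypothesis q_stable : forall t z w, (K <= t)%N -> `|z| <= 1 -> `|w| <= 1 ->
  \sum_(j < n.+1) \sum_(k < m.+1) scaled (einv R t) j k * z ^+ j * w ^+ k != 0.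

(** As a polynomial in the dilation parameter the difference vanishes at 0, so the division by that
    parameter is exact and the limit of [G] is its value at 0. *)
Let D (s t s' t' : nat) : {poly C} :=
  (1 - a *: 'X) ^+ s * (1 - b *: 'X) ^+ t - (1 - a *: 'X) ^+ s' * (1 - b *: 'X) ^+ t'.
Let G s t s' t' : {poly C} := drop_poly 1 (D s t s' t').

Lemma D_G s t s' t' x : (D s t s' t').[x] = x * (G s t s' t').[x].
Proof.
rewrite -{1}(poly_take_drop 1 (D s t s' t')) hornerD hornerM hornerXn expr1 -/(G _ _ _ _).
suff -> : take_poly 1 (D s t s' t') = 0 by rewrite horner0 add0r mulrC.
apply/polyP => -[|i]; rewrite coef_take_poly coef0 //=.
rewrite -horner_coef0 /D !hornerE.
by rewrite ?mulr0 !subr0 !expr1n !mul1r subrr.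
Qed.

Lemma G_0 s t s' t' : (G s t s' t').[0] = a * (s'%:R - s%:R) + b * (t'%:R - t%:R).
Proof.
have -> : (G s t s' t').[0] = (D s t s' t')^`().[0].
  by rewrite !horner_coef0 coef_deriv coef_drop_poly mulr1n.
rewrite /D derivB !derivM !deriv_exp !derivB !derivZ !derivX -polyC1 !derivC.
rewrite !sub0r !hornerE !hornerMn !hornerE.
rewrite !subr0 !expr1n !mul1r !mulr1 -[_ *+ s]mulr_natr -[_ *+ t]mulr_natr.
rewrite -[_ *+ s']mulr_natr -[_ *+ t']mulr_natr; ring.
Qed.

Theorem limit_sos : exists (P : 'I_n -> nat -> nat -> C) (Q : 'I_m -> nat -> nat -> C),
  [/\ forall i j k, (n <= j)%N || (m < k)%N -> P i j k = 0,
      forall i j k, (n < j)%N || (m <= k)%N -> Q i j k = 0 &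
      forall j j' k k', (j <= n)%N -> (j' <= n)%N -> (k <= m)%N -> (k' <= m)%N ->
      (q j k)^* * q j' k' * (a * (n%:R - (j + j')%:R) + b * (m%:R - (k + k')%:R)) =
      diffz (gramf P) j k j' k' + diffw (gramf Q) j k j' k'].
Proof.
have cc : c^* * c = 1 by rewrite -normCKC c1 expr1n.
pose e t := einv R (t + K).
have e0 t : 0 < e t by rewrite invr_gt0 ltr0n.
have e1 t : `|e t| <= 1.
  by rewrite gtr0_norm // invf_le1 ?ltr0n // ler1n.
pose s j j' := (j + j')%N.
pose F t j k j' k' := (q j k)^* * q j' k' *
  ((G (j + j') (k + k') (n + n - (j + j')) (m + m - (k + k'))).[e t] / 2).
have /choice[P HP] : forall t, exists PQ : ('I_n -> nat -> nat -> C) * ('I_m -> nat -> nat -> C),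
  [/\ forall i j k, (n <= j)%N || (m < k)%N -> PQ.1 i j k = 0,
      forall i j k, (n < j)%N || (m <= k)%N -> PQ.2 i j k = 0 &
      forall j j' k k', (j <= n)%N -> (j' <= n)%N -> (k <= m)%N -> (k' <= m)%N ->
      F t j k j' k' = diffz (gramf PQ.1) j k j' k' + diffw (gramf PQ.2) j k j' k'].
  move=> t; have [|P [Q [P0 Q0 PQ]]] := @stable_sos R n m (scaled (e t)).
    by move=> z w z1 w1; apply: q_stable => //; apply: leq_addl.
  (* Scaling P and Q by u absorbs the division by 2 t into the squares. *)
  pose u : C := (sqrtC (2 * e t))^-1.
  have u2 : `|u| ^+ 2 = (2 * e t)^-1.
    by rewrite normfV exprVn -normrX sqrtCK ger0_norm // mulr_ge0 ?ler0n // ltW.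
  exists (fun i j k => u * P i j k, fun i j k => u * Q i j k); split => /=.
  - by move=> i j k h; rewrite P0 ?mulr0.
  - by move=> i j k h; rewrite Q0 ?mulr0.
  move=> j j' k k' jn jn' km km'; rewrite diffzZ diffwZ -mulrDr -PQ // u2.
  have er : e t \is Num.real by apply: ger0_real; apply: ltW.
  have Er x : x \is Num.real -> (1 - x * e t)^* = 1 - x * e t.
    by move=> xr; rewrite conj_Creal // rpredB ?rpred1 ?rpredM.
  rewrite /scaled !rmorphM !rmorphXn /= !Er //.
  have Esym j1 k1 : (j1 <= n)%N -> (k1 <= m)%N -> q (n - j1)%N (m - k1)%N = c^* * (q j1 k1)^*.
    by move=> h1 h2; rewrite -rmorphM -q_sym //= conjCK.
  rewrite !Esym // !rmorphM /= !conjCK.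
  set x := 1 - a * e t; set y := 1 - b * e t.
  have DG := D_G (j + j') (k + k') (n + n - (j + j')) (m + m - (k + k')) (e t).
  have Dx : (D (j + j') (k + k') (n + n - (j + j')) (m + m - (k + k'))).[e t] =
      x ^+ (j + j') * y ^+ (k + k') - x ^+ (n - j + (n - j')) * y ^+ (m - k + (m - k')).
    rewrite /D !hornerE /x /y.
    by congr (_ - _ ^+ _ * _ ^+ _); lia.
  have et0 : e t != 0 by rewrite gt_eqF.
  rewrite /F; apply: (mulfI (_ : 2 * e t != 0)); first by rewrite mulf_neq0 // pnatr_eq0.
  rewrite [RHS]mulrA mulfV ?mul1r; last by rewrite mulf_neq0 // pnatr_eq0.
  transitivity ((q j k)^* * q j' k' * (e t * (G (j + j') (k + k') (n + n - (j + j')) (m + m - (k + k'))).[e t])).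
    by field.
  rewrite -DG Dx !exprD.
  transitivity ((q j k)^* * q j' k' * (x ^+ j * x ^+ j' * (y ^+ k * y ^+ k')) -
    (c^* * c) * ((q j k)^* * q j' k' * (x ^+ (n - j) * x ^+ (n - j') * (y ^+ (m - k) * y ^+ (m - k'))))).
    by rewrite cc mul1r mulrBr.
  ring.
have Fb j k : cbounded (fun t => \sum_(l < j.+1) \sum_(h < k.+1) F t l h l h).
  apply: cbounded_sum => l; apply: cbounded_sum => h; apply: cboundedZ.
  have [M HM] := cboundedZ 2^-1 (cbounded_horner
    (G (l + l) (h + h) (n + n - (l + l)) (m + m - (h + h))) e1).
  by exists M => t; rewrite mulrC.
have Fl j k j' k' : ulim (fun t => F t j k j' k')
    ((q j k)^* * q j' k' * ((G (j + j') (k + k') (n + n - (j + j')) (m + m - (k + k'))).[0] / 2)).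
  apply: ulimM (ulimC _) (ulimM _ (ulimC _)); apply: ulim_horner.
  exact: ulim_einv_shift.
have sumE t j k : (j <= n)%N -> (k <= m)%N ->
    \sum_(l < j.+1) \sum_(h < k.+1) F t l h l h = \sum_(l < j.+1) \sum_(h < k.+1)
    (diffz (gramf (P t).1) l h l h + diffw (gramf (P t).2) l h l h).
  move=> jn km; have [_ _ E] := HP t; apply: eq_bigr => l _; apply: eq_bigr => h _.
  by apply: E; apply: leq_trans (leq_ord _) _.
(* [F] stays bounded because its values are polynomials in a parameter from the unit disc. *)
have bound (u : nat -> C) j k : (forall t, `|u t| ^+ 2 <= \sum_(l < j.+1) \sum_(h < k.+1)
    F t l h l h) -> cbounded u.
  have [M HM] := Fb j k; move=> H; exists (1 + M) => t; apply: le_of_sq => //.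
  apply: le_trans (H t) _; apply: le_trans (HM t); apply: real_ler_norm.
  by apply: ger0_real; apply: le_trans (H t); rewrite exprn_ge0.
have /choice[P' HP'] : forall p : 'I_n * nat * nat,
    exists l, ulim (fun t => (P t).1 p.1.1 p.1.2 p.2) l.
  move=> [[i j] k] /=; case: (boolP ((n <= j)%N || (m < k)%N)) => [h|].
    exists 0; apply: (ulim_near (N := 0)) (ulimC 0) => t _.
    by have [P0 _ _] := HP t; rewrite P0.
  rewrite negb_or -ltnNge -leqNgt => /andP[/ltnW jn km].
  apply: ulim_ex; apply: (bound _ j k) => t; rewrite sumE //.
  by have [] := sum_diff_bound (P t).1 (P t).2 j k.
have /choice[Q' HQ'] : forall p : 'I_m * nat * nat,
    exists l, ulim (fun t => (P t).2 p.1.1 p.1.2 p.2) l.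
  move=> [[i j] k] /=; case: (boolP ((n < j)%N || (m <= k)%N)) => [h|].
    exists 0; apply: (ulim_near (N := 0)) (ulimC 0) => t _.
    by have [_ Q0 _] := HP t; rewrite Q0.
  rewrite negb_or -leqNgt -ltnNge => /andP[jn /ltnW km].
  apply: ulim_ex; apply: (bound _ j k) => t; rewrite sumE //.
  by have [] := sum_diff_bound (P t).1 (P t).2 j k.
exists (fun i j k => P' (i, j, k)), (fun i j k => Q' (i, j, k)); split.
- move=> i j k h; apply: ulim_uniq (HP' (i, j, k)) _.
  apply: (ulim_near (N := 0)) (ulimC 0) => t _.
  by have [P0 _ _] := HP t; rewrite P0.
- move=> i j k h; apply: ulim_uniq (HQ' (i, j, k)) _.
  apply: (ulim_near (N := 0)) (ulimC 0) => t _.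
  by have [_ Q0 _] := HP t; rewrite Q0.
move=> j j' k k' jn jn' km km'; have LR := ulimD
  (ulim_diffz (P := fun t => (P t).1) (fun i j k => HP' (i, j, k)) j k j' k')
  (ulim_diffw (P := fun t => (P t).2) (fun i j k => HQ' (i, j, k)) j k j' k').
apply: ulim_uniq LR.
have -> : a * (n%:R - (j + j')%:R) + b * (m%:R - (k + k')%:R) =
    (G (j + j') (k + k') (n + n - (j + j')) (m + m - (k + k'))).[0] / 2.
  by rewrite G_0 !natrB ?leq_add // !natrD; field.
apply: (ulim_near (N := 0)) (Fl j k j' k') => t _.
by have [_ _ E] := HP t; apply: E.
Qed.
End Limit.

(** * Zero sets of bivariate polynomials *)

Section BivariateFacts.
Variable R : realType.
Local Notation C := R[i].
Implicit Types p : {poly {poly C}}.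

Lemma horner2_map p x y : p.[x, y] = (map_poly (horner_eval y) p).[x].
Proof.
have := horner_map (horner_eval y) p x%:P; rewrite /= /horner_eval hornerC => <-.
by [].
Qed.

Lemma coef_root_bound (s : seq C) k : (forall r, r \in s -> `|r| <= 1) ->
  `|(\prod_(r <- s) ('X - r%:P))`_k| <= 2 ^+ size s.
Proof.
elim: s k => [|r s IH] k H.
  by rewrite big_nil coef1; case: eqP => _; rewrite ?normr1 ?normr0 ?ler01 // expr0.
have Hs t : t \in s -> `|t| <= 1 by move=> ts; apply: H; rewrite inE ts orbT.
rewrite big_cons mulrBl coefB coefXM coefCM /= exprS mulr_natl mulr2n.
apply: le_trans (ler_normB _ _) _; apply: lerD.
  by case: ifP => _; [rewrite normr0 exprn_ge0 // ler0n | apply: IH].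
rewrite normrM; apply: le_trans (IH k Hs).
by rewrite ler_piMl // H // mem_head.
Qed.

Lemma finitely_many_hits (u : nat -> C) (s : seq C) : injective u ->
  exists N, forall t, (N <= t)%N -> u t \notin s.
Proof.
move=> ui; elim: s => [|r s [N HN]]; first by exists 0%N.
case: (pselect (exists t, u t = r)) => [[t0 ut0]|h].
  exists (maxn N t0.+1) => t; rewrite geq_max => /andP[Nt t0t].
  rewrite inE negb_or HN // andbT -ut0; apply/negP => /eqP/ui tt.
  by rewrite tt ltnn in t0t.
exists N => t Nt; rewrite inE negb_or HN // andbT; apply/negP => /eqP ur.
by apply: h; exists t.
Qed.

(* If the leading coefficient vanished at [y0], all coefficients, being dominated
   by it on the disc, would vanish there too. *)
Lemma lead_coef_disc p : p != 0 ->
  (forall x y, `|y| <= 1 -> p.[x, y] = 0 -> `|x| <= 1) ->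
  (forall y, `|y| <= 1 -> p.[2, y] != 0) ->
  forall y, `|y| <= 1 -> (lead_coef p).[y] != 0.
Proof.
move=> p0 Hroots H2 y0 y01; apply/negP => /eqP fy0; set f := lead_coef p.
have f0 : f != 0 by rewrite lead_coef_eq0.
pose M : C := 2 ^+ (size p).-1.
have bound y k : `|y| <= 1 -> f.[y] != 0 -> `|(p`_k).[y]| <= M * `|f.[y]|.
  move=> y1 fy; have [r Er] := closed_field_poly_normal (map_poly (horner_eval y) p).
  have lE : lead_coef (map_poly (horner_eval y) p) = f.[y] by rewrite lead_coef_map_eq.
  have sE : size (map_poly (horner_eval y) p) = size p by rewrite size_map_poly_id0.
  rewrite -[_.[y]]/(horner_eval y p`_k) -coef_map Er lE coefZ normrM mulrC.
  apply: ler_wpM2r => //; rewrite /M -sE Er lE size_scale // size_prod_XsubC /=.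
  apply: coef_root_bound => x xr; apply: (Hroots _ y) => //; rewrite horner2_map.
  by apply/eqP; rewrite -[_ == 0]/(root _ _) Er lE rootZ // root_prod_XsubC.
(* A point of the disc other than y0. The points [u t] run along the segment from it to y0; being
   distinct, they eventually avoid the finitely many zeros of f. *)
pose c0 : C := (y0 == 0)%:R.
pose u t := y0 + einv R t * (c0 - y0).
have c0y : c0 - y0 != 0.
  by rewrite /c0; have [->|n0] := eqVneq y0 0; rewrite ?subr0 ?oner_eq0 // sub0r oppr_eq0.
have c01 : `|c0| <= 1 by rewrite /c0; case: eqP; rewrite ?normr1 ?normr0 ?ler01.
have e0 t : 0 < einv R t by rewrite invr_gt0 ltr0n.
have e1 t : einv R t <= 1 by rewrite invf_le1 ?ltr0n // ler1n.
have u1 t : `|u t| <= 1.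
  have -> : u t = (1 - einv R t) * y0 + einv R t * c0 by rewrite /u; ring.
  apply: le_trans (ler_normD _ _) _; rewrite !normrM.
  rewrite (ger0_norm (ltW (e0 t))) ger0_norm ?subr_ge0 //.
  rewrite -[leRHS](subrK (einv R t)) lerD //.
    by rewrite ler_piMr // subr_ge0.
  by rewrite ler_piMr // ltW.
have ui : injective u.
  move=> s t /addrI/(mulIf c0y)/invr_inj/eqP; rewrite eqr_nat eqSS => /eqP //.
have [r Er] := closed_field_poly_normal f.
have [N HN] := finitely_many_hits r ui.
have ul : ulim u y0.
  have := ulimD (ulimC y0) (ulimM (@ulim_einv R) (ulimC (c0 - y0))).
  by rewrite mul0r addr0.
have pk0 k : (p`_k).[y0] = 0.
  apply/eqP; rewrite -normr_eq0 -sqrf_eq0 eq_le exprn_ge0 // andbT.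
  have L1 := ulim_horner p`_k ul; have L2 := ulim_horner f ul.
  rewrite normCK; have -> : 0 = M ^+ 2 * (f.[y0] * f.[y0]^*) by rewrite fy0 mul0r mulr0.
  apply: (ulim_le (N := N)) (ulimM L1 (ulim_conj L1)) (ulimM (ulimC _) (ulimM L2 (ulim_conj L2))).
  move=> t /HN ut; have fu : f.[u t] != 0.
    rewrite Er hornerZ mulf_neq0 ?lead_coef_eq0 //.
    by rewrite -[_ == 0]/(root _ _) root_prod_XsubC.
  rewrite -!normCK -exprMn ler_pXn2r ?nnegrE //; first exact: bound.
  by rewrite mulr_ge0 // exprn_ge0 // ler0n.
have := H2 y0 y01; rewrite horner2_map.
suff -> : map_poly (horner_eval y0) p = 0 by rewrite horner0 eqxx.
by apply/polyP => k; rewrite coef_map coef0 /= /horner_eval pk0.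
Qed.

(** As p vanishes on no line w = const, every root of h is a root of g, and the corresponding linear
    factor can be cancelled from both. *)
Lemma primitive_quotient (h g : {poly C}) (Y : {poly {poly C}}) p :
  h != 0 -> (forall w, exists z, p.[z, w] != 0) -> h *: Y = g *: p ->
  exists g', Y = g' *: p.
Proof.
move=> h0 pw; have [d] := ubnP (size h); elim: d h g h0 => // d IH h g h0 hd E.
have [h1|h1] := eqVneq (size h) 1%N.
  have /size_poly1P[c c0 hE] : size h == 1%N by rewrite h1.
  exists (c^-1%:P * g); rewrite -scalerA -E hE scalerA -polyCM mulVf //.
  by rewrite polyC1 scale1r.
have [w /eqP hw] := closed_rootP _ h1.
have [z pz] := pw w.
have gw : root g w.
  have := congr1 (fun q => q.[z, w]) E; rewrite !hornerZ !hornerM hw mul0r.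
  by move/esym/eqP; rewrite mulf_eq0 (negbTE pz) orbF.
have {}hw : root h w by rewrite /root hw.
have [h' hE] := factor_theorem _ _ hw; have [g' gE] := factor_theorem _ _ gw.
have X0 : 'X - w%:P != 0 :> {poly C} by rewrite polyXsubC_eq0.
have h'0 : h' != 0 by apply: contra h0; rewrite hE => /eqP ->; rewrite mul0r.
apply: (IH h' g') => //.
  by move: hd; rewrite hE size_Mmonic ?monicXsubC // size_XsubC addn2.
move: E; rewrite hE gE mulrC [g' * _]mulrC -!scalerA => {}E.
apply/polyP => k; have := congr1 (fun q : {poly {poly C}} => q`_k) E.
by rewrite !coefZ => /(mulfI X0).
Qed.

End BivariateFacts.

(** * Symmetry and dilates of polynomials defining distinguished varieties *)

Section Distinguished.
Variable R : realType.
Local Notation C := R[i].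
Implicit Types p : {poly {poly C}}.

Lemma dist_cases p z w : defines_distinguished_variety p -> p.[z, w] = 0 ->
  [\/ `|z| < 1 /\ `|w| < 1, `|z| = 1 /\ `|w| = 1 | 1 < `|z| /\ 1 < `|w|].
Proof.
by move=> H pzw; have [[[]|[]]|[]] := H (z, w) pzw => /= h1 h2;
  [constructor 1|constructor 2|constructor 3].
Qed.

Lemma dist_swap p : defines_distinguished_variety p ->
  defines_distinguished_variety (swapXY p).
Proof.
move=> H [w z] /=; rewrite /zero_set /= horner2_swapXY => /(dist_cases H).
by case=> -[h1 h2]; [left; left|left; right|right]; split.
Qed.

Lemma norm2_gt1 : 1 < `|2 : C|.
Proof. by rewrite ger0_norm ?ler0n // ltr1n. Qed.

Lemma dist_neq0_2 p y : defines_distinguished_variety p -> `|y| <= 1 -> p.[2, y] != 0.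
Proof.
move=> H y1; apply/negP => /eqP/(dist_cases H).
case=> [[h _]|[h _]|[_ h]].
- by have := lt_trans h norm2_gt1; rewrite ltxx.
- by have := norm2_gt1; rewrite h ltxx.
- by have := lt_le_trans h y1; rewrite ltxx.
Qed.

Lemma dist_vertical p w : defines_distinguished_variety p -> exists z, p.[z, w] != 0.
Proof.
move=> H; case: (real_leP (normr_real w) (@real1 C)) => w1.
  by exists 2; apply: dist_neq0_2.
exists 0; apply/negP => /eqP/(dist_cases H); rewrite normr0.
case=> [[_ h]|[/esym/eqP]|[h _]].
- by have := lt_trans h w1; rewrite ltxx.
- by rewrite oner_eq0.
- by have := lt_trans h ltr01; rewrite ltxx.
Qed.

Lemma dist_lead_coef p y : defines_distinguished_variety p -> p != 0 -> `|y| <= 1 ->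
  (lead_coef p).[y] != 0.
Proof.
move=> H p0; apply: lead_coef_disc => // [x {}y y1|{}y]; last exact: dist_neq0_2.
move=> /(dist_cases H); case=> [[/ltW]|[->]|[_ h]] //.
by have := lt_le_trans h y1; rewrite ltxx.
Qed.

(** On the circle each linear factor satisfies w conj (w - r) = - r^-1 (w - r) when |r| = 1. *)
Lemma recip_unit_roots n (f : {poly C}) : size f = n.+1 ->
  (forall r, root f r -> `|r| = 1) -> exists c, recip n f = c *: f.
Proof.
move=> sf; have [s fE] := closed_field_poly_normal f.
have l0 : lead_coef f != 0 by rewrite lead_coef_eq0 -size_poly_eq0 sf.
have ss : size s = n by move: sf; rewrite fE size_scale // size_prod_XsubC => -[].
move=> Hr; have {}Hr r : r \in s -> `|r| = 1.
  by move=> rs; apply: Hr; rewrite fE rootZ // root_prod_XsubC.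
exists ((lead_coef f)^* / lead_coef f * \prod_(r <- s) - r^-1).
apply: poly_eq_circle => w w1; rewrite horner_recip ?sf ?norm1_neq0 //.
have fw : f.[w] = lead_coef f * (\prod_(r <- s) ('X - r%:P)).[w] by rewrite {1}fE hornerZ.
rewrite -conj_unit // conjCK hornerZ fw rmorphM /=.
have -> : w ^+ n * ((lead_coef f)^* * ((\prod_(r <- s) ('X - r%:P)).[w])^*) =
    (lead_coef f)^* * (w ^+ size s * ((\prod_(r <- s) ('X - r%:P)).[w])^*).
  by rewrite ss; ring.
have -> : w ^+ size s * ((\prod_(r <- s) ('X - r%:P)).[w])^* =
    (\prod_(r <- s) - r^-1) * (\prod_(r <- s) ('X - r%:P)).[w].
  elim: s Hr {fE ss fw} => [|r s IH] Hr; first by rewrite !big_nil hornerC conjC1 !mulr1.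
  rewrite !big_cons !hornerM rmorphM /= exprS.
  have := IH (fun t ts => Hr t (mem_behead (s := r :: s) ts)).
  set x := \prod_(j <- s) ('X - j%:P); set y := \prod_(j <- s) - j^-1 => E.
  transitivity ((w * (('X - r%:P).[w])^*) * (w ^+ size s * (x.[w])^*)); first by ring.
  rewrite E !hornerE rmorphB /= (conj_unit w1) (conj_unit (Hr r (mem_head _ _))).
  by field; rewrite !norm1_neq0 // Hr // mem_head.
by field.
Qed.

Variables (n m : nat) (p : {poly {poly C}}).
Hypotheses (sp : size p = n.+1) (sYp : sizeY p = m.+1).
Hypothesis dp : defines_distinguished_variety p.

Let p0 : p != 0. Proof. by rewrite -size_poly_eq0 sp. Qed.

Lemma size_coef j : (size (p`_j)%R <= m.+1)%N.
Proof. by rewrite -sYp max_size_coefXY. Qed.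

Lemma horner2_coef z w :
  p.[z, w] = \sum_(j < n.+1) \sum_(k < m.+1) p`_j`_k * z ^+ j * w ^+ k.
Proof.
rewrite (horner_coef p) sp horner_sum; apply: eq_bigr => j _.
rewrite -polyC_exp hornerM hornerC (horner_coef_wide _ (size_coef j)) mulr_suml.
by apply: eq_bigr => k _; rewrite mulrAC.
Qed.

Let pr : {poly {poly C}} := \poly_(j < n.+1) \poly_(k < m.+1) (p`_(n - j)`_(m - k))^*.

Lemma horner_pr j w : (j <= n)%N -> `|w| = 1 ->
  (pr`_j).[w] = w ^+ m * (recip n (map_poly (horner_eval w) p))`_j.
Proof.
move=> jn w1; rewrite /pr coef_poly ltnS jn /recip [in RHS]coef_poly ltnS jn.
rewrite -(horner_reverse m (fun k => p`_(n - j)`_k)) //; congr (_ * _^*).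
rewrite coef_map /= /horner_eval; congr (_.[_]); apply/polyP => k.
rewrite coef_poly; case: ltnP => // mk.
by rewrite nth_default // (leq_trans (size_coef _)).
Qed.

(** For |w| = 1 all zeros of p(., w) are unimodular, so p(., w) and its reflection are proportional;
    comparing leading coefficients makes this an identity of polynomials. *)
Lemma reverse_proportional : lead_coef p *: pr = pr`_n *: p.
Proof.
have f0 : lead_coef p != 0 by rewrite lead_coef_eq0.
apply/polyP => j; rewrite !coefZ; have [jn|nj] := leqP j n; last first.
  have -> : p`_j = 0 by rewrite nth_default ?sp.
  by rewrite nth_default ?mulr0 // (leq_trans (size_poly _ _)).
(* The additional factor makes the claim trivial at points w where the leading coefficient is
   zero. *)
apply: (mulfI f0); apply: poly_eq_circle => w w1; rewrite !hornerM.
have [->|fw] := eqVneq (lead_coef p).[w] 0; first by rewrite !mul0r.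
congr (_ * _); rewrite !horner_pr //.
pose P := map_poly (horner_eval w) p.
have sP : size P = n.+1 by rewrite size_map_poly_id0.
have [|c cE] := recip_unit_roots sP.
  move=> r; rewrite rootE -horner2_map => /eqP/(dist_cases dp).
  by case=> [[_ h]|[]|[_ h]] //; rewrite w1 ltxx in h.
by rewrite -/P cE !coefZ !coef_map lead_coefE sp /= /horner_eval; ring.
Qed.

(** The reflection is g p by [primitive_quotient]. Since its degree in w is still at most m, g is
    constant, and reflecting twice gives |g| = 1. *)
Lemma dist_symmetric : exists c : C, `|c| = 1 /\
  forall j k, (j <= n)%N -> (k <= m)%N -> (p`_(n - j)`_(m - k))^* = c * p`_j`_k.
Proof.
have f0 : lead_coef p != 0 by rewrite lead_coef_eq0.
have [g gE] := primitive_quotient f0 (fun w => dist_vertical w dp) reverse_proportional.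
have prE j k : (j <= n)%N -> (k <= m)%N -> (p`_(n - j)`_(m - k))^* = (g * p`_j)`_k.
  by move=> jn km; rewrite -coefZ -gE /pr coef_poly ltnS jn coef_poly ltnS km.
have gc : g = (g`_0)%:P.
  apply: size1_polyC; have [->|g0] := eqVneq g 0; first by rewrite size_poly0.
  have [j sj] : exists j, size (p`_j)%R = m.+1.
    pose F (i : 'I_(size p)) := size (p`_i)%R.
    have [|j jE] := @bigop.eq_bigmax _ F; first by rewrite card_ord sp.
    by exists j; rewrite -sYp /sizeY -/(F j) -jE.
  have pj0 : p`_j != 0 by rewrite -size_poly_eq0 sj.
  have : (size (g * p`_j)%R <= m.+1)%N.
    by rewrite -coefZ -gE /pr coef_poly; case: ifP => _; rewrite ?size_poly0 ?size_poly.
  by rewrite size_mul // sj addnS /= -[X in (_ <= X)%N]add1n leq_add2r.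
exists g`_0.
have {}prE j k : (j <= n)%N -> (k <= m)%N ->
    (p`_(n - j)`_(m - k))^* = g`_0 * p`_j`_k.
  by move=> jn km; rewrite prE // gc coefCM -gc.
split=> //; set k := (size (lead_coef p)).-1.
have km : (k <= m)%N.
  by rewrite -ltnS prednK ?size_poly_gt0 // lead_coefE size_coef.
have k0 : p`_n`_k != 0.
  by rewrite -[n]/(n.+1.-1) -sp -lead_coefE -lead_coefE lead_coef_eq0.
have E1 := prE n k (leqnn n) km.
have E2 := prE 0%N (m - k)%N (leq0n n) (leq_subr _ _).
rewrite subnn in E1; rewrite subn0 subKn // in E2.
have : `|g`_0| ^+ 2 * p`_n`_k = p`_n`_k.
  by rewrite normCK mulrAC -E1 mulrC -rmorphM /= -E2 conjCK.
rewrite -[RHS]mul1r => /(mulIf k0)/eqP.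
by rewrite sqrf_eq1 => /orP[/eqP //|/eqP h]; have := normr_ge0 g`_0; rewrite h oppr_ge0 ler10.
Qed.

(* The reversal [w -> 1/w] moves the zeros of [p] off the closed bidisc, except
   on the torus, and shrinking either variable removes those. *)
Lemma dist_scaled_stable (a b e : C) : 0 <= a -> 0 <= b -> a != 0 \/ b != 0 ->
  0 < e -> a * e <= 1 -> b * e <= 1 -> forall z w, `|z| <= 1 -> `|w| <= 1 ->
  \sum_(j < n.+1) \sum_(k < m.+1)
    scaled (fun j k => p`_j`_(m - k)) a b e j k * z ^+ j * w ^+ k != 0.
Proof.
move=> a0 b0 ab e0 ae be z w z1 w1.
set x := (1 - a * e) * z; set y := (1 - b * e) * w.
have shrink (c v : C) : 0 <= c -> c * e <= 1 -> `|v| <= 1 ->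
    `|(1 - c * e) * v| <= 1 /\ (c != 0 -> `|(1 - c * e) * v| < 1).
  move=> c0 ce v1; have h0 : 0 <= 1 - c * e by rewrite subr_ge0.
  have h1 : 1 - c * e <= 1 by rewrite gerBl mulr_ge0 // ltW.
  rewrite normrM (ger0_norm h0); split; first by rewrite mulr_ile1.
  move=> cn0; apply: le_lt_trans (_ : 1 - c * e < 1); first by rewrite ler_piMr.
  by rewrite gtrBl mulr_gt0 // lt_neqAle eq_sym cn0.
have [x1 xs] := shrink a z a0 ae z1; have [y1 ys] := shrink b w b0 be w1.
have -> : \sum_(j < n.+1) \sum_(k < m.+1)
    scaled (fun j k => p`_j`_(m - k)) a b e j k * z ^+ j * w ^+ k =
  \sum_(j < n.+1) \sum_(k < m.+1) p`_j`_(m - k) * x ^+ j * y ^+ k.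
  apply: eq_bigr => j _; apply: eq_bigr => k _.
  by rewrite /scaled /x /y !exprMn; ring.
have [yE|yn0] := eqVneq y 0.
  have := dist_lead_coef (dist_swap dp) _ x1; rewrite swapXY_eq0 => /(_ p0).
  have sS : size (swapXY p) = m.+1 by rewrite -sizeYE.
  congr (_ != 0); rewrite lead_coefE sS /=.
  have sz : (size ((swapXY p)`_m)%R <= n.+1)%N.
    by rewrite -sp -[p in X in (_ <= X)%N]swapXYK -sizeYE max_size_coefXY.
  rewrite (horner_coef_wide _ sz); apply: eq_bigr => j _.
  rewrite big_ord_recl big1 ?addr0 => [|k _]; last by rewrite yE expr0n mulr0.
  by rewrite subn0 expr0 mulr1 coef_swapXY.
have -> : \sum_(j < n.+1) \sum_(k < m.+1) p`_j`_(m - k) * x ^+ j * y ^+ k =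
    y ^+ m * p.[x, y^-1].
  rewrite horner2_coef mulr_sumr; apply: eq_bigr => j _.
  rewrite mulr_sumr (reindex_inj rev_ord_inj) /=; apply: eq_bigr => k _.
  have km : (k <= m)%N by rewrite -ltnS.
  rewrite subSS subKn // [RHS]mulrCA; congr (_ * _).
  by rewrite exprVn -expfB_cond ?(negbTE yn0).
rewrite mulf_neq0 ?expf_neq0 //; apply/negP => /eqP/(dist_cases dp).
have yi : 1 <= `|y^-1| by rewrite normfV invf_ge1 // normr_gt0.
case=> [[_ h]|[h1 h2]|[h _]].
- by have := lt_le_trans h yi; rewrite ltxx.
- case: ab => [/xs|/ys]; first by rewrite -/x h1 ltxx.
  have : `|y| = 1 by rewrite -[LHS]invrK -normfV h2 invr1.
  by rewrite -/y => ->; rewrite ltxx.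
- by have := lt_le_trans h x1; rewrite ltxx.
Qed.

End Distinguished.

(** * Irreducible factors and Gauss's lemma in C[z, w] *)

Section Irreducible.
Variable R : realType.
Local Notation C := R[i].
Implicit Types p q r d e f : {poly {poly C}}.

(** At a root w of c the product e d vanishes on the line over w, so e or d does, and X - w can be
    cancelled from it. Induction on the degree of c removes all of c. *)
Lemma gauss_factor (c : {poly C}) q e d : c != 0 -> c *: q = e * d ->
  exists e' d' (s t : {poly C}),
    [/\ s != 0, t != 0, e = s *: e', d = t *: d' & q = e' * d'].
Proof.
move=> c0; have [N] := ubnP (size c); elim: N => // N IH in c e d c0 *.
move=> cN E; have [c1|c1] := eqVneq (size c) 1%N.
  have /size_poly1P[x x0 cE] : size c == 1%N by rewrite c1.
  exists (x^-1%:P *: e), d, x%:P, 1; split.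
  - by rewrite polyC_eq0.
  - exact: oner_neq0.
  - by rewrite scalerA -polyCM mulfV // polyC1 scale1r.
  - by rewrite scale1r.
  by rewrite -scalerAl -E cE scalerA -polyCM mulVf // polyC1 scale1r.
have [w cw] := closed_rootP _ c1; have [c' cE] := factor_theorem _ _ cw.
pose X := 'X - w%:P : {poly C}; have X0 : X != 0 by rewrite polyXsubC_eq0.
have c'0 : c' != 0 by apply: contra c0; rewrite cE => /eqP ->; rewrite mul0r.
have c'N : (size c' < N)%N.
  by move: cN; rewrite cE size_Mmonic ?monicXsubC // size_XsubC addn2.
pose ev := map_poly (horner_eval w).
have divX f : ev f = 0 -> exists f', f = X *: f'.
  move=> f0; exists (\poly_(i < size f) (f`_i %/ X)); apply/polyP => i.
  rewrite coefZ coef_poly; case: ltnP => fi; last by rewrite nth_default ?mulr0.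
  rewrite mulrC divpK // dvdp_XsubCl /root.
  by have := congr1 (fun g : {poly C} => g`_i) f0; rewrite coef_map coef0 /= /horner_eval => ->.
have : ev e * ev d = 0.
  rewrite -rmorphM -E; apply/polyP => i; rewrite coef_map coefZ /= /horner_eval hornerM.
  by move/eqP: cw => ->; rewrite mul0r coef0.
have XI f g : X *: f = X *: g -> f = g.
  move=> h; apply/polyP => i; have := congr1 (fun g : {poly {poly C}} => g`_i) h.
  by rewrite !coefZ => /(mulfI X0).
move/eqP; rewrite mulf_eq0 => /orP[/eqP/divX[e1 eE]|/eqP/divX[d1 dE]].
  have [|e' [d' [s [t [s0 t0 e1E dE qE]]]]] := IH c' e1 d c'0 c'N.
    by apply: XI; rewrite scalerAl -eE -E cE scalerA mulrC.
  exists e', d', (X * s), t; split=> //; first by rewrite mulf_neq0.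
  by rewrite eE e1E scalerA.
have [|e' [d' [s [t [s0 t0 eE d1E qE]]]]] := IH c' e d1 c'0 c'N.
  by apply: XI; rewrite scalerAr -dE -E cE scalerA mulrC.
exists e', d', s, (X * t); split=> //; first by rewrite mulf_neq0.
by rewrite dE d1E scalerA.
Qed.

(** Divisibility of polynomials over C[w] is meant up to a nonzero factor from C[w], that is, over
    C(w); Gauss's lemma brings a factorization back to C[z, w]. *)
Lemma irreducible2_poly q : irreducible2 q -> (1 < size q)%N -> irreducible_poly q.
Proof.
move=> [q0 _ qI] q1; split=> // d d1 /Pdiv.Idomain.dvdpP[[c e] /= c0 E].
have [e' [d' [s [t [s0 t0 eE dE qE]]]]] := gauss_factor c0 E.
have [] := qI _ _ qE; rewrite poly_unitE => /andP[/eqP s1 _]; last first.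
  by move: d1; rewrite dE size_scale // s1 eqxx.
have [u uE] : exists u, e' = u%:P by exists e'`_0; apply: size1_polyC; rewrite s1.
have u0 : u != 0 by rewrite -polyC_eq0 -uE -size_poly_eq0 s1.
apply/Pdiv.Idomain.eqpP; exists (u, t) => /=; first by rewrite u0 t0.
by rewrite dE qE uE scalerA mulrC -scalerA mul_polyC.
Qed.

Lemma unit2P q : q \is a GRing.unit -> exists2 c : C, c != 0 & q = c%:P%:P.
Proof.
rewrite poly_unitE => /andP[/eqP s1]; rewrite poly_unitE => /andP[/eqP s2 _].
have qE : q = (q`_0)%:P by apply: size1_polyC; rewrite s1.
have /size_poly1P[c c0 cE] : size q`_0 == 1%N by rewrite s2.
by exists c => //; rewrite qE cE.
Qed.

Lemma unit2C (c : C) : c != 0 -> (c%:P%:P : {poly {poly C}}) \is a GRing.unit.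
Proof. by move=> c0; rewrite !(rmorph_unit, unitfE). Qed.

Lemma swapXYCC (c : C) : swapXY (c%:P%:P : {poly {poly C}}) = c%:P%:P.
Proof. by rewrite swapXY_polyC map_polyC. Qed.

Lemma swapXY_unit q : (swapXY q \is a GRing.unit) = (q \is a GRing.unit).
Proof.
have H r : r \is a GRing.unit -> swapXY r \is a GRing.unit.
  by move=> /unit2P[c c0 ->]; rewrite swapXYCC unit2C.
by apply/idP/idP => /H; rewrite ?swapXYK.
Qed.

Lemma irreducible2_swap q : irreducible2 q -> irreducible2 (swapXY q).
Proof.
move=> [q0 qU qI]; split; rewrite ?swapXY_eq0 ?swapXY_unit // => r s E.
have [] := qI (swapXY r) (swapXY s); rewrite ?swapXY_unit; [|by left|by right].
by rewrite -rmorphM /= -E swapXYK.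
Qed.

(** A nonunit depending on w alone would vanish on a whole line w = const. *)
Lemma dist_irreducible_size q : defines_distinguished_variety q -> irreducible2 q ->
  (1 < size q)%N.
Proof.
move=> dq [q0 qU _]; rewrite ltnNge; apply/negP => /size1_polyC qE.
have c0 : q`_0 != 0 by rewrite -polyC_eq0 -qE.
have [c1|c1] := eqVneq (size (q`_0)%R) 1%N.
  have /size_poly1P[c cn0 cE] : size (q`_0)%R == 1%N by rewrite c1.
  by move: qU; rewrite qE cE unit2C.
have [w /eqP cw] := closed_rootP _ c1.
by have [z] := dist_vertical w dq; rewrite qE hornerC cw eqxx.
Qed.

Lemma vertical_free_size q f : defines_distinguished_variety q -> q %= f ->
  exists g, f = g *: q.
Proof.
move=> dq /Pdiv.Idomain.eqpP[[c1 c2] /= /andP[c10 c20] E].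
exact: (primitive_quotient c20 (fun w => dist_vertical w dq) (esym E)).
Qed.

(* [q] and [f] have finitely many common zeros unless [q] divides [f] over the
   field of fractions of [C[w]]. *)
Lemma dvdp_of_vanish q f : irreducible_poly q ->
  (forall z w, `|w| != 1 -> q.[z, w] = 0 -> f.[z, w] = 0) -> q %| f.
Proof.
move=> qI H; rewrite -[_ %| _]negbK -irreducible_poly_coprime //; apply/negP.
move=> /Pdiv.Idomain.Bezout_coprimepP[[u v] /= /Pdiv.Idomain.eqp_size].
rewrite size_poly1 => s1.
have [c c0 E] : exists2 c : {poly C}, c != 0 & u * q + v * f = c%:P.
  exists (u * q + v * f)`_0; last by apply: size1_polyC; rewrite s1.
  by rewrite -polyC_eq0 -size1_polyC ?s1 // -size_poly_eq0 s1.
have q1 : (1 < size q)%N by have [] := qI.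
have q0 : q != 0 by rewrite -size_poly_eq0 -lt0n (ltn_trans _ q1).
pose h := c * lead_coef q.
have h0 : h != 0 by rewrite mulf_neq0 // lead_coef_eq0.
(* A nonzero polynomial cannot vanish on the circle of radius 2. At such a w, q(., w) keeps its
   degree and so has a zero, while the Bezout relation has a nonzero right-hand side. *)
have [w w2 hw] : exists2 w, `|w| = 2 & h.[w] != 0.
  case: (pselect (exists2 w, `|w| = 2 & h.[w] != 0)) => // nh.
  case/negP: h0; rewrite -(@comp_poly2_eq0 _ h (2 *: 'X)); last first.
    by rewrite size_scale ?pnatr_eq0 // size_polyX.
  apply/eqP/poly_eq_circle => w w1; rewrite horner_comp hornerZ hornerX horner0.
  apply/eqP/negPn/negP => hn; apply: nh; exists (2 * w) => //.
  by rewrite normrM w1 mulr1 ger0_norm ?ler0n.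
move: hw; rewrite hornerM mulf_eq0 negb_or => /andP[cw lw].
have : size (map_poly (horner_eval w) q) != 1%N.
  by rewrite size_map_poly_id0 // gtn_eqF.
move/closed_rootP => [z /eqP qz].
have w1 : `|w| != 1 by rewrite w2 -subr_eq0 (_ : 2 - 1 = 1 :> C) ?oner_eq0 //; ring.
have qzw : q.[z, w] = 0 by rewrite horner2_map.
have := congr1 (fun g => g.[z, w]) E.
by rewrite !hornerE qzw (H z w w1 qzw) !mulr0 addr0 => /esym/eqP; rewrite (negbTE cw).
Qed.

End Irreducible.

(** * The derivation a z d/dz - b w d/dw *)

Section Derivation.
Variable R : realType.
Local Notation C := R[i].
Implicit Types p q r f : {poly {poly C}}.
Variables a b : C.

Definition euler p : {poly {poly C}} := a%:P *: ('X * dz p) - (b *: 'X) *: dw p.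

Lemma coef_euler p j k : (euler p)`_j`_k = (a * j%:R - b * k%:R) * p`_j`_k.
Proof.
rewrite /euler coefB !coefZ coefXM coef_map /= coefB coefCM -scalerAl coefZ coefXM.
rewrite /dz coef_deriv coef_deriv.
have -> : (if j == 0%N then 0 else p`_(j.-1.+1) *+ j.-1.+1)`_k = p`_j`_k *+ j.
  by case: j => [|j] /=; rewrite ?coef0 ?mulr0n // coefMn.
have -> : (if k == 0%N then 0 else p`_j`_(k.-1.+1) *+ k.-1.+1) = p`_j`_k *+ k.
  by case: k.
by rewrite -[_ *+ j]mulr_natr -[_ *+ k]mulr_natr; ring.
Qed.

Lemma dwE p : dw p = swapXY (swapXY p)^`().
Proof.
apply/polyP => j; apply/polyP => k.
by rewrite coef_map /= coef_deriv coef_swapXY coef_deriv coefMn coef_swapXY.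
Qed.

Lemma eulerM q r : euler (q * r) = euler q * r + q * euler r.
Proof.
rewrite /euler /dz !dwE rmorphM /= !derivM rmorphD !rmorphM /= !swapXYK -!mul_polyC.
by ring.
Qed.

Lemma horner_euler p z w :
  (euler p).[z, w] = a * z * (dz p).[z, w] - b * w * (dw p).[z, w].
Proof. by rewrite /euler !hornerE. Qed.

Lemma size_euler p : (size (euler p) <= size p)%N.
Proof.
apply/leq_sizeP => j pj; apply/polyP => k.
by rewrite coef_euler (_ : p`_j = 0) ?coef0 ?mulr0 ?nth_default.
Qed.

Lemma size_coef_euler p j : (size ((euler p)`_j)%R <= size (p`_j)%R)%N.
Proof. by apply/leq_sizeP => k pk; rewrite coef_euler nth_default ?mulr0. Qed.

Lemma dist_prod_factor p q r : defines_distinguished_variety p -> p = q * r ->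
  defines_distinguished_variety q.
Proof.
move=> dp pE x qx; apply: dp; rewrite /zero_set /= pE !hornerM.
by rewrite [q.[_, _]]qx mul0r.
Qed.

Hypotheses (a0 : 0 <= a) (b0 : 0 <= b) (ab : a != 0 \/ b != 0).

(** An eigenvector contains only monomials z^j w^k with a j - b k = c. As the leading coefficients
    of q in z and in w do not vanish at 0, q contains pure powers of z and of w, so c is both
    nonnegative and nonpositive, forcing a = b = 0. *)
Lemma dist_euler_neq q (c : C) : defines_distinguished_variety q -> (1 < size q)%N ->
  (1 < size (swapXY q))%N -> euler q <> c%:P%:P * q.
Proof.
move=> dq s1 s2 E.
have q0 : q != 0 by rewrite -size_poly_eq0 -lt0n (ltn_trans _ s1).
have key j k : q`_j`_k != 0 -> c = a * j%:R - b * k%:R.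
  move=> qjk; apply: (mulIf qjk); rewrite -coef_euler E.
  by rewrite !coefCM.
have c00 : `|0 : C| <= 1 by rewrite normr0 ler01.
have h1 := dist_lead_coef dq q0 c00.
rewrite horner_coef0 lead_coefE in h1.
have sq0 : swapXY q != 0 by rewrite swapXY_eq0.
have h2 := dist_lead_coef (dist_swap dq) sq0 c00.
rewrite horner_coef0 lead_coefE coef_swapXY in h2.
have := key _ _ h1; rewrite mulr0 subr0 => c1.
have := key _ _ h2; rewrite mulr0 sub0r => c2.
have n1 : 0 < (size q).-1%:R :> C by rewrite ltr0n -subn1 subn_gt0.
have m1 : 0 < (size (swapXY q)).-1%:R :> C by rewrite ltr0n -subn1 subn_gt0.
have : a * (size q).-1%:R + b * (size (swapXY q)).-1%:R = 0.
  by rewrite -c1 c2 addNr.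
move/eqP; rewrite paddr_eq0 ?mulr_ge0 ?ler0n // !mulf_eq0.
rewrite (gt_eqF n1) (gt_eqF m1) !orbF => /andP[/eqP aE /eqP bE].
by case: ab; rewrite ?aE ?bE eqxx.
Qed.

(** One irreducible factor q_0 would divide [euler p], hence [euler q_0] by the Leibniz rule, the
    other factors being coprime to it. The degrees in z and w make the quotient a constant, contrary
    to [dist_euler_neq]. *)
Lemma euler_not_vanish p : defines_distinguished_variety p -> zero_set p !=set0 ->
  product_of_distinct_irreducibles p ->
  ~ (forall z w, `|w| != 1 -> p.[z, w] = 0 -> (euler p).[z, w] = 0).
Proof.
move=> dp [[z0 w0] /= p0] [k [q [qI qA pE]]] H.
case: k q qI qA pE => [|k] q qI qA pE.
  by move: p0; rewrite /zero_set /= pE big_ord0 hornerC hornerC => /eqP; rewrite oner_eq0.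
pose r := \prod_(i < k) q (lift ord0 i).
have pqr : p = q ord0 * r by rewrite pE big_ord_recl.
have dq i : defines_distinguished_variety (q i).
  by apply: (@dist_prod_factor p _ (\prod_(j < k.+1 | j != i) q j)); rewrite // pE (bigD1 i).
have s1 i : (1 < size (q i))%N := dist_irreducible_size (dq i) (qI i).
have s2 : (1 < size (swapXY (q ord0)))%N.
  exact: dist_irreducible_size (dist_swap (dq ord0)) (irreducible2_swap (qI ord0)).
have qp i : irreducible_poly (q i) := irreducible2_poly (qI i) (s1 i).
have cop : coprimep (q ord0) r.
  rewrite /r; elim/big_ind: _ => [|x y|i _]; first exact: coprimep1.
    by rewrite coprimepMr => -> ->.
  rewrite irreducible_poly_coprime //; apply/negP => dv.
  have [_ /(_ (q ord0)) eqi] := qp (lift ord0 i).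
  have {}dv : q ord0 %= q (lift ord0 i) by apply: eqi; rewrite // gtn_eqF.
  have [g gE] := vertical_free_size (dq ord0) dv.
  have [_ _ qIi] := qI (lift ord0 i).
  have [|gU|qU] := qIi g%:P (q ord0); first by rewrite mul_polyC.
    by case: (qA (lift ord0 i) ord0 isT); exists g%:P => //; rewrite gE mul_polyC.
  by have [_ /negP] := qI ord0.
have dv1 : q ord0 %| euler p.
  by apply: dvdp_of_vanish => // z w w1 qz; apply: H => //; rewrite pqr !hornerM qz mul0r.
have dv2 : q ord0 %| euler (q ord0).
  move: dv1; rewrite pqr eulerM (dvdp_addl _ (dvdp_mulr _ (dvdpp _))).
  by rewrite Gauss_dvdpl.
have [[c e] /= c0 E] := Pdiv.Idomain.dvdpP _ _ dv2.
have q0 : q ord0 != 0 by have [] := qI ord0.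
have eC : e = (e`_0)%:P.
  apply: size1_polyC; have [->|e0] := eqVneq e 0; first by rewrite size_poly0.
  have := size_euler (q ord0); rewrite -(size_scale (euler (q ord0)) c0) E size_mul //.
  by rewrite -subn1 leq_subLR leq_add2r.
have [g gE] : exists g, euler (q ord0) = g *: q ord0.
  apply: (primitive_quotient c0 (fun w => dist_vertical w (dq ord0))).
  by rewrite E {1}eC mul_polyC.
have gC : g = (g`_0)%:P.
  apply: size1_polyC; have [->|g0] := eqVneq g 0; first by rewrite size_poly0.
  have := size_coef_euler (q ord0) (size (q ord0)).-1.
  rewrite gE coefZ -lead_coefE size_mul ?lead_coef_eq0 //.
  by rewrite -subn1 leq_subLR leq_add2r.
apply: (@dist_euler_neq (q ord0) g`_0) => //.
by rewrite gE {1}gC mul_polyC.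
Qed.

End Derivation.

(** * The sums of squares identity for distinguished varieties *)

Section Evaluation.
Variable C : numClosedFieldType.
Implicit Types f g : {poly {poly C}}.

Lemma bidegree_ltP f N M : bidegree_lt f N M <->
  forall j k, (N <= j)%N || (M <= k)%N -> f`_j`_k = 0.
Proof.
split=> [[sf sYf] j k /orP[Nj|Mk]|H].
- by rewrite (_ : f`_j = 0) ?coef0 // nth_default // (leq_trans sf).
- by rewrite nth_default // (leq_trans _ Mk) // (leq_trans (max_size_coefXY _ _)).
split.
  by apply/leq_sizeP => j Nj; apply/polyP => k; rewrite coef0 H ?Nj.
apply/bigmax_leqP => j _; apply/leq_sizeP => k Mk.
by rewrite H ?Mk ?orbT.
Qed.

Lemma horner2_wide f N M z w : bidegree_lt f N M ->
  f.[z, w] = \sum_(j < N) \sum_(k < M) f`_j`_k * (z ^+ j * w ^+ k).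
Proof.
move=> [sf sYf]; rewrite (horner_coef_wide _ sf) horner_sum; apply: eq_bigr => j _.
have sj : (size (f`_j)%R <= M)%N := leq_trans (max_size_coefXY _ _) sYf.
rewrite -polyC_exp hornerM hornerC (horner_coef_wide _ sj) mulr_suml.
by apply: eq_bigr => k _; rewrite mulrAC mulrA.
Qed.

Variables (N M : nat) (z w Z W : C).

Definition evalk (S : nat -> nat -> nat -> nat -> C) : C :=
  \sum_(j < N.+1) \sum_(k < M.+1) \sum_(j' < N.+1) \sum_(k' < M.+1)
    S j k j' k' * ((Z^* ^+ j * W^* ^+ k) * (z ^+ j' * w ^+ k')).

Lemma eq_evalk S T : (forall j k j' k', (j <= N)%N -> (k <= M)%N -> (j' <= N)%N ->
  (k' <= M)%N -> S j k j' k' = T j k j' k') -> evalk S = evalk T.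
Proof.
move=> H; apply: eq_bigr => j _; apply: eq_bigr => k _; apply: eq_bigr => j' _.
by apply: eq_bigr => k' _; rewrite H ?leq_ord.
Qed.

Lemma evalkD S T : evalk (fun j k j' k' => S j k j' k' + T j k j' k') = evalk S + evalk T.
Proof.
rewrite -big_split; apply: eq_bigr => j _; rewrite -big_split; apply: eq_bigr => k _.
rewrite -big_split; apply: eq_bigr => j' _; rewrite -big_split; apply: eq_bigr => k' _.
by rewrite mulrDl.
Qed.

Lemma evalkZ c S : evalk (fun j k j' k' => c * S j k j' k') = c * evalk S.
Proof.
rewrite mulr_sumr; apply: eq_bigr => j _; rewrite mulr_sumr; apply: eq_bigr => k _.
rewrite mulr_sumr; apply: eq_bigr => j' _; rewrite mulr_sumr; apply: eq_bigr => k' _.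
by rewrite -!mulrA.
Qed.

Lemma evalkB S T : evalk (fun j k j' k' => S j k j' k' - T j k j' k') = evalk S - evalk T.
Proof.
rewrite -[evalk T]mul1r -mulNr -evalkZ -evalkD; apply: eq_evalk => * .
by rewrite mulN1r.
Qed.

Lemma evalk_sum (I : Type) (r : seq I) (S : I -> nat -> nat -> nat -> nat -> C) :
  evalk (fun j k j' k' => \sum_(i <- r) S i j k j' k') = \sum_(i <- r) evalk (S i).
Proof.
elim: r => [|i r IH].
  rewrite big_nil -[RHS](mul0r (evalk (fun _ _ _ _ => 0))) -evalkZ.
  by apply: eq_evalk => *; rewrite big_nil mulr0.
rewrite big_cons -IH -evalkD; apply: eq_evalk => *; exact: big_cons.
Qed.

Lemma evalk_prod f g : bidegree_lt f N.+1 M.+1 -> bidegree_lt g N.+1 M.+1 ->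
  evalk (fun j k j' k' => (f`_j`_k)^* * g`_j'`_k') = (f.[Z, W])^* * g.[z, w].
Proof.
move=> bf bg; rewrite (horner2_wide _ _ bf) (horner2_wide _ _ bg) rmorph_sum mulr_suml.
apply: eq_bigr => j _; rewrite rmorph_sum mulr_suml; apply: eq_bigr => k _.
rewrite mulr_sumr; apply: eq_bigr => j' _; rewrite mulr_sumr; apply: eq_bigr => k' _.
by rewrite !rmorphM !rmorphXn /=; ring.
Qed.

(** The vanishing of S at the top index N keeps the shifted array inside the summation range. *)
Lemma evalk_shiftz S : (forall j k j' k', (N <= j)%N || (N <= j')%N -> S j k j' k' = 0) ->
  evalk (fun j k j' k' => if (j, j') is (j1.+1, j1'.+1) then S j1 k j1' k' else 0) =
  Z^* * z * evalk S.
Proof.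
move=> S0; rewrite /evalk big_ord_recl [X in X + _]big1 ?add0r; last first.
  move=> k _; apply: big1 => j' _; apply: big1 => k' _; exact: mul0r.
rewrite [X in _ = _ * X]big_ord_recr /= [X in _ = _ * (_ + X)]big1 ?addr0; last first.
  move=> k _; apply: big1 => j' _; apply: big1 => k' _.
  by rewrite S0 ?leqnn ?mul0r.
rewrite mulr_sumr; apply: eq_bigr => j _; rewrite mulr_sumr; apply: eq_bigr => k _.
rewrite big_ord_recl [X in X + _]big1 ?add0r => [|k' _]; last exact: mul0r.
rewrite [X in _ = _ * X]big_ord_recr /= [X in _ = _ * (_ + X)]big1 ?addr0 => [|k' _]; last first.
  by rewrite S0 ?leqnn ?orbT ?mul0r.
rewrite mulr_sumr; apply: eq_bigr => j' _; rewrite mulr_sumr; apply: eq_bigr => k' _.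
by rewrite !exprS; ring.
Qed.

Lemma evalk_shiftw S : (forall j k j' k', (M <= k)%N || (M <= k')%N -> S j k j' k' = 0) ->
  evalk (fun j k j' k' => if (k, k') is (k1.+1, k1'.+1) then S j k1 j' k1' else 0) =
  W^* * w * evalk S.
Proof.
move=> S0; rewrite mulr_sumr; apply: eq_bigr => j _.
rewrite big_ord_recl [X in X + _]big1 ?add0r; last first.
  by move=> j' _; apply: big1 => k' _; exact: mul0r.
rewrite [X in _ = _ * X]big_ord_recr /= [X in _ = _ * (_ + X)]big1 ?addr0; last first.
  by move=> j' _; apply: big1 => k' _; rewrite S0 ?leqnn ?mul0r.
rewrite mulr_sumr; apply: eq_bigr => k _; rewrite mulr_sumr; apply: eq_bigr => j' _.
rewrite big_ord_recl mul0r add0r.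
rewrite [X in _ = _ * X]big_ord_recr /= S0 ?leqnn ?orbT // mul0r addr0.
rewrite mulr_sumr; apply: eq_bigr => k' _.
by rewrite !exprS; ring.
Qed.

Lemma evalk_diffz S : (forall j k j' k', (N <= j)%N || (N <= j')%N -> S j k j' k' = 0) ->
  evalk (diffz S) = (1 - Z^* * z) * evalk S.
Proof. by move=> S0; rewrite evalkB evalk_shiftz // mulrBl mul1r. Qed.

Lemma evalk_diffw S : (forall j k j' k', (M <= k)%N || (M <= k')%N -> S j k j' k' = 0) ->
  evalk (diffw S) = (1 - W^* * w) * evalk S.
Proof. by move=> S0; rewrite evalkB evalk_shiftw // mulrBl mul1r. Qed.

Lemma evalk_gramf d (P : 'rV[{poly {poly C}}]_d) :
  (forall i, bidegree_lt (P 0 i) N.+1 M.+1) ->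
  evalk (gramf (fun i j k => (P 0 i)`_j`_k)) = dotmx (evalv P z w) (evalv P Z W).
Proof.
move=> bP; rewrite dotmxE mxE evalk_sum; apply: eq_bigr => i _.
by rewrite evalk_prod // !mxE mulrC.
Qed.

End Evaluation.

(** * The identity for pairs of points *)

Section Polarized.
Variable R : realType.
Local Notation C := R[i].
Variables (n m : nat) (p : {poly {poly C}}) (a b : R).

(** Its diagonal is the identity of the theorem, its restriction to V the last claim; P and Q enter
    through inner products only, so unitary changes of coordinates preserve it. *)
Definition polarized (P : 'rV[{poly {poly C}}]_n) (Q : 'rV[{poly {poly C}}]_m) : Prop :=
  forall z w Z W : C,
  (a%:C%C * n%:R - b%:C%C * m%:R) * ((p.[Z, W])^* * p.[z, w])
  - (p.[Z, W])^* * (euler a%:C%C b%:C%C p).[z, w]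
  - ((euler a%:C%C b%:C%C p).[Z, W])^* * p.[z, w] =
  (1 - Z^* * z) * dotmx (evalv P z w) (evalv P Z W) -
  (1 - W^* * w) * dotmx (evalv Q z w) (evalv Q Z W).

Hypotheses (hdeg : has_bidegree p n m) (hdist : defines_distinguished_variety p).
Hypotheses (ha : 0 <= a) (hb : 0 <= b) (hab : ~ (a = 0 /\ b = 0)).

Lemma realC (x : R) : (x%:C%C)^* = x%:C%C :> C.
Proof. by rewrite conj_Creal // complex_real. Qed.

Lemma realC_neq0 : a%:C%C != 0 :> C \/ b%:C%C != 0 :> C.
Proof.
have [aE|] := eqVneq a 0; last by left; rewrite (inj_eq (@complexI R)).
right; rewrite (inj_eq (@complexI R)); apply/negP => /eqP bE.
exact: hab.
Qed.

Lemma polarized_sos : exists (P : 'rV[{poly {poly C}}]_n) (Q : 'rV[{poly {poly C}}]_m),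
  [/\ forall j, bidegree_lt (P 0 j) n m.+1, forall j, bidegree_lt (Q 0 j) n.+1 m &
      polarized P Q].
Proof.
have [sp sYp] := hdeg.
have [c [c1 cE]] := dist_symmetric sp sYp hdist.
pose q j k := p`_j`_(m - k).
have qsym j k : (j <= n)%N -> (k <= m)%N -> (q (n - j)%N (m - k)%N)^* = c * q j k.
  by move=> jn km; apply: cE => //; apply: leq_subr.
have A0 : 0 <= a%:C%C :> C by rewrite lecR.
have B0 : 0 <= b%:C%C :> C by rewrite lecR.
(* For k >= K the parameter 1/(k + 1) makes a t and b t at most 1, as [dist_scaled_stable]
   requires. *)
pose K := (Num.trunc (a + b)).+1.
have small (x : R) t : (K <= t)%N -> x <= a + b -> x%:C%C * einv R t <= 1 :> C.
  move=> Kt xab; rewrite ler_pdivrMr ?ltr0n // mul1r -(rmorph_nat (real_complex R)) lecR.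
  apply: le_trans xab _; apply: ltW; apply: lt_le_trans (truncnS_gt _) _.
  by rewrite ler_nat (leq_trans Kt).
have qst t z w : (K <= t)%N -> `|z| <= 1 -> `|w| <= 1 ->
    \sum_(j < n.+1) \sum_(k < m.+1) scaled q a%:C%C b%:C%C (einv R t) j k * z ^+ j * w ^+ k != 0.
  move=> Kt; apply: dist_scaled_stable => //; first exact: realC_neq0.
  - by rewrite invr_gt0 ltr0n.
  - by apply: small => //; rewrite lerDl.
  - by apply: small => //; rewrite lerDr.
have ar : a%:C%C \is Num.real by rewrite complex_real.
have br : b%:C%C \is Num.real by rewrite complex_real.
have [P0 [Q0 [HP HQ E]]] := limit_sos ar br c1 qsym qst.
(* Undoing w -> 1/w reverses P in degree m and Q in degree m - 1. The term in Q changes its sign,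
   since 1 - 1/|w|^2 = - (1 - |w|^2) / |w|^2. *)
pose P : 'rV[{poly {poly C}}]_n := \row_i \poly_(j < n) \poly_(k < m.+1) P0 i j (m - k)%N.
pose Q : 'rV[{poly {poly C}}]_m := \row_i \poly_(j < n.+1) \poly_(k < m) Q0 i j (m.-1 - k)%N.
have bP i : bidegree_lt (P 0 i) n m.+1.
  apply/bidegree_ltP => j k; rewrite mxE coef_poly; case: (ltnP j n) => jn; last by rewrite coef0.
  by rewrite coef_poly => /= mk; rewrite ltnNge mk.
have bQ i : bidegree_lt (Q 0 i) n.+1 m.
  apply/bidegree_ltP => j k; rewrite mxE coef_poly; case: (ltnP j n.+1) => jn; last by rewrite coef0.
  by rewrite coef_poly => /= mk; rewrite ltnNge mk.
pose F i j k := (P 0 i)`_j`_k; pose G i j k := (Q 0 i)`_j`_k.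
have FE i j k : (k <= m)%N -> F i j k = P0 i j (m - k)%N.
  move=> km; rewrite /F mxE coef_poly; case: ltnP => jn; last by rewrite coef0 HP ?jn.
  by rewrite coef_poly ltnS km.
have GE i j k : (j <= n)%N -> (k < m)%N -> G i j k = Q0 i j (m.-1 - k)%N.
  by move=> jn km; rewrite /G mxE coef_poly ltnS jn coef_poly km.
have G0 i j k : (m <= k)%N -> G i j k = 0.
  by move=> mk; have /bidegree_ltP := bQ i; apply; rewrite mk orbT.
have F0 i j k : (n <= j)%N -> F i j k = 0.
  by move=> nj; have /bidegree_ltP := bP i; apply; rewrite nj.
have gF j k j' k' : (k <= m)%N -> (k' <= m)%N ->
    gramf P0 j (m - k) j' (m - k') = gramf F j k j' k'.
  by move=> km km'; apply: eq_bigr => i _; rewrite !FE.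
have main j k j' k' : (j <= n)%N -> (k <= m)%N -> (j' <= n)%N -> (k' <= m)%N ->
    (p`_j`_k)^* * p`_j'`_k' *
      (a%:C%C * (n%:R - (j + j')%:R) + b%:C%C * ((k + k')%:R - m%:R)) =
    diffz (gramf F) j k j' k' - diffw (gramf G) j k j' k'.
  move=> jn km jn' km'; have := E j j' (m - k)%N (m - k')%N jn jn' (leq_subr _ _) (leq_subr _ _).
  rewrite /q !subKn //.
  have -> : m%:R - (m - k + (m - k'))%:R = (k + k')%:R - m%:R :> C.
    by rewrite !natrD !natrB //; ring.
  move=> ->; congr (_ + _).
    rewrite /diffz gF //; congr (_ - _).
    by case: j j' {jn jn'} => [|j] [|j'] //; rewrite gF.
  rewrite /diffw opprB; congr (_ - _).
    case: k km => [|k] km.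
      by rewrite /gramf big1 // => i _; rewrite subn0 HQ ?leqnn ?orbT // conjC0 mul0r.
    case: k' km' => [|k'] km'.
      by rewrite /gramf big1 // => i _; rewrite subn0 (HQ i j') ?leqnn ?orbT // mulr0.
    by apply: eq_bigr => i _; rewrite !GE // -!subn1 -!subnDA !add1n.
  move: km; rewrite leq_eqVlt => /orP[/eqP ->|km].
    by rewrite subnn /gramf big1 // => i _; rewrite G0 // conjC0 mul0r.
  move: km'; rewrite leq_eqVlt => /orP[/eqP ->|km'].
    rewrite subnn /gramf big1 => [|i _]; last by rewrite [G i j' m]G0 // mulr0.
    by case: (m - k)%N.
  have -> : (m - k = (m.-1 - k).+1)%N by lia.
  have -> : (m - k' = (m.-1 - k').+1)%N by lia.
  by apply: eq_bigr => i _; rewrite !GE.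
exists P, Q; split=> // z w Z W.
have bp : bidegree_lt p n.+1 m.+1 by split; rewrite ?sp ?sYp.
have be : bidegree_lt (euler a%:C%C b%:C%C p) n.+1 m.+1.
  apply/bidegree_ltP => j k h; rewrite coef_euler.
  by have /bidegree_ltP -> := bp; rewrite ?mulr0.
have wide1 d (T : 'rV[{poly {poly C}}]_d) N M : (N <= n.+1)%N -> (M <= m.+1)%N ->
    (forall i, bidegree_lt (T 0 i) N M) -> forall i, bidegree_lt (T 0 i) n.+1 m.+1.
  move=> Nn Mm H i; have [h1 h2] := H i.
  by split; [apply: leq_trans Nn | apply: leq_trans Mm].
rewrite -!(@evalk_prod _ n m) // -(evalk_gramf _ _ _ _ (wide1 _ _ _ _ (leqnSn n) (leqnn _) bP)).
rewrite -(evalk_gramf _ _ _ _ (wide1 _ _ _ _ (leqnn _) (leqnSn m) bQ)).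
rewrite -evalkZ -!evalkB -evalk_diffz => [|j k j' k' h]; last first.
  rewrite /gramf big1 // => i _; case/orP: h => h.
    by rewrite [X in X^*]F0 // conjC0 mul0r.
  by rewrite [X in _ * X]F0 // mulr0.
rewrite -evalk_diffw => [|j k j' k' h]; last first.
  rewrite /gramf big1 // => i _; case/orP: h => h.
    by rewrite [X in X^*]G0 // conjC0 mul0r.
  by rewrite [X in _ * X]G0 // mulr0.
rewrite -evalkB; apply: eq_evalk => j k j' k' jn km jn' km'.
rewrite -main // !coef_euler !rmorphM rmorphB !rmorphM /= !conjC_nat !realC !natrD.
by ring.
Qed.

End Polarized.

(** * Points of V where P and Q do not vanish *)

Section NonVanishing.
Variable R : realType.
Local Notation C := R[i].
Variables (n m : nat) (p : {poly {poly C}}) (a b : R).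
Hypotheses (hdist : defines_distinguished_variety p) (hne : zero_set p !=set0).
Hypotheses (ha : 0 <= a) (hb : 0 <= b) (hab : ~ (a = 0 /\ b = 0)).
Hypothesis hsf : product_of_distinct_irreducibles p.
Variables (P : 'rV[{poly {poly C}}]_n) (Q : 'rV[{poly {poly C}}]_m).
Hypothesis hpol : polarized p a b P Q.

Lemma off_torus_nonzero : exists z w, [/\ `|z| != 1, `|w| != 1, p.[z, w] = 0 &
  evalv P z w != 0 \/ evalv Q z w != 0].
Proof.
apply: contrapT => H.
have A0 : 0 <= a%:C%C :> C by rewrite lecR.
have B0 : 0 <= b%:C%C :> C by rewrite lecR.
apply: (euler_not_vanish A0 B0 (realC_neq0 hab) hdist hne hsf) => Z W W1 pZW.
have Z1 : `|Z| != 1.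
  case: (dist_cases hdist pZW) => [[z1 w1]|[z1 w1]|[z1 w1]].
  - by rewrite lt_eqF.
  - by rewrite w1 eqxx in W1.
  - by rewrite gt_eqF.
have P0 : evalv P Z W = 0 by apply/eqP/negPn/negP => h; apply: H; exists Z, W; split=> //; left.
have Q0 : evalv Q Z W = 0 by apply/eqP/negPn/negP => h; apply: H; exists Z, W; split=> //; right.
(* Pairing (Z, W) with a point (z, 0) outside V leaves only the term conj (euler p)(Z, W) p(z,
   0). *)
have [z pzw] := dist_vertical 0 hdist.
have := hpol z 0 Z W; rewrite P0 Q0 pZW conjC0 !mul0r mulr0 !linear0r.
rewrite !sub0r !mulr0 subr0 oppr0 add0r => /eqP.
by rewrite oppr_eq0 mulf_eq0 conjC_eq0 (negPf pzw) orbF => /eqP.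
Qed.

Lemma one_sub_norm_neq0 (z : C) : `|z| != 1 -> 1 - z^* * z != 0.
Proof. by rewrite -normCKC subr_eq0 [1 == _]eq_sym pexpr_eq1. Qed.

Lemma hpol_diag z w : p.[z, w] = 0 ->
  (1 - z^* * z) * dotmx (evalv P z w) (evalv P z w) =
  (1 - w^* * w) * dotmx (evalv Q z w) (evalv Q z w).
Proof.
move=> pzw; have /esym/eqP := hpol z w z w.
by rewrite pzw conjC0 !mul0r !mulr0 subrr subr0 subr_eq0 => /eqP.
Qed.

(** Off the torus neither 1 - |z|^2 nor 1 - |w|^2 vanishes, so the diagonal identity makes P and Q
    vanish at the same points of V there. *)
Lemma sos_nonzero :
  (exists z w, p.[z, w] = 0 /\ evalv P z w != 0) /\
  (exists z w, p.[z, w] = 0 /\ evalv Q z w != 0).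
Proof.
have [z [w [z1 w1 pzw PQ]]] := off_torus_nonzero.
suff : (evalv P z w != 0) && (evalv Q z w != 0).
  by case/andP => PN QN; split; exists z, w.
have E := hpol_diag pzw.
have [P0|PN] := eqVneq (evalv P z w) 0; have [Q0|QN] := eqVneq (evalv Q z w) 0 => //.
- by case: PQ; rewrite ?P0 ?Q0 eqxx.
- move/eqP: E; rewrite P0 linear0r mulr0 eq_sym mulf_eq0 (negPf (one_sub_norm_neq0 w1)).
  by rewrite dnorm_eq0 (negPf QN).
- move/eqP: E; rewrite Q0 linear0r mulr0 mulf_eq0 (negPf (one_sub_norm_neq0 z1)).
  by rewrite dnorm_eq0 (negPf PN).
Qed.

End NonVanishing.

(** * Unitary changes of coordinates *)

Section Rotation.
Variable C : numClosedFieldType.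
Variable d : nat.
Implicit Types (T : 'rV[{poly {poly C}}]_d) (U : 'M[C]_d).

Definition rotate T U : 'rV[{poly {poly C}}]_d := T *m map_mx (fun c => c%:P%:P) U.

Lemma evalv_rotate T U z w : evalv (rotate T U) z w = evalv T z w *m U.
Proof.
apply/rowP => j; rewrite !mxE !horner_sum; apply: eq_bigr => i _.
by rewrite !mxE !hornerM !hornerC.
Qed.

Lemma dotmx_rotate T U z w Z W : U *m U^t* = 1%:M ->
  dotmx (evalv (rotate T U) z w) (evalv (rotate T U) Z W) =
  dotmx (evalv T z w) (evalv T Z W).
Proof.
by move=> UU; rewrite !evalv_rotate !dotmxE ctM mulmxA -[_ *m U *m _]mulmxA UU mulmx1.
Qed.

Lemma bidegree_rotate T U N M : (forall j, bidegree_lt (T 0 j) N M) ->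
  forall j, bidegree_lt (rotate T U 0 j) N M.
Proof.
move=> H j; apply/bidegree_ltP => i k h; rewrite mxE coef_sum coef_sum big1 // => l _.
rewrite mxE coefMC coefMC.
by have /bidegree_ltP -> := H l; rewrite ?mul0r.
Qed.

Lemma rotate_nonvanishing T z w : evalv T z w != 0 ->
  exists U, U *m U^t* = 1%:M /\ forall j, (rotate T U 0 j).[z, w] != 0.
Proof.
move=> /unitary_no_zero_entry[U [UU H]]; exists U; split=> // j.
by have := H j; rewrite -evalv_rotate /evalv [(\row__ _) 0 j]mxE.
Qed.

End Rotation.

Lemma eucl_norm_sq (C : numClosedFieldType) d (u : 'rV[C]_d) : eucl_norm u ^+ 2 = dotmx u u.
Proof. exact: sqrtCK. Qed.

Lemma polarized_diag (R : realType) n m (p : {poly {poly R[i]}}) (a b : R) P Q z w :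
  @polarized R n m p a b P Q ->
  (b%:C * m%:R - a%:C * n%:R)%C * `|p.[z, w]| ^+ 2
       + 2 * 'Re ((a%:C%C * z * (dz p).[z, w] - b%:C%C * w * (dw p).[z, w])
                  * (p.[z, w])^*)
       + (1 - `|z| ^+ 2) * eucl_norm (evalv P z w) ^+ 2
       = (1 - `|w| ^+ 2) * eucl_norm (evalv Q z w) ^+ 2.
Proof.
move=> /(_ z w z w); rewrite -horner_euler !eucl_norm_sq !normCKC.
set x := dotmx _ _; set y := dotmx _ _; set e := (euler _ _ _).[z, w]; set f := p.[z, w] => E.
have -> : 2 * 'Re (e * f^*) = e * f^* + f * e^*.
  rewrite ReE mulrC divfK ?pnatr_eq0 // rmorphM /= conjCK; ring.
have {E}E : x * (1 - z^* * z) = (a%:C%C * n%:R - b%:C%C * m%:R) * (f^* * f) -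
  f^* * e - e^* * f + (1 - w^* * w) * y by rewrite E; ring.
by rewrite [(1 - z^* * z) * x]mulrC E; ring.
Qed.

Theorem theorem2p17 (R : realType) (n m : nat) (p : {poly {poly R[i]}})
    (hdeg : has_bidegree p n m)
    (hdist : defines_distinguished_variety p)
    (hne : zero_set p !=set0)
    (a b : R) (ha : 0 <= a) (hb : 0 <= b) (hab : ~ (a = 0 /\ b = 0)) :
  exists (P : 'rV[{poly {poly R[i]}}]_n) (Q : 'rV[{poly {poly R[i]}}]_m),
    (forall j, bidegree_lt (P 0 j) n m.+1) /\
    (forall j, bidegree_lt (Q 0 j) n.+1 m) /\
    (forall z w : R[i],
       (b%:C * m%:R - a%:C * n%:R)%C * `|p.[z, w]| ^+ 2
       + 2 * 'Re ((a%:C%C * z * (dz p).[z, w] - b%:C%C * w * (dw p).[z, w])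
                  * (p.[z, w])^*)
       + (1 - `|z| ^+ 2) * eucl_norm (evalv P z w) ^+ 2
       = (1 - `|w| ^+ 2) * eucl_norm (evalv Q z w) ^+ 2) /\
    (product_of_distinct_irreducibles p ->
       (forall j, ~ (forall x, zero_set p x -> (P 0 j).[x.1, x.2] = 0)) /\
       (forall j, ~ (forall x, zero_set p x -> (Q 0 j).[x.1, x.2] = 0))) /\
    (forall z w Z W : R[i], zero_set p (z, w) -> zero_set p (Z, W) ->
       (1 - z * Z^*) * dotmx (evalv P z w) (evalv P Z W)
       = (1 - w * W^*) * dotmx (evalv Q z w) (evalv Q Z W)).
Proof.
have [P0 [Q0 [bP0 bQ0 pol0]]] := polarized_sos hdeg hdist ha hb hab.
have [P [Q [bP bQ pol nv]]] : exists (P : 'rV[{poly {poly R[i]}}]_n)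
    (Q : 'rV[{poly {poly R[i]}}]_m),
    [/\ forall j, bidegree_lt (P 0 j) n m.+1, forall j, bidegree_lt (Q 0 j) n.+1 m,
        polarized p a b P Q &
        product_of_distinct_irreducibles p ->
        (forall j, ~ (forall x, zero_set p x -> (P 0 j).[x.1, x.2] = 0)) /\
        (forall j, ~ (forall x, zero_set p x -> (Q 0 j).[x.1, x.2] = 0))].
  have [hsf|] := pselect (product_of_distinct_irreducibles p); last by exists P0, Q0.
  have [[z [w [pzw Pzw]]] [Z [W [pZW QZW]]]] := sos_nonzero hdist hne ha hb hab hsf pol0.
  have [U [UU HU]] := rotate_nonvanishing Pzw.
  have [V [VV HV]] := rotate_nonvanishing QZW.
  exists (rotate P0 U), (rotate Q0 V); split.
  - exact: bidegree_rotate.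
  - exact: bidegree_rotate.
  - by move=> x y X Y; rewrite !dotmx_rotate.
  - by move=> _; split=> j H;
      [have := HU j; rewrite (H (z, w)) // | have := HV j; rewrite (H (Z, W)) //];
      rewrite eqxx.
exists P, Q; do 2![split=> //]; split; first by move=> z w; apply: polarized_diag.
split=> // z w Z W pzw pZW; have := pol z w Z W.
rewrite pzw pZW conjC0 !mul0r !mulr0 !subr0 => /esym/eqP.
by rewrite subr_eq0 => /eqP; rewrite mulrC [W^* * w]mulrC [Z^* * z]mulrC mulrC.
Qed.
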